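(* Let $0<p\leq q<\infty$ and let $g,\psi$ be nonconstant entire functions on $\mathbb{C}$. Define $$M_{(g,\psi)}(z)=\frac{|g'(z)|}{1+|z|}e^{\frac12(|\psi(z)|^2-|z|^2)},\qquad \widetilde M_{(g,\psi)}(z)=\frac{|g(z)|(1+|\psi(z)|)}{1+|z|}e^{\frac12(|\psi(z)|^2-|z|^2)}.$$ Then: (i) $V_{(g,\psi)}:\mathcal{F}_p\to\mathcal{F}_q$ is bounded if and only if $M_{(g,\psi)}\in L^\infty(\mathbb{C},dA)$; (ii) $V_{(g,\psi)}:\mathcal{F}_p\to\mathcal{F}_q$ is compact if and only if $\lim_{|z|\to\infty}M_{(g,\psi)}(z)=0$; (iii) $J_{(g,\psi)}:\mathcal{F}_p\to\mathcal{F}_q$ is bounded if and only if $\widetilde M_{(g,\psi)}\in L^\infty(\mathbb{C},dA)$; (iv) $J_{(g,\psi)}:\mathcal{F}_p\to\mathcal{F}_q$ is compact if and only if $\lim_{|z|\to\infty}\widetilde M_{(g,\psi)}(z)=0$.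
   Context: $dA$ is Lebesgue area measure on $\mathbb{C}$. For $0<p<\infty$, the Fock space $\mathcal{F}_p$ is the space of entire functions $f$ with $\|f\|_p^p=\frac{p}{2\pi}\int_{\mathbb{C}}|f(z)|^pe^{-\frac p2|z|^2}\,dA(z)<\infty$. For entire $g,\psi$, the generalized Volterra-type operators are $V_{(g,\psi)}f(z)=\int_0^z f(\psi(w))g'(w)\,dw$ and $J_{(g,\psi)}f(z)=\int_0^z f'(\psi(w))g(w)\,dw$. *)

(* Defs.v *)
From Stdlib Require Import Reals.
From Coquelicot Require Import Coquelicot.
From mathcomp Require Import all_boot all_algebra.
From mathcomp Require Import all_classical all_reals all_analysis.
From mathcomp Require Import Rstruct Rstruct_topology.

Set Implicit Arguments.
Unset Strict Implicit.
Unset Printing Implicit Defensive.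

Local Open Scope R_scope.

Definition area := ((@lebesgue_measure R) \x (@lebesgue_measure R))%E.

Definition entire (f : C -> C) : Prop := forall z : C, Coquelicot.Derive.ex_derive f z.

(** The complex derivative f' (meaningful when f is entire). *)
Definition Cderiv (f : C -> C) (z : C) : C :=
  @Coquelicot.Hierarchy.iota C_CompleteNormedModule (fun l : C => Coquelicot.Derive.is_derive f z l).

(** x^p for x >= 0 and real p, with 0^p = 0 for p > 0 (MathComp's powR). *)
Definition rpow (x p : R) : R := powR x p.

Definition fock_integral (p : R) (f : C -> C) : \bar R :=
  (\int[area]_(z in setT)
     (rpow (Cmod (f z)) p * exp (- (p / 2) * (Cmod z) ^ 2))%:E)%E.

Definition in_Fock (p : R) (f : C -> C) : Prop :=
  entire f /\ (fock_integral p f < +oo)%E.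

Definition fock_norm (p : R) (f : C -> C) : R :=
  rpow (p / (2 * PI) * fine (fock_integral p f)) (1 / p).

(** Complex line integral from 0 to z along the segment [0,z]:
    int_0^z h(w) dw = int_0^1 h(t z) z dt. *)
Definition cint0 (h : C -> C) (z : C) : C :=
  @RInt C_R_CompleteNormedModule
    (fun t : R => Cmult (h (Cmult (RtoC t) z)) z) 0 1.

Definition Vop (g psi : C -> C) (f : C -> C) : C -> C :=
  cint0 (fun w => Cmult (f (psi w)) (Cderiv g w)).

Definition Jop (g psi : C -> C) (f : C -> C) : C -> C :=
  cint0 (fun w => Cmult (Cderiv f (psi w)) (g w)).

Definition bounded_op (p q : R) (T : (C -> C) -> (C -> C)) : Prop :=
  (forall f, in_Fock p f -> in_Fock q (T f)) /\
  exists K : R, forall f, in_Fock p f -> fock_norm q (T f) <= K * fock_norm p f.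

Definition compact_op (p q : R) (T : (C -> C) -> (C -> C)) : Prop :=
  (forall f, in_Fock p f -> in_Fock q (T f)) /\
  forall fn : nat -> C -> C,
    (forall n, in_Fock p (fn n)) ->
    (exists B : R, forall n, fock_norm p (fn n) <= B) ->
    exists (phi : nat -> nat) (h : C -> C),
      (forall n, (phi n < phi (S n))%nat) /\ in_Fock q h /\
      is_lim_seq (fun k => fock_norm q (fun z => Cminus (T (fn (phi k)) z) (h z))) 0.

Definition Mgp (g psi : C -> C) (z : C) : R :=
  Cmod (Cderiv g z) / (1 + Cmod z) * exp (/ 2 * ((Cmod (psi z)) ^ 2 - (Cmod z) ^ 2)).

Definition Mtgp (g psi : C -> C) (z : C) : R :=
  Cmod (g z) * (1 + Cmod (psi z)) / (1 + Cmod z)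
  * exp (/ 2 * ((Cmod (psi z)) ^ 2 - (Cmod z) ^ 2)).

Definition in_Linfty (M : C -> R) : Prop :=
  exists K : R, {ae area, forall z : R * R, Rabs (M z) <= K}.

Definition vanishes_at_infinity (M : C -> R) : Prop :=
  forall eps : R, 0 < eps -> exists r : R, forall z : C, r < Cmod z -> Rabs (M z) < eps.

Definition nonconstant (f : C -> C) : Prop := ~ exists c : C, forall z, f z = c.

(* Main.v *)
Require Import Defs.
From mathcomp Require Import ssreflect.
From Stdlib Require Import Reals Lra Lia Classical ClassicalEpsilon.
From Coquelicot Require Import Coquelicot.
Local Open Scope R_scope.

(** Differentiating [T f = int_0^z D f(psi) gam] shows that [(T f)'(z)], measured in the weight
    [(1 + |z|) e^{|z|^2/2}], is the normalised value of [D f] at [psi z] times the symbol [M z].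
    Necessity: by Cauchy's estimate on a disc of radius comparable to [1/(1 + |z|)], a bound for
    [T f] near [z] bounds [(T f)'(z)] in that weight, and normalised reproducing kernels centred
    at [psi z] make the value of [D f] there as large as possible.
    Sufficiency: if [M] is bounded then [|gam| e^{(|psi|^2-|z|^2)/2} = O(1 + |z|)], which forces
    [psi z = a z + b] with [0 < |a| <= 1].  The value of [D f] at [psi z] is bounded by the local
    L^p-average of [f e^{-|z|^2/2}] around [a z + b]; integrating [(T f)'] along the ray from [0]
    to [z], the part of the ray at distance at least 1 from [z] is exponentially negligible, so
    that [T f] satisfies the same pointwise bound, up to an integrable error.  As [p <= q], the
    L^q-norm of the local averages is controlled by the L^p-norm of [f] after the affine change
    of variables.  For compactness, Montel's theorem gives a locally uniform limit, and the
    estimate is split into [|z| <= rho], where convergence is uniform, and [|z| > rho], where [M]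
    is small. *)

(** * Complex differentiability *)

(** The scale [1 / (1 + |z|)] is the one on which [|z|^2] varies by a bounded amount, so that the
    Gaussian weight is constant there up to a factor; the [1 + |z|] in the denominator of both
    symbols comes from it. The range [0 < p] leaves neither convexity nor duality to rely on:
    everything rests on bounding [|f c|^p] by the area mean of [|f|^p]. Area is a product measure,
    so means are taken over squares and the Cauchy theory starts from rectangles; circles enter
    through the exponential map. Affineness of [psi] is a rigidity statement: where [gam] does not
    vanish, the growth bound lets [|psi'|^k] grow at most like [sqrt k], so [|psi'| <= 1] there,
    hence everywhere, and Liouville's theorem applies. A nonconstant [psi] has nonzero slope, which
    keeps the cost of the change of variables finite. Necessity for compactness does not go through
    weakly null sequences: images of test functions at escaping points are compared with their
    limit, whose weighted modulus decays at infinity. *)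

Definition cdiff (f : C -> C) (z l : C) : Prop :=
  forall eps, 0 < eps -> exists delta, 0 < delta /\
    forall w, Cmod (w - z) < delta ->
      Cmod (f w - f z - l * (w - z)) <= eps * Cmod (w - z).

Lemma cdiff_derive (f : C -> C) (z l : C) :
  cdiff f z l <-> @is_derive C_AbsRing C_NormedModule f z l.
Proof.
split.
- move=> H; split.
    exact: (@is_linear_scal_l C_AbsRing C_NormedModule l).
  move=> x Hx.
  have <- : z = x by exact: (@is_filter_lim_locally_unique C_AbsRing (AbsRing_NormedModule C_AbsRing) z x Hx).
  move=> eps.
  have [d [Hd Hw]] := H eps (cond_pos eps).
  exists (mkposreal d Hd) => y Hy.
  have := Hw y Hy.
  by rewrite (Cmult_comm l).
- move=> [_ H] eps Heps.
  have [d Hd] := H z (fun P HP => HP) (mkposreal eps Heps).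
  exists d; split; first exact: cond_pos.
  move=> w Hw; have := Hd w Hw.
  by rewrite (Cmult_comm l).
Qed.

(** The product and chain rules live on the module structure of an absolute ring over itself,
    [entire] on [C_NormedModule]; the epsilon form [cdiff] passes between the two. *)
Lemma cdiff_derive_abs (f : C -> C) (z l : C) :
  cdiff f z l <-> @is_derive C_AbsRing (AbsRing_NormedModule C_AbsRing) f z l.
Proof.
split.
- move=> H; split.
    exact: (@is_linear_scal_l C_AbsRing (AbsRing_NormedModule C_AbsRing) l).
  move=> x Hx.
  have <- : z = x by exact: (@is_filter_lim_locally_unique C_AbsRing (AbsRing_NormedModule C_AbsRing) z x Hx).
  move=> eps.
  have [d [Hd Hw]] := H eps (cond_pos eps).
  exists (mkposreal d Hd) => y Hy.
  have := Hw y Hy.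
  by rewrite (Cmult_comm l).
- move=> [_ H] eps Heps.
  have [d Hd] := H z (fun P HP => HP) (mkposreal eps Heps).
  exists d; split; first exact: cond_pos.
  move=> w Hw; have := Hd w Hw.
  by rewrite (Cmult_comm l).
Qed.

Lemma cdiff_unique f z l1 l2 : cdiff f z l1 -> cdiff f z l2 -> l1 = l2.
Proof.
move=> /cdiff_derive H1 /cdiff_derive H2.
by rewrite -(is_C_derive_unique _ _ _ H1) (is_C_derive_unique _ _ _ H2).
Qed.

Lemma cdiff_Cderiv f z l : cdiff f z l -> Cderiv f z = l.
Proof.
move=> H; apply: (cdiff_unique f z) => //.
apply/cdiff_derive.
apply: (@iota_correct C_AbsRing C_CompleteNormedModule
  (fun l : C => @is_derive C_AbsRing C_NormedModule f z l)).
exists l; split; first exact/cdiff_derive.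
by move=> l' /cdiff_derive H'; apply: cdiff_unique H'.
Qed.

Lemma entire_cdiff f : entire f <-> forall z, cdiff f z (Cderiv f z).
Proof.
split=> H z.
- have [l /cdiff_derive Hl] := H z.
  by rewrite (cdiff_Cderiv f z l).
- by exists (Cderiv f z); apply/cdiff_derive.
Qed.

Lemma entireP f g : (forall z, cdiff f z (g z)) -> entire f.
Proof. by move=> H z; exists (g z); apply/cdiff_derive. Qed.

Lemma cdiff_ext f g z l : (forall w, f w = g w) -> cdiff f z l -> cdiff g z l.
Proof.
by move=> E H eps /H [d [? K]]; exists d; split => // w /K; rewrite !E.
Qed.

Lemma cdiff_ext_loc f g z l r : 0 < r ->
  (forall w, Cmod (w - z) < r -> f w = g w) -> cdiff f z l -> cdiff g z l.
Proof.
move=> Hr E H eps /H [d [? K]]; exists (Rmin d r).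
split; first exact: Rmin_glb_lt.
move=> w Hw; rewrite -!E; first by apply: K; apply: Rlt_le_trans Hw (Rmin_l _ _).
  by rewrite (_ : (z - z = 0)%C) ?Cmod_0 //; ring.
exact: Rlt_le_trans Hw (Rmin_r _ _).
Qed.

Lemma cdiff_const c z : cdiff (fun _ => c) z 0%C.
Proof.
move=> eps He; exists 1; split; first lra.
move=> w _; rewrite (_ : (c - c - 0 * (w - z) = 0)%C) ?Cmod_0; last by ring.
by apply: Rmult_le_pos; [lra | apply: Cmod_ge_0].
Qed.

Lemma cdiff_id z : cdiff (fun w => w) z 1%C.
Proof.
move=> eps He; exists 1; split; first lra.
move=> w _; rewrite (_ : (w - z - 1 * (w - z) = 0)%C) ?Cmod_0; last by ring.
by apply: Rmult_le_pos; [lra | apply: Cmod_ge_0].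
Qed.

Lemma cdiff_plus f g z l k : cdiff f z l -> cdiff g z k ->
  cdiff (fun w => f w + g w)%C z (l + k)%C.
Proof.
move=> /cdiff_derive Hf /cdiff_derive Hg; apply/cdiff_derive.
exact: is_derive_plus Hf Hg.
Qed.

Lemma cdiff_mult f g z l k : cdiff f z l -> cdiff g z k ->
  cdiff (fun w => f w * g w)%C z (l * g z + f z * k)%C.
Proof.
move=> /cdiff_derive_abs Hf /cdiff_derive_abs Hg; apply/cdiff_derive_abs.
exact: is_derive_mult Hf Hg Cmult_comm.
Qed.

Lemma cdiff_comp f g z l k : cdiff f (g z) l -> cdiff g z k ->
  cdiff (fun w => f (g w)) z (k * l)%C.
Proof.
move=> /cdiff_derive_abs Hf /cdiff_derive_abs Hg; apply/cdiff_derive_abs.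
exact: is_derive_comp Hf Hg.
Qed.

Lemma cdiff_eq f z l k : l = k -> cdiff f z l -> cdiff f z k.
Proof. by move=> ->. Qed.

Lemma cdiff_scal c f z l : cdiff f z l -> cdiff (fun w => c * f w)%C z (c * l)%C.
Proof.
move=> H; apply: cdiff_eq (cdiff_mult _ _ _ _ _ (cdiff_const c z) H); ring.
Qed.

Lemma cdiff_minus f g z l k : cdiff f z l -> cdiff g z k ->
  cdiff (fun w => f w - g w)%C z (l - k)%C.
Proof.
move=> Hf Hg.
apply: (cdiff_eq _ _ (l + (-(1)) * k)%C); first by ring.
apply: (cdiff_ext (fun w => f w + (-(1)) * g w)%C); first by move=> w; ring.
exact: cdiff_plus Hf (cdiff_scal _ _ _ _ Hg).
Qed.

Definition ccont (f : C -> C) (z : C) : Prop :=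
  forall eps, 0 < eps -> exists delta, 0 < delta /\
    forall w, Cmod (w - z) < delta -> Cmod (f w - f z) < eps.

Lemma cdiff_ccont f z l : cdiff f z l -> ccont f z.
Proof.
move=> H eps Heps.
have [d [Hd K]] := H 1 Rlt_0_1.
have Hl := Cmod_ge_0 l.
exists (Rmin d (eps / (2 + Cmod l))); split.
  by apply: Rmin_glb_lt => //; apply: Rdiv_lt_0_compat; lra.
move=> w Hw.
have /K Hk : Cmod (w - z) < d by apply: Rlt_le_trans Hw (Rmin_l _ _).
have H2 : Cmod (w - z) < eps / (2 + Cmod l) by apply: Rlt_le_trans Hw (Rmin_r _ _).
have -> : (f w - f z = (f w - f z - l * (w - z)) + l * (w - z))%C by ring.
apply: Rle_lt_trans (Cmod_triangle _ _) _; rewrite Cmod_mult.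
have : Cmod (w - z) * (2 + Cmod l) < eps.
  by apply/Rlt_div_r; lra.
have := Cmod_ge_0 (w - z); lra.
Qed.

Lemma entire_ccont f z : entire f -> ccont f z.
Proof. by move=> /entire_cdiff /(_ z); apply: cdiff_ccont. Qed.

Lemma entire_const c : entire (fun _ => c).
Proof. by apply: entireP => z; apply: cdiff_const. Qed.

Lemma entire_id : entire (fun w => w).
Proof. by apply: entireP => z; apply: cdiff_id. Qed.

Lemma entire_plus f g : entire f -> entire g -> entire (fun w => f w + g w)%C.
Proof.
move=> /entire_cdiff Hf /entire_cdiff Hg.
by apply: entireP => z; apply: cdiff_plus (Hf z) (Hg z).
Qed.

Lemma entire_minus f g : entire f -> entire g -> entire (fun w => f w - g w)%C.
Proof.
move=> /entire_cdiff Hf /entire_cdiff Hg.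
by apply: entireP => z; apply: cdiff_minus (Hf z) (Hg z).
Qed.

Lemma entire_mult f g : entire f -> entire g -> entire (fun w => f w * g w)%C.
Proof.
move=> /entire_cdiff Hf /entire_cdiff Hg.
by apply: entireP => z; apply: cdiff_mult (Hf z) (Hg z).
Qed.

Lemma entire_comp f g : entire f -> entire g -> entire (fun w => f (g w)).
Proof.
move=> /entire_cdiff Hf /entire_cdiff Hg.
by apply: entireP => z; apply: cdiff_comp (Hf _) (Hg z).
Qed.

Lemma entire_ext f g : (forall w, f w = g w) -> entire f -> entire g.
Proof.
by move=> E /entire_cdiff H; apply: entireP => z; apply: cdiff_ext (H z).
Qed.

(** * Powers and the complex exponential *)

Fixpoint cpow (z : C) (n : nat) : C := if n is S m then (z * cpow z m)%C else 1%C.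

Lemma Cmod_cpow z n : Cmod (cpow z n) = Cmod z ^ n.
Proof. by elim: n => [|n IH] /=; rewrite ?Cmod_1 // Cmod_mult IH. Qed.

Lemma entire_cpow f n : entire f -> entire (fun w => cpow (f w) n).
Proof.
move=> Hf; elim: n => [|n IH] /=; first exact: entire_const.
exact: entire_mult.
Qed.

Definition cexp (z : C) : C := (exp (fst z) * cos (snd z), exp (fst z) * sin (snd z)).

Lemma cexp_plus z w : cexp (z + w) = (cexp z * cexp w)%C.
Proof.
rewrite /cexp /Cmult /Cplus /= exp_plus cos_plus sin_plus.
by congr pair; ring.
Qed.

Lemma cexp_0 : cexp 0 = 1%C.
Proof. by rewrite /cexp /= exp_0 cos_0 sin_0; congr pair; ring. Qed.

Lemma Cmod_cexp z : Cmod (cexp z) = exp (fst z).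
Proof.
rewrite /Cmod /cexp /=.
have -> : exp (fst z) * cos (snd z) * (exp (fst z) * cos (snd z) * 1) +
    exp (fst z) * sin (snd z) * (exp (fst z) * sin (snd z) * 1) =
    exp (fst z) ^ 2 * ((sin (snd z))² + (cos (snd z))²) by rewrite /Rsqr; ring.
rewrite sin2_cos2 Rmult_1_r sqrt_pow2 //.
by apply: Rlt_le; apply: exp_pos.
Qed.

Lemma cexp_neq0 z : cexp z <> 0%C.
Proof.
by move=> H; have := exp_pos (fst z); rewrite -Cmod_cexp H Cmod_0; lra.
Qed.

Lemma derivable_pt_lim_eps f x l : derivable_pt_lim f x l ->
  forall eps, 0 < eps -> exists delta, 0 < delta /\
    forall h, Rabs h < delta -> Rabs (f (x + h) - f x - l * h) <= eps * Rabs h.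
Proof.
move=> H eps He; have [d Hd] := H eps He.
exists d; split; first exact: cond_pos.
move=> h Hh; case: (Req_dec h 0) => [->|h0].
  by rewrite Rplus_0_r Rabs_R0 (_ : _ - _ - _ = 0) ?Rabs_R0; lra.
have -> : f (x + h) - f x - l * h = ((f (x + h) - f x) / h - l) * h by field.
rewrite Rabs_mult; apply: Rmult_le_compat_r; first exact: Rabs_pos.
by apply: Rlt_le; apply: Hd.
Qed.

Lemma Cmod_le_Rabs (z : C) : Cmod z <= Rabs (fst z) + Rabs (snd z).
Proof.
rewrite {1}(_ : z = (RtoC (fst z) + Ci * RtoC (snd z))%C).
  apply: Rle_trans (Cmod_triangle _ _) _.
  by rewrite Cmod_mult !Cmod_R Cmod_Ci; lra.
by case: z => a b; rewrite /Cplus /Cmult /=; congr pair; ring.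
Qed.

Lemma Rabs_fst_Cmod (z : C) : Rabs (fst z) <= Cmod z.
Proof. exact: Rle_trans (Rmax_l _ _) (Rmax_Cmod z). Qed.

Lemma Rabs_snd_Cmod (z : C) : Rabs (snd z) <= Cmod z.
Proof. exact: Rle_trans (Rmax_r _ _) (Rmax_Cmod z). Qed.

Lemma cdiff_cexp0 : cdiff cexp 0 1.
Proof.
(* The errors [B1], [B2], [B6] and [B3] below add up to [(1 + 2 + 4 + 1) * e * m], whence [e0 / 8];
   the cap at 1 absorbs products of small terms. *)
move=> e0 He0; set e := Rmin (e0 / 8) 1.
have He : 0 < e by apply: Rmin_glb_lt; lra.
have He1 : e <= 1 by apply: Rmin_r.
have Hee : e <= e0 / 8 by apply: Rmin_l.
have [d1 [Hd1 K1]] := derivable_pt_lim_eps _ _ _ (derivable_pt_lim_exp 0) e He.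
have [d2 [Hd2 K2]] := derivable_pt_lim_eps _ _ _ (derivable_pt_lim_cos 0) e He.
have [d3 [Hd3 K3]] := derivable_pt_lim_eps _ _ _ (derivable_pt_lim_sin 0) e He.
rewrite exp_0 in K1; rewrite cos_0 sin_0 in K2; rewrite cos_0 sin_0 in K3.
exists (Rmin e (Rmin d1 (Rmin d2 d3))); split.
  by do 3 (apply: Rmin_glb_lt => //).
move=> [a b]; rewrite (_ : ((a, b) - 0 = (a, b))%C); last by ring.
move=> H.
have [Ha Hb] := (Rabs_fst_Cmod (a, b), Rabs_snd_Cmod (a, b)); rewrite /= in Ha Hb.
have Hm1 := Rmin_l e (Rmin d1 (Rmin d2 d3)).
have Hm2 := Rmin_r e (Rmin d1 (Rmin d2 d3)).
have Hm3 := Rmin_l d1 (Rmin d2 d3).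
have Hm4 := Rmin_r d1 (Rmin d2 d3).
have Hm5 := Rmin_l d2 d3.
have Hm6 := Rmin_r d2 d3.
have {}K1 := K1 a ltac:(lra).
have {}K2 := K2 b ltac:(lra).
have {}K3 := K3 b ltac:(lra).
rewrite !Rplus_0_l in K1 K2 K3.
set m := Cmod (a, b) in Ha Hb H *.
apply: Rle_trans (Cmod_le_Rabs _) _.
rewrite cexp_0 /cexp /Cmult /= .
have -> : exp a * cos b + - (1) + - (1 * a - 0 * b) =
  (exp a - 1 - 1 * a) * cos b + (cos b - 1 - -0 * b) * (1 + a) by ring.
have -> : exp a * sin b + - 0 + - (1 * b + 0 * a) =
  ((exp a - 1 - 1 * a) + a) * ((sin b - 0 - 1 * b) + b) + (sin b - 0 - 1 * b) by ring.
have Hcos : Rabs (cos b) <= 1 by apply: Rabs_le; apply: COS_bound.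
have B1 : Rabs ((exp a - 1 - 1 * a) * cos b) <= e * m.
  rewrite Rabs_mult -[e * m]Rmult_1_r; apply: Rmult_le_compat => //; try exact: Rabs_pos.
  by apply: Rle_trans K1 _; apply: Rmult_le_compat_l; lra.
have Ha1 : Rabs a <= 1 by lra.
have B2 : Rabs ((cos b - 1 - -0 * b) * (1 + a)) <= e * m * 2.
  rewrite Rabs_mult; apply: Rmult_le_compat => //; try exact: Rabs_pos.
    by apply: Rle_trans K2 _; apply: Rmult_le_compat_l; lra.
  by apply: Rle_trans (Rabs_triang _ _) _; rewrite Rabs_R1; lra.
have B3 : Rabs (sin b - 0 - 1 * b) <= e * m.
  by apply: Rle_trans K3 _; apply: Rmult_le_compat_l; lra.
have B4 : Rabs ((exp a - 1 - 1 * a) + a) <= 2 * e.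
  apply: Rle_trans (Rabs_triang _ _) _.
  have : e * Rabs a <= 1 * Rabs a by apply: Rmult_le_compat_r; [apply: Rabs_pos | lra].
  lra.
have B5 : Rabs ((sin b - 0 - 1 * b) + b) <= 2 * m.
  apply: Rle_trans (Rabs_triang _ _) _.
  have : e * m <= 1 * m by apply: Rmult_le_compat_r; [apply: Cmod_ge_0 | lra].
  lra.
have B6 : Rabs (((exp a - 1 - 1 * a) + a) * ((sin b - 0 - 1 * b) + b)) <= 2 * e * (2 * m).
  by rewrite Rabs_mult; apply: Rmult_le_compat => //; apply: Rabs_pos.
have := Rabs_triang ((exp a - 1 - 1 * a) * cos b) ((cos b - 1 - -0 * b) * (1 + a)).
have := Rabs_triang (((exp a - 1 - 1 * a) + a) * ((sin b - 0 - 1 * b) + b)) (sin b - 0 - 1 * b).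
have Hm : 0 <= m by apply: Cmod_ge_0.
have : e * m <= e0 / 8 * m by apply: Rmult_le_compat_r.
lra.
Qed.

Lemma cdiff_cexp z : cdiff cexp z (cexp z).
Proof.
apply: (cdiff_ext (fun w => cexp z * cexp (w - z))%C).
  by move=> w; rewrite -cexp_plus; congr cexp; ring.
apply: (cdiff_eq _ _ (cexp z * ((1 - 0) * 1))%C); first by ring.
apply: cdiff_scal; apply: (cdiff_comp cexp (fun w => w - z)%C).
  rewrite (_ : (z - z = 0)%C); [exact: cdiff_cexp0 | ring].
exact: cdiff_minus (cdiff_id z) (cdiff_const z z).
Qed.

Lemma entire_cexp : entire cexp.
Proof. exact: entireP cdiff_cexp. Qed.

Lemma cexp_opp z : (cexp (- z) * cexp z = 1)%C.
Proof. by rewrite -cexp_plus -cexp_0; congr cexp; ring. Qed.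

(** * Curve integrals and Goursat's theorem *)

Notation ccontinuous g t := (@continuous R_UniformSpace C_UniformSpace g t).
Notation CI g a b := (@RInt C_R_CompleteNormedModule g a b).

Lemma rc_eps (g : R -> C) t : ccontinuous g t <->
  forall eps, 0 < eps -> exists d, 0 < d /\
    forall s, Rabs (s - t) < d -> Cmod (g s - g t) < eps.
Proof.
split.
- move=> H eps He.
  have H2 : 0 < sqrt 2 by apply: sqrt_lt_R0; lra.
  have He' : 0 < eps / sqrt 2 by apply: Rdiv_lt_0_compat.
  have [d Hd] := proj1 (@filterlim_locally R C_UniformSpace (locally t) _ g (g t)) H (mkposreal _ He').
  exists d; split; first exact: cond_pos.
  move=> s Hs.
  have := C_NormedModule_mixin_compat2 _ _ _ (Hd s Hs) => /=.
  have -> : sqrt 2 * (eps / sqrt 2) = eps by field; lra.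
  by [].
- move=> H; apply/filterlim_locally => eps.
  have [d [Hd K]] := H eps (cond_pos eps).
  exists (mkposreal d Hd) => s Hs.
  by apply: C_NormedModule_mixin_compat1; apply: K.
Qed.

Lemma rc_comp (f : C -> C) (g : R -> C) t :
  ccont f (g t) -> ccontinuous g t -> ccontinuous (fun s => f (g s)) t.
Proof.
move=> Hf /rc_eps Hg; apply/rc_eps => eps /Hf [d [/Hg [d' [Hd' K']] K]].
by exists d'; split => // s /K' /K.
Qed.

Lemma rc_Cmod (g : R -> C) t : ccontinuous g t -> continuous (fun s => Cmod (g s)) t.
Proof.
move=> /rc_eps H; apply/filterlim_locally => eps.
have [d [Hd K]] := H eps (cond_pos eps).
exists (mkposreal d Hd) => s /K.
apply: Rle_lt_trans.
rewrite /abs /minus /plus /opp /=.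
have := Cmod_triangle (g s - g t) (g t); have := Cmod_triangle (g t - g s) (g s).
rewrite (_ : (g s - g t + g t = g s)%C); last by ring.
rewrite (_ : (g t - g s + g s = g t)%C); last by ring.
have -> : Cmod (g t - g s) = Cmod (g s - g t).
  by rewrite -Cmod_opp; congr Cmod; ring.
by move=> ? ?; apply: Rabs_le; lra.
Qed.

Lemma rc_const c t : ccontinuous (fun _ => c) t.
Proof. exact: continuous_const. Qed.

Lemma rc_plus g h t : ccontinuous g t -> ccontinuous h t ->
  ccontinuous (fun s => g s + h s)%C t.
Proof. exact: (@continuous_plus _ _ C_R_NormedModule). Qed.

Lemma rc_scal c g t : ccontinuous g t -> ccontinuous (fun s => c * g s)%C t.
Proof.
apply: (rc_comp (fun w => c * w)%C); apply: cdiff_ccont.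
exact: cdiff_scal (cdiff_id _).
Qed.

(** Polarisation reduces the product to squares, and squaring is a map of one complex variable, to
    which [rc_comp] applies. *)
Lemma rc_mult g h t : ccontinuous g t -> ccontinuous h t ->
  ccontinuous (fun s => g s * h s)%C t.
Proof.
move=> Hg Hh.
have E s : (g s * h s)%C = ((/ 4) * ((g s + h s) * (g s + h s)
   + (-(1)) * ((g s + (-(1)) * h s) * (g s + (-(1)) * h s))))%C by field.
apply: (continuous_ext _ _ t (fun s => eq_sym (E s))).
have Sq w : ccont (fun w => w * w)%C w.
  apply: cdiff_ccont; exact: cdiff_mult (cdiff_id _) (cdiff_id _).
apply: rc_scal; apply: rc_plus; last apply: rc_scal.
  by apply: (rc_comp (fun w => w * w)%C) => //; apply: rc_plus.
by apply: (rc_comp (fun w => w * w)%C) => //; apply: rc_plus => //; apply: rc_scal.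
Qed.

Lemma rc_pair (u v : R -> R) t : continuous u t -> continuous v t ->
  ccontinuous (fun s => (u s, v s)) t.
Proof.
move=> Hu Hv; apply/filterlim_locally => eps.
have H1 := proj1 (filterlim_locally u (u t)) Hu eps.
have H2 := proj1 (filterlim_locally v (v t)) Hv eps.
case: H1 => d1 K1; case: H2 => d2 K2.
exists (mkposreal _ (Rmin_stable_in_posreal d1 d2)) => s Hs; split.
  by apply: K1; apply: ball_le Hs; apply: Rmin_l.
by apply: K2; apply: ball_le Hs; apply: Rmin_r.
Qed.

Lemma CI_ex (g : R -> C) a b : (forall t, ccontinuous g t) -> @ex_RInt C_R_NormedModule g a b.
Proof.
by move=> H; apply: (@ex_RInt_continuous C_R_CompleteNormedModule) => t _; apply: H.
Qed.

Lemma CI_correct (g : R -> C) a b : (forall t, ccontinuous g t) ->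
  @is_RInt C_R_NormedModule g a b (CI g a b).
Proof. by move=> H; apply: (@RInt_correct C_R_CompleteNormedModule); apply: CI_ex. Qed.

Lemma norm_C_R (z : C) : @norm R_AbsRing C_R_NormedModule z = Cmod z.
Proof.
rewrite /norm /= /prod_norm /= /norm /= /abs /= /Cmod.
by congr sqrt; rewrite !Rmult_1_r -!Rabs_mult !Rabs_pos_eq //; nra.
Qed.

Lemma CI_plus (g h : R -> C) a b : (forall t, ccontinuous g t) -> (forall t, ccontinuous h t) ->
  CI (fun t => g t + h t)%C a b = (CI g a b + CI h a b)%C :> C.
Proof.
by move=> Hg Hh; apply: (@RInt_plus C_R_CompleteNormedModule); apply: CI_ex.
Qed.

Lemma CI_ext (g h : R -> C) a b : (forall t, g t = h t :> C) -> CI g a b = CI h a b.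
Proof. by move=> H; apply: RInt_ext => t _; apply: H. Qed.

(** The integral over this module is linear over the reals only; a complex factor is handled on real
    and imaginary parts. *)
Lemma CI_scal c (g : R -> C) a b : (forall t, ccontinuous g t) ->
  CI (fun t => c * g t)%C a b = (c * CI g a b)%C :> C.
Proof.
move=> Hg; apply: (@is_RInt_unique C_R_CompleteNormedModule).
have H := CI_correct g a b Hg.
have H1 := is_RInt_fct_extend_fst _ _ _ _ H.
have H2 := is_RInt_fct_extend_snd _ _ _ _ H.
case: c => x y.
apply: is_RInt_fct_extend_pair => /=.
  exact: (is_RInt_minus _ _ _ _ _ _ (is_RInt_scal _ _ _ x _ H1) (is_RInt_scal _ _ _ y _ H2)).
exact: (is_RInt_plus _ _ _ _ _ _ (is_RInt_scal _ _ _ x _ H2) (is_RInt_scal _ _ _ y _ H1)).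
Qed.

Lemma CI_minus (g h : R -> C) a b : (forall t, ccontinuous g t) -> (forall t, ccontinuous h t) ->
  CI (fun t => g t - h t)%C a b = (CI g a b - CI h a b)%C :> C.
Proof.
move=> Hg Hh.
rewrite (CI_ext _ (fun t => g t + (-(1)) * h t)%C); last by move=> t; ring.
have Hh' t : ccontinuous (fun t => (-(1)) * h t)%C t by apply: rc_scal.
by rewrite CI_plus // CI_scal //; ring.
Qed.

Lemma CI_Chasles (g : R -> C) a b c : (forall t, ccontinuous g t) ->
  (CI g a b + CI g b c)%C = CI g a c :> C.
Proof. by move=> Hg; apply: (@RInt_Chasles C_R_CompleteNormedModule); apply: CI_ex. Qed.

Lemma CI_norm (g : R -> C) a b : a <= b -> (forall t, ccontinuous g t) ->
  Cmod (CI g a b) <= RInt (fun t => Cmod (g t)) a b.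
Proof.
move=> Hab Hg; rewrite -norm_C_R.
apply: (norm_RInt_le g (fun t => Cmod (g t)) a b) => //.
- by move=> t _; rewrite norm_C_R; apply: Rle_refl.
- exact: CI_correct.
- by apply: RInt_correct; apply: ex_RInt_continuous => t _; apply: rc_Cmod.
Qed.

Lemma CI_norm_const (g : R -> C) a b M : a <= b -> (forall t, ccontinuous g t) ->
  (forall t, a <= t <= b -> Cmod (g t) <= M) -> Cmod (CI g a b) <= (b - a) * M.
Proof.
move=> Hab Hg HM; rewrite -norm_C_R.
apply: (norm_RInt_le_const g a b) => //; last exact: CI_correct.
by move=> t Ht; rewrite norm_C_R; apply: HM.
Qed.

Lemma rc_affine (P Q : C) t : ccontinuous (fun s => P + Q * RtoC s)%C t.
Proof.
apply: rc_plus; first exact: rc_const.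
apply: rc_scal; apply: rc_pair; [exact: continuous_id | exact: continuous_const].
Qed.

Lemma CI_affine (P Q : C) a b :
  CI (fun t => P + Q * RtoC t)%C a b = (P * (b - a) + Q * ((b * b - a * a) / 2))%C :> C.
Proof.
have HR (u v : R) : is_RInt (fun t => u + v * t) a b (u * (b - a) + v * ((b * b - a * a) / 2)).
  have := is_RInt_derive (fun t => u * t + v * (t * t / 2)) (fun t => u + v * t) a b.
  have -> : minus (u * b + v * (b * b / 2)) (u * a + v * (a * a / 2)) =
     u * (b - a) + v * ((b * b - a * a) / 2).
    by rewrite /minus /plus /opp /=; field.
  apply; first by move=> x _; auto_derive => //; field.
  move=> x _; apply: (continuous_plus (fun _ => u)); first exact: continuous_const.
  by apply: (continuous_scal_r v); apply: continuous_id.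
apply: (@is_RInt_unique C_R_CompleteNormedModule).
case: P => p1 p2; case: Q => q1 q2.
have -> : ((p1, p2) * (b - a) + (q1, q2) * ((b * b - a * a) / 2))%C =
   (p1 * (b - a) + q1 * ((b * b - a * a) / 2), p2 * (b - a) + q2 * ((b * b - a * a) / 2)).
  by rewrite -!RtoC_mult -!RtoC_minus -RtoC_div /Cmult /Cplus /=; [congr pair; field | lra].
apply: is_RInt_fct_extend_pair => /=.
  by apply: is_RInt_ext (HR p1 q1) => x _; change (p1 + q1 * x = p1 + (q1 * x - q2 * 0)); ring.
by apply: is_RInt_ext (HR p2 q2) => x _; change (p2 + q2 * x = p2 + (q1 * 0 + q2 * x)); ring.
Qed.

(** * Bisection and local compactness *)

Lemma nested_intervals (x : nat -> R) (a : R) : 0 <= a ->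
  (forall n, x n <= x (S n) /\ x (S n) + a * / 2 ^ (S n) <= x n + a * / 2 ^ n) ->
  exists X, forall n, x n <= X <= x n + a * / 2 ^ n.
Proof.
move=> Ha H.
have inc n k : x n <= x (n + k)%nat /\ x (n + k)%nat + a * / 2 ^ (n + k) <= x n + a * / 2 ^ n.
  elim: k => [|k [IH1 IH2]]; first by rewrite Nat.add_0_r; lra.
  by rewrite Nat.add_succ_r; have := H (n + k)%nat; lra.
have pos n : 0 <= a * / 2 ^ n.
  by apply: Rmult_le_pos => //; apply: Rlt_le; apply: Rinv_0_lt_compat; apply: pow_lt; lra.
have cross n m : x n <= x m + a * / 2 ^ m.
  case: (Nat.le_ge_cases n m) => Hnm.
    have := inc n (m - n)%nat; rewrite (_ : (n + (m - n))%nat = m); last by lia.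
    by have := pos m; lra.
  have := inc m (n - m)%nat; rewrite (_ : (m + (n - m))%nat = n); last by lia.
  by have := pos n; lra.
have [||X [ub lub]] := completeness (fun y => exists n, y = x n).
- by exists (x 0%nat + a * / 2 ^ 0) => y [n ->].
- by exists (x 0%nat), 0%nat.
exists X => n; split; first by apply: ub; exists n.
by apply: lub => y [m ->].
Qed.

Lemma pow_half_small d : 0 < d -> exists n, / 2 ^ n < d.
Proof.
move=> Hd.
have [N HN] := pow_lt_1_zero (/ 2) ltac:(rewrite Rabs_pos_eq; lra) d Hd.
exists N; have := HN N (le_n N).
rewrite Rabs_pos_eq -?pow_inv //; apply: pow_le; lra.
Qed.

(** Serves the subdivision in Goursat's theorem and, with [P] the failure of a claim on the
    rectangle with corner [x, y] and sides [a * s], [b * s], the compactness of rectangles. Keeping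
    the scale [s] apart from the sides allows degenerate rectangles. *)
Lemma bisection (a b x0 y0 : R) (P : R -> R -> R -> Prop) : 0 <= a -> 0 <= b ->
  P x0 y0 1 ->
  (forall x y s, 0 < s -> P x y s -> exists i j, (i = 0 \/ i = 1) /\ (j = 0 \/ j = 1) /\
     P (x + i * (a * (s / 2))) (y + j * (b * (s / 2))) (s / 2)) ->
  exists X Y, forall d, 0 < d -> exists x y s, 0 < s < d /\ P x y s /\
    x <= X <= x + a * s /\ y <= Y <= y + b * s.
Proof.
move=> Ha Hb H0 Hstep.
pose Rl n (p q : R * R) := exists i j, (i = 0 \/ i = 1) /\ (j = 0 \/ j = 1) /\
  q = (fst p + i * (a * (/ 2 ^ n / 2)), snd p + j * (b * (/ 2 ^ n / 2))) /\
  P (fst q) (snd q) (/ 2 ^ n / 2).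
(* A total choice function, with [p] itself as the inhabitant; it returns a genuine quarter along
   [sq], where [P] is maintained ([HP]). *)
pose nxt n p := epsilon (inhabits p) (Rl n p).
pose sq := fix sq n := if n is S m then nxt m (sq m) else (x0, y0).
have pow2 n : 0 < / 2 ^ n by apply: Rinv_0_lt_compat; apply: pow_lt; lra.
have half n : / 2 ^ n / 2 = / 2 ^ (S n).
  by rewrite /= Rinv_mult; lra.
have HR n p : P (fst p) (snd p) (/ 2 ^ n) -> Rl n p (nxt n p).
  move=> HP; apply: epsilon_spec.
  have [i [j [Hi [Hj HP']]]] := Hstep _ _ _ (pow2 n) HP.
  exists (fst p + i * (a * (/ 2 ^ n / 2)), snd p + j * (b * (/ 2 ^ n / 2))); exists i, j.
  by split => //; split.
have HP n : P (fst (sq n)) (snd (sq n)) (/ 2 ^ n).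
  elim: n => [|n IH]; first by rewrite /= Rinv_1.
  by have [i [j [_ [_ [_]]]]] := HR n _ IH; rewrite half.
have mono c i u n : 0 <= c -> (i = 0 \/ i = 1) ->
   u <= u + i * (c * (/ 2 ^ n / 2)) /\
   u + i * (c * (/ 2 ^ n / 2)) + c * / 2 ^ S n <= u + c * / 2 ^ n.
  move=> Hc Hi; rewrite -half; have := pow2 n; set t := / 2 ^ n => Ht.
  have : 0 <= c * t by nra.
  by case: Hi => ->; lra.
have [X HX] : exists X, forall n, fst (sq n) <= X <= fst (sq n) + a * / 2 ^ n.
  apply: nested_intervals => // n.
  have [i [j [Hi [_ [E _]]]]] := HR n _ (HP n).
  by rewrite /= E /=; apply: mono.
have [Y HY] : exists Y, forall n, snd (sq n) <= Y <= snd (sq n) + b * / 2 ^ n.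
  apply: nested_intervals => // n.
  have [i [j [_ [Hj [E _]]]]] := HR n _ (HP n).
  by rewrite /= E /=; apply: mono.
exists X, Y => d /pow_half_small [n Hn].
by exists (fst (sq n)), (snd (sq n)), (/ 2 ^ n); repeat split => //; try apply HX; try apply HY.
Qed.

Lemma continuous_bounded_rect (f : C -> R) x0 y0 a b : 0 <= a -> 0 <= b ->
  (forall z : C, exists d K, 0 < d /\ forall w, Cmod (w - z) < d -> f w <= K) ->
  exists K, forall x y, x0 <= x <= x0 + a -> y0 <= y <= y0 + b -> f (x, y) <= K.
Proof.
move=> Ha Hb Hf; apply: NNPP => Hn.
pose P x0 y0 s := ~ exists K, forall x y, x0 <= x <= x0 + a * s -> y0 <= y <= y0 + b * s -> f (x, y) <= K.
have [||X [Y H]] := bisection a b x0 y0 P Ha Hb.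
- by rewrite /P !Rmult_1_r.
- move=> x y s Hs HP; apply: NNPP => Hno; apply: HP.
  have Q i j : (i = 0 \/ i = 1) -> (j = 0 \/ j = 1) -> exists K, forall u v,
    x + i * (a * (s / 2)) <= u <= x + i * (a * (s / 2)) + a * (s / 2) ->
    y + j * (b * (s / 2)) <= v <= y + j * (b * (s / 2)) + b * (s / 2) -> f (u, v) <= K.
    by move=> Hi Hj; apply: NNPP => HQ; apply: Hno; exists i, j.
  have [K1 H1] := Q 0 0 (or_introl eq_refl) (or_introl eq_refl).
  have [K2 H2] := Q 0 1 (or_introl eq_refl) (or_intror eq_refl).
  have [K3 H3] := Q 1 0 (or_intror eq_refl) (or_introl eq_refl).
  have [K4 H4] := Q 1 1 (or_intror eq_refl) (or_intror eq_refl).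
  exists (Rmax (Rmax K1 K2) (Rmax K3 K4)) => u v Hu Hv.
  have [M1 [M2 [M3 [M4 [M5 M6]]]]] := (Rmax_l K1 K2, (Rmax_r K1 K2, (Rmax_l K3 K4, (Rmax_r K3 K4,
    (Rmax_l (Rmax K1 K2) (Rmax K3 K4), Rmax_r (Rmax K1 K2) (Rmax K3 K4)))))).
  case: (Rle_dec u (x + a * (s / 2))) => Hu'; case: (Rle_dec v (y + b * (s / 2))) => Hv'.
  + by apply: Rle_trans (H1 u v _ _) _; lra.
  + by apply: Rle_trans (H2 u v _ _) _; lra.
  + by apply: Rle_trans (H3 u v _ _) _; lra.
  + by apply: Rle_trans (H4 u v _ _) _; lra.
have [d [K [Hd HK]]] := Hf (X, Y).
have [|x [y [s [[Hs Hsd] [HP [HX HY]]]]]] := H (d / (a + b + 1)).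
  by apply: Rdiv_lt_0_compat; lra.
apply: HP; exists K => u v Hu Hv; apply: HK.
apply: Rle_lt_trans (Cmod_le_Rabs _) _ => /=.
have D1 : Rabs (u + - X) <= a * s by apply: Rabs_le; lra.
have D2 : Rabs (v + - Y) <= b * s by apply: Rabs_le; lra.
have : s * (a + b + 1) < d by apply/Rlt_div_r; lra.
nra.
Qed.

Lemma ccont_bounded (f : C -> C) (r : R) : (forall z, ccont f z) ->
  exists K, 0 < K /\ forall z, Cmod z <= r -> Cmod (f z) <= K.
Proof.
move=> Hf.
have [K HK] : exists K, forall x y, - Rabs r <= x <= - Rabs r + 2 * Rabs r -> - Rabs r <= y <= - Rabs r + 2 * Rabs r ->
    Cmod (f (x, y)) <= K.
  have Hr := Rabs_pos r.
  apply: (continuous_bounded_rect (fun z => Cmod (f z))); try lra.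
  move=> z; have [d [Hd Hw]] := Hf z 1 Rlt_0_1.
  exists d, (Cmod (f z) + 1); split=> // w /Hw H.
  rewrite (_ : f w = f z + (f w - f z))%C; last by ring.
  by apply: Rle_trans (Cmod_triangle _ _) _; lra.
exists (Rmax K 1); split; first by apply: Rlt_le_trans (Rmax_r _ _); lra.
move=> [x y] Hz; apply: Rle_trans (HK x y _ _) (Rmax_l _ _).
- have := Rle_trans _ _ _ (Rle_trans _ _ _ (Rabs_fst_Cmod _) Hz) (Rle_abs r).
  by move=> /= /Rabs_le_between; lra.
- have := Rle_trans _ _ _ (Rle_trans _ _ _ (Rabs_snd_Cmod _) Hz) (Rle_abs r).
  by move=> /= /Rabs_le_between; lra.
Qed.

(** The counterclockwise boundary integral from the lower left corner [x, y]; the factor [Ci] is the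
    direction of the vertical sides. *)
Definition rectint (G : C -> C) (x y a b : R) : C :=
  (CI (fun t => G (t, y)) x (x + a) + Ci * CI (fun t => G ((x + a)%R, t)) y (y + b)
   - CI (fun t => G (t, (y + b)%R)) x (x + a) - Ci * CI (fun t => G (x, t)) y (y + b))%C.

Lemma rc_hor (G : C -> C) y t : (forall z, ccont G z) -> ccontinuous (fun t => G (t, y)) t.
Proof.
move=> H; apply: (rc_comp G (fun t => (t, y))) => //.
by apply: rc_pair; [exact: continuous_id | exact: continuous_const].
Qed.

Lemma rc_ver (G : C -> C) x t : (forall z, ccont G z) -> ccontinuous (fun t => G (x, t)) t.
Proof.
move=> H; apply: (rc_comp G (fun t => (x, t))) => //.
by apply: rc_pair; [exact: continuous_const | exact: continuous_id].
Qed.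

Lemma rectint_split4 G x y a b : (forall z, ccont G z) ->
  rectint G x y (a + a) (b + b) =
  (rectint G x y a b + rectint G (x + a)%R y a b + rectint G x (y + b)%R a b +
   rectint G (x + a)%R (y + b)%R a b)%C.
Proof.
move=> HG; rewrite /rectint.
have Hh v : CI (fun t => G (t, v)) x (x + (a + a)) =
   (CI (fun t => G (t, v)) x (x + a) + CI (fun t => G (t, v)) (x + a) (x + a + a))%C.
  by rewrite -Rplus_assoc CI_Chasles // => t; apply: rc_hor.
have Hv u : CI (fun t => G (u, t)) y (y + (b + b)) =
   (CI (fun t => G (u, t)) y (y + b) + CI (fun t => G (u, t)) (y + b) (y + b + b))%C.
  by rewrite -Rplus_assoc CI_Chasles // => t; apply: rc_ver.
rewrite !Hh !Hv -!Rplus_assoc; ring.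
Qed.

Lemma rectint_ext G H x y a b : (forall z, G z = H z) ->
  rectint G x y a b = rectint H x y a b.
Proof.
move=> E; rewrite /rectint.
have Eh v : CI (fun t => G (t, v)) x (x + a) = CI (fun t => H (t, v)) x (x + a).
  by apply: CI_ext => t; apply: E.
have Ev v : CI (fun t => G (v, t)) y (y + b) = CI (fun t => H (v, t)) y (y + b).
  by apply: CI_ext => t; apply: E.
by rewrite !Eh !Ev.
Qed.

Lemma rectint_plus G H x y a b : (forall z, ccont G z) -> (forall z, ccont H z) ->
  rectint (fun z => G z + H z)%C x y a b = (rectint G x y a b + rectint H x y a b)%C.
Proof.
move=> HG HH; rewrite /rectint !CI_plus; first ring.
all: by move=> t; (exact: rc_hor || exact: rc_ver).
Qed.

Lemma rectint_affine (P Q : C) x y a b : rectint (fun z => P + Q * z)%C x y a b = 0%C.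
Proof.
rewrite /rectint.
have Hh v u w : CI (fun t => P + Q * (t, v))%C u w =
   ((P + Q * (Ci * v)) * (w - u) + Q * ((w * w - u * u) / 2))%C.
  rewrite -CI_affine; apply: CI_ext => t.
  by rewrite {1}(_ : (t, v) = t + Ci * v)%C; [ring | rewrite /Cplus /Cmult /=; congr pair; ring].
have Hv v u w : CI (fun t => P + Q * (v, t))%C u w =
   ((P + Q * v) * (w - u) + (Q * Ci) * ((w * w - u * u) / 2))%C.
  rewrite -CI_affine; apply: CI_ext => t.
  by rewrite {1}(_ : (v, t) = v + Ci * t)%C; [ring | rewrite /Cplus /Cmult /=; congr pair; ring].
by rewrite !Hh !Hv !RtoC_plus; field.
Qed.

Lemma rectint_bound G x y a b M : 0 <= a -> 0 <= b -> (forall z, ccont G z) ->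
  (forall u v, x <= u <= x + a -> y <= v <= y + b -> Cmod (G (u, v)) <= M) ->
  Cmod (rectint G x y a b) <= 2 * (a + b) * M.
Proof.
move=> Ha Hb HG HM; rewrite /rectint.
have Hh v : y <= v <= y + b -> Cmod (CI (fun t => G (t, v)) x (x + a)) <= a * M.
  move=> Hv; rewrite {2}(_ : a = x + a - x); last by ring.
  apply: CI_norm_const; [lra | by move=> t; apply: rc_hor | by move=> t Ht; apply: HM].
have Hv u : x <= u <= x + a -> Cmod (CI (fun t => G (u, t)) y (y + b)) <= b * M.
  move=> Hu; rewrite {2}(_ : b = y + b - y); last by ring.
  apply: CI_norm_const; [lra | by move=> t; apply: rc_ver | by move=> t Ht; apply: HM].
have := Hh y ltac:(lra); have := Hh (y + b) ltac:(lra).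
have := Hv x ltac:(lra); have := Hv (x + a) ltac:(lra).
set c1 := CI _ _ _; set c2 := CI _ _ _; set c3 := CI _ _ _; set c4 := CI _ _ _.
move=> H1 H2 H3 H4.
have := Cmod_triangle (c4 + Ci * c1 - c3) (- (Ci * c2)).
have := Cmod_triangle (c4 + Ci * c1) (- c3).
have := Cmod_triangle c4 (Ci * c1).
rewrite !Cmod_opp !Cmod_mult Cmod_Ci /Cminus.
lra.
Qed.

Lemma goursat G x y a b : 0 <= a -> 0 <= b -> entire G -> rectint G x y a b = 0%C.
Proof.
move=> Ha Hb HG.
have HGc z : ccont G z by apply: entire_ccont.
apply: NNPP => Hn.
have Hpos : 0 < Cmod (rectint G x y a b) by apply/Cmod_gt_0.
pose c := Cmod (rectint G x y a b).
pose P x y s := c * (s * s) <= Cmod (rectint G x y (a * s) (b * s)).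
have [||X [Y H]] := bisection a b x y P Ha Hb.
- by rewrite /P !Rmult_1_r; apply: Rle_refl.
- move=> u v s Hs HP; apply: NNPP => Hno.
  have Q i j : (i = 0 \/ i = 1) -> (j = 0 \/ j = 1) ->
    Cmod (rectint G (u + i * (a * (s / 2))) (v + j * (b * (s / 2))) (a * (s / 2)) (b * (s / 2))) <
      c * (s / 2 * (s / 2)).
    by move=> Hi Hj; apply: Rnot_le_lt => HQ; apply: Hno; exists i, j.
  have := Q 0 0 (or_introl eq_refl) (or_introl eq_refl).
  have := Q 0 1 (or_introl eq_refl) (or_intror eq_refl).
  have := Q 1 0 (or_intror eq_refl) (or_introl eq_refl).
  have := Q 1 1 (or_intror eq_refl) (or_intror eq_refl).
  move: HP; rewrite /P.
  rewrite !Rmult_0_l !Rplus_0_r !Rmult_1_l.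
  rewrite {1}(_ : a * s = a * (s / 2) + a * (s / 2)); last by field.
  rewrite {1}(_ : b * s = b * (s / 2) + b * (s / 2)); last by field.
  rewrite rectint_split4 //.
  set r1 := rectint _ _ _ _ _; set r2 := rectint _ _ _ _ _; set r3 := rectint _ _ _ _ _; set r4 := rectint _ _ _ _ _.
  have := Cmod_triangle (r1 + r2 + r3) r4.
  have := Cmod_triangle (r1 + r2) r3.
  have := Cmod_triangle r1 r2.
  lra.
set L := Cderiv G (X, Y).
have HL : cdiff G (X, Y) L by apply: (proj1 (entire_cdiff G)).
(* The affine part of [G] at the limit point integrates to 0, and the remainder contributes at most
   [2 * e * (a + b)^2 * s^2]; this [e] makes that at most half of [c * (s * s)]. The [+ 1] covers
   degenerate rectangles. *)
have He : 0 < c / (4 * ((a + b + 1) * (a + b + 1))).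
  by apply: Rdiv_lt_0_compat => //; nra.
have [d [Hd HdK]] := HL _ He; set e := _ / _ in He HdK.
have [|u [v [s [[Hs Hsd] [HP [HX HY]]]]]] := H (d / (a + b + 1)).
  by apply: Rdiv_lt_0_compat; lra.
have Hsd' : s * (a + b + 1) < d by apply/Rlt_div_r; lra.
pose E z := (G z - G (X, Y) - L * (z - (X, Y)))%C.
have HE z : ccont E z.
  apply: cdiff_ccont; apply: cdiff_minus; first apply: cdiff_minus.
  - exact: (proj1 (entire_cdiff G) HG z).
  - exact: cdiff_const.
  - apply: cdiff_scal; apply: cdiff_minus; [exact: cdiff_id | exact: cdiff_const].
have HA z : ccont (fun z => (G (X, Y) - L * (X, Y)) + L * z)%C z.
  apply: cdiff_ccont; apply: cdiff_plus; first exact: cdiff_const.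
  apply: cdiff_scal; exact: cdiff_id.
have ER : rectint G u v (a * s) (b * s) = rectint E u v (a * s) (b * s).
  rewrite -[RHS]Cplus_0_l -(rectint_affine (G (X, Y) - L * (X, Y)) L u v (a * s) (b * s)).
  rewrite -rectint_plus //; apply: rectint_ext => z.
  by rewrite /E; ring.
have B : Cmod (rectint E u v (a * s) (b * s)) <= 2 * (a * s + b * s) * (e * (a * s + b * s)).
  apply: rectint_bound => //; try nra.
  move=> u' v' Hu Hv.
  have D : Cmod ((u', v') - (X, Y)) <= a * s + b * s.
    apply: Rle_trans (Cmod_le_Rabs _) _ => /=.
    have D1 : Rabs (u' + - X) <= a * s by apply: Rabs_le; lra.
    have D2 : Rabs (v' + - Y) <= b * s by apply: Rabs_le; lra.
    lra.
  apply: Rle_trans (HdK _ _) _; first nra.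
  by apply: Rmult_le_compat_l => //; lra.
move: HP; rewrite /P ER => HP.
have {B HP} : c * (s * s) <= 2 * e * ((a + b) * (a + b)) * (s * s) by nra.
have -> : 2 * e * ((a + b) * (a + b)) * (s * s) =
   c / 2 * (((a + b) * (a + b)) / ((a + b + 1) * (a + b + 1))) * (s * s).
  by rewrite /e; field; lra.
have : ((a + b) * (a + b)) / ((a + b + 1) * (a + b + 1)) <= 1.
  by apply/Rle_div_l; nra.
set q := _ / _ => Hq.
have Hc : 0 < c by [].
have Hss : 0 < c * (s * s) by apply: Rmult_lt_0_compat => //; nra.
have -> : c / 2 * q * (s * s) = q * ((c * (s * s)) / 2) by field.
nra.
Qed.

Lemma Ci_mult_inj z w : (Ci * z = Ci * w)%C -> z = w.
Proof.
move=> H; have : (- (Ci * (Ci * z)) = - (Ci * (Ci * w)))%C by rewrite H.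
have E u : (- (Ci * (Ci * u)) = u)%C.
  by case: u => a b; rewrite /Ci /Cmult /Copp /=; congr pair; ring.
by rewrite !E.
Qed.

(** The horizontal sides of a period rectangle cancel, so Goursat's theorem equates the vertical
    ones. *)
Lemma periodic_strip_le G s1 s2 : s1 <= s2 -> entire G ->
  (forall s t, G (s, (t + 2 * PI)%R) = G (s, t)) ->
  CI (fun t => G (s1, t)) 0 (2 * PI) = CI (fun t => G (s2, t)) 0 (2 * PI).
Proof.
move=> Hs HG Hp.
have HPI := PI_RGT_0.
have := goursat G s1 0 (s2 - s1) (2 * PI) ltac:(lra) ltac:(lra) HG.
rewrite /rectint Rplus_0_l (_ : s1 + (s2 - s1) = s2); last by ring.
rewrite (CI_ext (fun t => G (t, 2 * PI)) (fun t => G (t, 0))); last first.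
  by move=> t; rewrite -[2 * PI]Rplus_0_l Hp.
set A := CI _ _ _; set B := CI _ _ _; set D := CI (fun t => G (s1, t)) _ _.
move=> H; apply: Ci_mult_inj; symmetry.
have -> : (Ci * B = (A + Ci * B - A - Ci * D) + Ci * D)%C by ring.
by rewrite H; ring.
Qed.

Lemma periodic_strip G s1 s2 : entire G ->
  (forall s t, G (s, (t + 2 * PI)%R) = G (s, t)) ->
  CI (fun t => G (s1, t)) 0 (2 * PI) = CI (fun t => G (s2, t)) 0 (2 * PI).
Proof.
move=> HG Hp; case: (Rle_dec s1 s2) => Hs; first exact: periodic_strip_le.
by symmetry; apply: periodic_strip_le => //; lra.
Qed.

(** * Cauchy's estimate and its consequences *)

(** [L] is the Taylor coefficient of order [n] of [f] at [c] when all lower ones vanish. As an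
    asymptotic condition it multiplies well and asks for no power series. *)
Definition lead (f : C -> C) (c : C) (n : nat) (L : C) : Prop :=
  forall eps, 0 < eps -> exists d, 0 < d /\ forall h, Cmod h < d ->
    Cmod (f (c + h) - L * cpow h n)%C <= eps * Cmod h ^ n.

Lemma cpow_mult z w n : cpow (z * w) n = (cpow z n * cpow w n)%C.
Proof. by elim: n => [|n IH] /=; [ring | rewrite IH; ring]. Qed.

Lemma cpow_1 n : cpow 1 n = 1%C.
Proof. by elim: n => [//|n IH] /=; rewrite IH; ring. Qed.

Lemma cpow_add z n m : cpow z (n + m) = (cpow z n * cpow z m)%C.
Proof. by elim: n => [|n IH] /=; [ring | rewrite IH; ring]. Qed.

Lemma cexp_period s t : cexp (s, t + 2 * PI) = cexp (s, t).
Proof. by rewrite /cexp /= cos_plus sin_plus cos_2PI sin_2PI; congr pair; ring. Qed.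

Lemma cexp_opp_period s t : cexp (Copp (s, t + 2 * PI)) = cexp (Copp (s, t)).
Proof.
have -> : Copp (s, t + 2 * PI) = (- s, - (t + 2 * PI)) by [].
by rewrite -(cexp_period (- s) (- (t + 2 * PI))); rewrite /Copp /=; congr cexp; congr pair; ring.
Qed.

(* The function [f (c + exp w) exp (- n w)] is entire and [2 i pi]-periodic, so that Goursat's
   theorem on a period rectangle makes its mean over vertical segments, that is, over
   circles around [c], independent of the radius. *)
Lemma cauchy_estimate (f : C -> C) c n L r K : entire f -> lead f c n L -> 0 < r ->
  (forall h, Cmod h = r -> Cmod (f (c + h)%C) <= K) -> Cmod L * r ^ n <= K.
Proof.
move=> Hf HL Hr HK.
have HPI := PI_RGT_0.
pose G w := (f (c + cexp w) * cpow (cexp (- w)) n)%C.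
have HG : entire G.
  apply: entire_mult.
    apply: (entire_comp f (fun w => c + cexp w)%C) => //.
    exact: entire_plus (entire_const _) entire_cexp.
  apply: entire_cpow; apply: (entire_comp cexp (fun w => - w)%C entire_cexp).
  apply: (entire_ext (fun w => 0 - w)%C); first by move=> w; ring.
  exact: entire_minus (entire_const _) entire_id.
have HGc z : ccont G z by apply: entire_ccont.
have Hp s t : G (s, t + 2 * PI) = G (s, t) by rewrite /G cexp_period cexp_opp_period.
have HGn w : (G w * cpow (cexp w) n)%C = f (c + cexp w)%C.
  by rewrite /G -Cmult_assoc -cpow_mult cexp_opp cpow_1; ring.
have HGm w : Cmod (G w) * exp (fst w) ^ n = Cmod (f (c + cexp w)%C).
  by rewrite -HGn Cmod_mult Cmod_cpow Cmod_cexp.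
have Hrn : 0 < r ^ n by apply: pow_lt.
have B1 : Cmod (CI (fun t => G (ln r, t)) 0 (2 * PI)) <= (2 * PI - 0) * (K / r ^ n).
  apply: CI_norm_const; [lra | by move=> t; apply: rc_ver; apply: HGc | ].
  move=> t _; apply/Rle_div_r => //.
  have := HGm (ln r, t); rewrite /= exp_ln // => ->.
  by apply: HK; rewrite Cmod_cexp /= exp_ln.
apply/(Rle_div_r _ K) => //.
apply: le_epsilon => eps Heps.
have [d [Hd Hdl]] := HL eps Heps.
(* On the small circle of radius [d / 2] the integrand is uniformly close to [L], so its mean is
   nearly [L]; independence of the radius carries this to the circle of radius [r]. *)
have HG2 t : Cmod (G (ln (d / 2), t) - L)%C <= eps.
  have Hd2 : 0 < exp (ln (d / 2)) ^ n by apply: pow_lt; apply: exp_pos.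
  apply: (Rmult_le_reg_r _ _ _ Hd2).
  have E : exp (ln (d / 2)) = Cmod (cexp (ln (d / 2), t)) by rewrite Cmod_cexp.
  rewrite {1}E -Cmod_cpow -Cmod_mult.
  have -> : ((G (ln (d / 2), t) - L) * cpow (cexp (ln (d / 2), t)) n =
     f (c + cexp (ln (d / 2), t)) - L * cpow (cexp (ln (d / 2), t)) n)%C.
    by rewrite -HGn; ring.
  rewrite E; apply: Hdl; rewrite -E exp_ln; lra.
have B2 : Cmod (CI (fun t => G (ln (d / 2), t) - L)%C 0 (2 * PI)) <= (2 * PI - 0) * eps.
  apply: CI_norm_const; [lra | | by move=> t _; apply: HG2].
  move=> t; apply: (rc_ver (fun z => G z - L)%C) => z.
  apply: entire_ccont; exact: entire_minus HG (entire_const _).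
have EL : CI (fun t => L) 0 (2 * PI) = (L * RtoC (2 * PI))%C :> C.
  rewrite (CI_ext (fun t => L) (fun t => L + 0 * RtoC t)%C); last by move=> t; ring.
  by rewrite CI_affine; ring.
move: B2; rewrite CI_minus; [|by move=> t; apply: rc_ver; apply: HGc| by move=> t; apply: rc_const].
rewrite EL (periodic_strip G _ (ln r)) // => B2.
have : Cmod (L * RtoC (2 * PI)) <= 2 * PI * (K / r ^ n + eps).
  rewrite -Cmod_opp.
  set A := CI _ _ _ in B1 B2.
  have -> : (- (L * RtoC (2 * PI)) = (A - L * RtoC (2 * PI)) + - A)%C by ring.
  apply: Rle_trans (Cmod_triangle _ _) _; rewrite Cmod_opp; lra.
rewrite Cmod_mult Cmod_R Rabs_pos_eq; last lra.
nra.
Qed.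

Lemma lead_0 f c : ccont f c -> lead f c 0 (f c).
Proof.
move=> H eps He; have [d [Hd K]] := H eps He.
exists d; split=> // h Hh /=; rewrite Rmult_1_r Cmult_1_r.
apply: Rlt_le; apply: K.
by rewrite (_ : (c + h - c = h)%C) //; ring.
Qed.

Lemma lead_1 f c l : cdiff f c l -> lead (fun w => f w - f c)%C c 1 l.
Proof.
move=> H eps He; have [d [Hd K]] := H eps He.
exists d; split=> // h Hh /=; rewrite Rmult_1_r Cmult_1_r.
have := K (c + h)%C; rewrite (_ : (c + h - c = h)%C); last by ring.
by apply.
Qed.

Lemma lead_mult f g c n m L M : lead f c n L -> lead g c m M ->
  lead (fun w => f w * g w)%C c (n + m) (L * M)%C.
Proof.
move=> Hf Hg eps He.
have [HL HM] := (Cmod_ge_0 L, Cmod_ge_0 M).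
(* The cap [e2 <= 1] bounds [g] by [(|M| + 1) * |h|^m]; each factor's error then receives half of
   [eps]. *)
pose e1 := eps / (2 * (Cmod M + 1)); pose e2 := Rmin 1 (eps / (2 * (Cmod L + 1))).
have He1 : 0 < e1 by apply: Rdiv_lt_0_compat; lra.
have He2 : 0 < e2 by apply: Rmin_glb_lt; [lra | apply: Rdiv_lt_0_compat; lra].
have [d1 [Hd1 K1]] := Hf e1 He1.
have [d2 [Hd2 K2]] := Hg e2 He2.
exists (Rmin d1 d2); split; first exact: Rmin_glb_lt.
move=> h Hh.
have {}K1 := K1 h (Rlt_le_trans _ _ _ Hh (Rmin_l _ _)).
have {}K2 := K2 h (Rlt_le_trans _ _ _ Hh (Rmin_r _ _)).
have P k : 0 <= Cmod h ^ k by apply: pow_le; apply: Cmod_ge_0.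
have E21 : e2 <= 1 by apply: Rmin_l.
have E22 : Cmod L * e2 <= eps / 2.
  have : e2 <= eps / (2 * (Cmod L + 1)) by apply: Rmin_r.
  move=> /(Rmult_le_compat_l (Cmod L + 1)) H.
  have {}H := H ltac:(lra).
  have E : (Cmod L + 1) * (eps / (2 * (Cmod L + 1))) = eps / 2 by field; lra.
  nra.
have E1 : e1 * (Cmod M + 1) = eps / 2 by rewrite /e1; field; lra.
have Bg : Cmod (g (c + h)%C) <= (Cmod M + 1) * Cmod h ^ m.
  rewrite (_ : (g (c + h) = (g (c + h) - M * cpow h m) + M * cpow h m)%C); last by ring.
  apply: Rle_trans (Cmod_triangle _ _) _; rewrite Cmod_mult Cmod_cpow.
  have := P m; nra.
rewrite cpow_add.
have -> : (f (c + h) * g (c + h) - L * M * (cpow h n * cpow h m) =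
  (f (c + h) - L * cpow h n) * g (c + h) + L * cpow h n * (g (c + h) - M * cpow h m))%C by ring.
apply: Rle_trans (Cmod_triangle _ _) _.
rewrite !Cmod_mult Cmod_cpow pow_add.
have T1 : Cmod (f (c + h)%C - L * cpow h n) * Cmod (g (c + h)%C) <=
   (e1 * Cmod h ^ n) * ((Cmod M + 1) * Cmod h ^ m).
  by apply: Rmult_le_compat => //; apply: Cmod_ge_0.
have T2 : Cmod L * Cmod h ^ n * Cmod (g (c + h)%C - M * cpow h m) <= Cmod L * Cmod h ^ n * (e2 * Cmod h ^ m).
  by apply: Rmult_le_compat_l => //; apply: Rmult_le_pos.
have Hnm : 0 <= Cmod h ^ n * Cmod h ^ m by apply: Rmult_le_pos.
have T3 : Cmod L * e2 * (Cmod h ^ n * Cmod h ^ m) <= eps / 2 * (Cmod h ^ n * Cmod h ^ m).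
  by apply: Rmult_le_compat_r.
have T4 : e1 * (Cmod M + 1) * (Cmod h ^ n * Cmod h ^ m) = eps / 2 * (Cmod h ^ n * Cmod h ^ m).
  by rewrite E1.
nra.
Qed.

Lemma lead_cpow f c L k : lead f c 1 L -> lead (fun w => cpow (f w) k) c k (cpow L k).
Proof.
move=> H; elim: k => [|k IH] /=.
  move=> eps He; exists 1; split; first lra.
  move=> h _ /=; rewrite (_ : (1 - 1 * 1 = 0)%C); last by ring.
  by rewrite Cmod_0; lra.
exact: (lead_mult f (fun w => cpow (f w) k) c 1 k).
Qed.

Lemma entire_mean_bound f c r K : entire f -> 0 < r ->
  (forall w, Cmod (w - c) = r -> Cmod (f w) <= K) -> Cmod (f c) <= K.
Proof.
move=> Hf Hr HK.
have := cauchy_estimate f c 0 (f c) r K Hf (lead_0 f c (entire_ccont f c Hf)) Hr.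
rewrite /= Rmult_1_r; apply=> h Hh; apply: HK.
by rewrite (_ : (c + h - c = h)%C) //; ring.
Qed.

(** Subtracting [f c] turns the derivative into a leading coefficient of order 1; this subtraction
    costs the factor 2. *)
Lemma cauchy_deriv f c l r K : entire f -> cdiff f c l -> 0 < r ->
  (forall w, Cmod (w - c) = r -> Cmod (f w) <= K) -> Cmod l * r <= 2 * K.
Proof.
move=> Hf Hl Hr HK.
have H1 : entire (fun w => f w - f c)%C by apply: entire_minus Hf (entire_const _).
have := cauchy_estimate _ c 1 l r (2 * K) H1 (lead_1 f c l Hl) Hr.
rewrite /= Rmult_1_r; apply=> h Hh.
apply: Rle_trans (Cmod_triangle _ _) _; rewrite Cmod_opp.
have := entire_mean_bound f c r K Hf Hr HK.
have : Cmod (f (c + h)%C) <= K.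
  by apply: HK; rewrite (_ : (c + h - c = h)%C) //; ring.
lra.
Qed.

Lemma cdiff_curve (f : C -> C) (a v : C) t l : cdiff f (a + RtoC t * v)%C l ->
  @is_derive R_AbsRing C_R_NormedModule (fun s => f (a + RtoC s * v)%C) t (l * v)%C.
Proof.
move=> H; split; first exact: (@is_linear_scal_l R_AbsRing C_R_NormedModule (l * v)%C).
move=> x Hx.
have <- : t = x by exact: (@is_filter_lim_locally_unique R_AbsRing R_NormedModule t x Hx).
move=> eps.
have Hv := Cmod_ge_0 v.
have He : 0 < eps / (Cmod v + 1) by apply: Rdiv_lt_0_compat; [apply: cond_pos | lra].
have [d [Hd K]] := H _ He.
have Hd' : 0 < d / (Cmod v + 1) by apply: Rdiv_lt_0_compat; lra.
exists (mkposreal _ Hd') => s Hs.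
rewrite norm_C_R.
have Es : (a + RtoC s * v - (a + RtoC t * v) = RtoC (s - t) * v)%C by rewrite RtoC_minus; ring.
have Ms : Cmod (RtoC (s - t) * v) = Rabs (s - t) * Cmod v by rewrite Cmod_mult Cmod_R.
have Hs' : Rabs (s - t) < d / (Cmod v + 1) by [].
have {}Hs' : Rabs (s - t) * (Cmod v + 1) < d by apply/Rlt_div_r; lra.
have {}K : Cmod (f (a + s * v)%C - f (a + t * v)%C - l * (RtoC (s - t) * v)) <=
   eps / (Cmod v + 1) * (Rabs (s - t) * Cmod v).
  rewrite -Es -Ms -Es; apply: K; rewrite Es Ms.
  by have := Rabs_pos (s - t); nra.
set D := (X in Cmod X <= _).
have -> : D = (f (a + s * v) - f (a + t * v) - l * (RtoC (s - t) * v))%C.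
  rewrite /D.
  set A := f (a + s * v)%C; set B := f (a + t * v)%C.
  have -> : (l * (RtoC (s - t) * v) = RtoC (s - t) * (l * v))%C by ring.
  case: A => a1 a2; case: B => b1 b2; case: (l * v)%C => l1 l2.
  rewrite /minus /plus /opp /scal /= /prod_plus /prod_opp /prod_scal /= /scal /= /mult /= /plus /opp /=.
  by rewrite /Cminus /Cplus /Copp /Cmult /=; congr pair; ring.
apply: Rle_trans K _.
change (norm (minus s t)) with (Rabs (s - t)).
have -> : eps / (Cmod v + 1) * (Rabs (s - t) * Cmod v) = eps * Rabs (s - t) * (Cmod v / (Cmod v + 1)).
  by field; lra.
rewrite -[X in _ <= X]Rmult_1_r; apply: Rmult_le_compat_l.
  by apply: Rmult_le_pos; [apply: Rlt_le; apply: cond_pos | apply: Rabs_pos].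
by apply/Rle_div_l; lra.
Qed.

Lemma is_derive_real_part (k : C) (g : R -> C) t (l : C) :
  @is_derive R_AbsRing C_R_NormedModule g t l ->
  is_derive (fun s => fst (k * g s)%C) t (fst (k * l)%C).
Proof.
move=> [_ H]; split; first exact: (@is_linear_scal_l R_AbsRing R_NormedModule).
move=> x Hx.
have <- : t = x by exact: (@is_filter_lim_locally_unique R_AbsRing R_NormedModule t x Hx).
move=> eps.
have Hk := Cmod_ge_0 k.
have He : 0 < eps / (Cmod k + 1) by apply: Rdiv_lt_0_compat; [apply: cond_pos | lra].
have [d Hd] := H t (fun P HP => HP) (mkposreal _ He).
exists d => s Hs; have := Hd s Hs; rewrite norm_C_R /=.
set D := (X in Cmod X <= _).
have ED : fst (k * D)%C = fst (k * g s)%C - fst (k * g t)%C - (s - t) * fst (k * l)%C.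
  rewrite /D; case: k {Hk He Hd D} => k1 k2; case: (g s) => a1 a2; case: (g t) => b1 b2; case: l {H} => l1 l2.
  rewrite /minus /plus /opp /scal /= /prod_plus /prod_opp /prod_scal /= /scal /= /mult /= /plus /opp /=.
  ring.
change (norm (minus s t)) with (Rabs (s - t)).
move=> K.
change (Rabs (fst (k * g s)%C - fst (k * g t)%C - (s - t) * fst (k * l)%C) <= eps * Rabs (s - t)).
rewrite -ED; apply: Rle_trans (Rabs_fst_Cmod _) _; rewrite Cmod_mult.
have -> : eps * Rabs (s - t) = (Cmod k + 1) * (eps / (Cmod k + 1) * Rabs (s - t)) by field; lra.
have := Cmod_ge_0 D; nra.
Qed.

(** The real mean value inequality is applied to the component of [f] along [u = f b - f a], that
    is, to the real part of [Cconj u * f] on the segment, whose increment is [|u|^2]. *)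
Lemma mean_value_ineq f a b M : entire f ->
  (forall w, Cmod (w - a) <= Cmod (b - a) -> Cmod (Cderiv f w) <= M) ->
  Cmod (f b - f a) <= M * Cmod (b - a).
Proof.
move=> /entire_cdiff Hf HM.
set u := (f b - f a)%C.
case: (Req_dec (Cmod u) 0) => [->|Hu0].
  apply: Rmult_le_pos; last exact: Cmod_ge_0.
  apply: Rle_trans (Cmod_ge_0 _) (HM a _).
  by rewrite (_ : (a - a = 0)%C) ?Cmod_0; [apply: Cmod_ge_0 | ring].
have Hu : 0 < Cmod u by have := Cmod_ge_0 u; lra.
pose g (s : R) : C := f (a + RtoC s * (b - a))%C.
have := bounded_variation (fun s => fst (Cconj u * g s)%C)
  (fun s => fst (Cconj u * (Cderiv f (a + RtoC s * (b - a)) * (b - a)))%C) (Cmod u * (M * Cmod (b - a))) 0 1.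
have -> : fst (Cconj u * g 1)%C - fst (Cconj u * g 0)%C = Cmod u * Cmod u.
  rewrite /g (_ : (a + 1 * (b - a) = b)%C); last by ring.
  rewrite (_ : (a + 0 * (b - a) = a)%C); last by ring.
  have -> : fst (Cconj u * f b)%C - fst (Cconj u * f a)%C = fst (Cconj u * u)%C.
    by rewrite /u /Cmult /Cminus /Cplus /Copp /=; ring.
  have -> : Cmod u * Cmod u = Cmod u ^ 2 by ring.
  by rewrite Cmod2_alt /Re /Im /Cconj /=; ring.
rewrite !(Rminus_0_r 1) Rabs_R1 !Rmult_1_r Rabs_pos_eq; last nra.
move=> H; apply: (Rmult_le_reg_l (Cmod u)) => //.
apply: H => t Ht; split.
  exact: is_derive_real_part (cdiff_curve f a (b - a)%C t _ (Hf _)).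
apply: Rle_trans (Rabs_fst_Cmod _) _.
rewrite !Cmod_mult Cmod_conj; apply: Rmult_le_compat_l; first lra.
apply: Rmult_le_compat_r; first exact: Cmod_ge_0.
apply: HM; rewrite (_ : (a + t * (b - a) - a = t * (b - a))%C); last by ring.
rewrite Cmod_mult Cmod_R; rewrite Rminus_0_r in Ht; have := Cmod_ge_0 (b - a); nra.
Qed.

Section local_bounds.
Variables (f : C -> C) (R B : R).
Hypothesis Hf : entire f.
Hypothesis HB : forall z, Cmod z <= R + 3 -> Cmod (f z) <= B.

(** Each lemma of this section consumes part of the margin in [R + 3]: unit circles lead from
    [R + 3] to [R + 2] for the derivative, then increments of length 1 to [R + 1], then unit circles
    again to [R]. *)
Lemma deriv_local_bound c : Cmod c <= R + 2 -> Cmod (Cderiv f c) <= 2 * B.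
Proof.
move=> Hc.
have := cauchy_deriv f c _ 1 B Hf (proj1 (entire_cdiff f) Hf c) Rlt_0_1.
rewrite Rmult_1_r; apply=> w Hw; apply: HB.
rewrite (_ : (w = (w - c) + c)%C); last by ring.
by apply: Rle_trans (Cmod_triangle _ _) _; lra.
Qed.

Lemma local_lipschitz w h : Cmod w <= R + 1 -> Cmod h <= 1 ->
  Cmod (f (w + h)%C - f w) <= 2 * B * Cmod h.
Proof.
move=> Hw Hh.
have E : (w + h - w = h)%C by ring.
have := mean_value_ineq f w (w + h)%C (2 * B) Hf; rewrite E; apply=> v Hv.
apply: deriv_local_bound.
rewrite (_ : (v = (v - w) + w)%C); last by ring.
by apply: Rle_trans (Cmod_triangle _ _) _; lra.
Qed.

Lemma cdiff_shift h z : cdiff (fun w => f (w + h)%C) z (Cderiv f (z + h)%C).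
Proof.
apply: (cdiff_eq _ _ ((1 + 0) * Cderiv f (z + h))%C); first by ring.
apply: (cdiff_comp f (fun w => w + h)%C); first exact: (proj1 (entire_cdiff f) Hf _).
exact: cdiff_plus (cdiff_id z) (cdiff_const h z).
Qed.

(** Cauchy's estimate is applied to the difference [f (w + h) - f w], already of size [2 * B * |h|];
    a second derivative is not yet known to exist. *)
Lemma deriv_local_lipschitz c h : Cmod c <= R -> Cmod h <= 1 ->
  Cmod (Cderiv f (c + h)%C - Cderiv f c) <= 4 * B * Cmod h.
Proof.
move=> Hc Hh.
have D z : cdiff (fun w => f (w + h) - f w)%C z (Cderiv f (z + h) - Cderiv f z)%C.
  exact: cdiff_minus (cdiff_shift h z) (proj1 (entire_cdiff f) Hf z).
have := cauchy_deriv _ c _ 1 (2 * B * Cmod h) (entireP _ _ D) (D c) Rlt_0_1.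
rewrite Rmult_1_r => H.
have -> : 4 * B * Cmod h = 2 * (2 * B * Cmod h) by ring.
apply: H => w Hw; apply: local_lipschitz => //.
rewrite (_ : (w = (w - c) + c)%C); last by ring.
by apply: Rle_trans (Cmod_triangle _ _) _; lra.
Qed.

Lemma taylor_local w h : Cmod w <= R -> Cmod h <= 1 ->
  Cmod (f (w + h)%C - f w - Cderiv f w * h) <= 4 * B * (Cmod h * Cmod h).
Proof.
move=> Hw Hh.
pose g v := (f v - Cderiv f w * v)%C.
have D z : cdiff g z (Cderiv f z - Cderiv f w * 1)%C.
  exact: cdiff_minus (proj1 (entire_cdiff f) Hf z) (cdiff_scal _ _ _ _ (cdiff_id z)).
have E : (w + h - w = h)%C by ring.
have := mean_value_ineq g w (w + h)%C (4 * B * Cmod h) (entireP _ _ D); rewrite E.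
have -> : (g (w + h) - g w = f (w + h) - f w - Cderiv f w * h)%C by rewrite /g; ring.
rewrite -Rmult_assoc; apply=> v Hv.
rewrite (cdiff_Cderiv _ _ _ (D v)).
have -> : (Cderiv f v - Cderiv f w * 1 = Cderiv f (w + (v - w)) - Cderiv f w)%C.
  by rewrite (_ : (w + (v - w) = v)%C); ring.
apply: Rle_trans (deriv_local_lipschitz w (v - w)%C Hw _) _; first lra.
apply: Rmult_le_compat_l => //.
have := HB 0%C; rewrite Cmod_0; have := Cmod_ge_0 (f 0%C); have := Cmod_ge_0 w; move=> ? ? H.
have := H ltac:(lra); lra.
Qed.
End local_bounds.

Lemma entire_bounded f r : entire f ->
  exists K, 0 < K /\ forall z, Cmod z <= r -> Cmod (f z) <= K.
Proof. by move=> Hf; apply: ccont_bounded => z; apply: entire_ccont. Qed.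

Lemma quotient_limit (q : C -> C) K : 0 <= K ->
  (forall h k, 0 < Cmod h <= 1 -> 0 < Cmod k <= 1 -> Cmod (q h - q k) <= K * (Cmod h + Cmod k)) ->
  exists L, forall h, 0 < Cmod h <= 1 -> Cmod (q h - L) <= K * Cmod h.
Proof.
move=> HK0 HK.
pose s n := RtoC (/ INR (S n)).
have Hs n : Cmod (s n) = / INR (S n).
  rewrite /s Cmod_R Rabs_pos_eq //; apply: Rlt_le; apply: Rinv_0_lt_compat.
  exact: lt_0_INR (Nat.lt_0_succ n).
have Hs1 n : 0 < Cmod (s n) <= 1.
  rewrite Hs; split; first by apply: Rinv_0_lt_compat; apply: lt_0_INR; lia.
  rewrite -Rinv_1; apply: Rinv_le_contravar; first lra.
  by rewrite S_INR; have := pos_INR n; lra.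
have small eps : 0 < eps -> exists N, forall n, (N <= n)%nat -> K * Cmod (s n) < eps.
  move=> He.
  have [N [HN1 HN2]] := archimed_cor1 (eps / (K + 1)) ltac:(apply: Rdiv_lt_0_compat; lra).
  exists N => n Hn.
  have H1 : Cmod (s n) <= / INR N.
    rewrite Hs; apply: Rinv_le_contravar; first exact: lt_0_INR.
    by apply: le_INR; lia.
  have : / INR N * (K + 1) < eps by apply/Rlt_div_r; lra.
  have := proj1 (Hs1 n); nra.
have cau (pr : C -> R) : (forall x y, Rabs (pr x - pr y) <= Cmod (x - y)) ->
   exists l : R, forall eps, 0 < eps -> exists N, forall n, (N <= n)%nat -> Rabs (pr (q (s n)) - l) < eps.
  move=> Hpr.
  have [|l Hl] := proj2 (ex_lim_seq_cauchy_corr (fun n => pr (q (s n)))).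
    move=> eps; have [N HN] := small (eps / 2) ltac:(have := cond_pos eps; lra).
    exists N => n m Hn Hm.
    apply: Rle_lt_trans (Hpr _ _) _.
    apply: Rle_lt_trans (HK _ _ (Hs1 n) (Hs1 m)) _.
    by have := HN n Hn; have := HN m Hm; lra.
  exists l => eps He; move/is_lim_seq_spec in Hl.
  by have [N HN] := Hl (mkposreal eps He); exists N.
have [l1 H1] := cau fst (fun x y => Rabs_fst_Cmod (x - y)).
have [l2 H2] := cau snd (fun x y => Rabs_snd_Cmod (x - y)).
exists (l1, l2) => h Hh; apply: le_epsilon => eps He.
have [N1 {}H1] := H1 (eps / 3) ltac:(lra).
have [N2 {}H2] := H2 (eps / 3) ltac:(lra).
have [N3 H3] := small (eps / 3) ltac:(lra).
pose n := (N1 + N2 + N3)%nat.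
have {}H1 := H1 n ltac:(rewrite /n; lia).
have {}H2 := H2 n ltac:(rewrite /n; lia).
have {}H3 := H3 n ltac:(rewrite /n; lia).
rewrite (_ : (q h - (l1, l2) = (q h - q (s n)) + (q (s n) - (l1, l2)))%C); last by ring.
apply: Rle_trans (Cmod_triangle _ _) _.
have := HK _ _ Hh (Hs1 n).
have : Cmod (q (s n) - (l1, l2)) <= eps / 3 + eps / 3.
  by apply: Rle_trans (Cmod_le_Rabs _) _ => /=; apply: Rplus_le_compat; apply: Rlt_le.
lra.
Qed.

(** The difference quotients [E u] are within [4 * B * |u|] of the derivative near [c], so
    [E h - E k] is small on the unit circle around [c]; Cauchy's estimate then makes its derivative
    at [c], which is [q h - q k], small as well, and the quotients of the derivative converge. *)
Lemma entire_Cderiv f : entire f -> entire (Cderiv f).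
Proof.
move=> Hf c.
have [B [HB0 HB]] := entire_bounded f (Cmod c + 1 + 3) Hf.
pose q h := ((Cderiv f (c + h) - Cderiv f c) / h)%C.
have Hq h k : 0 < Cmod h <= 1 -> 0 < Cmod k <= 1 -> Cmod (q h - q k) <= 8 * B * (Cmod h + Cmod k).
  move=> [Hh0 Hh] [Hk0 Hk].
  have Hh0' : h <> 0%C by apply/Cmod_gt_0.
  have Hk0' : k <> 0%C by apply/Cmod_gt_0.
  pose E u w := (/ u * (f (w + u) - f w))%C.
  have DE u z : cdiff (E u) z (/ u * (Cderiv f (z + u) - Cderiv f z))%C.
    apply: cdiff_scal; exact: cdiff_minus (cdiff_shift f Hf u z) (proj1 (entire_cdiff f) Hf z).
  have D z := cdiff_minus _ _ z _ _ (DE h z) (DE k z).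
  have BE u w : 0 < Cmod u <= 1 -> Cmod w <= Cmod c + 1 -> Cmod (E u w - Cderiv f w) <= 4 * B * Cmod u.
    move=> [Hu0 Hu] Hw.
    have Hu' : u <> 0%C by apply/Cmod_gt_0.
    have -> : (E u w - Cderiv f w = (f (w + u) - f w - Cderiv f w * u) / u)%C by rewrite /E; field.
    rewrite Cmod_div //; apply/Rle_div_l => //.
    apply: Rle_trans (taylor_local f (Cmod c + 1) B Hf HB w u Hw Hu) _; lra.
  have := cauchy_deriv _ c _ 1 (4 * B * Cmod h + 4 * B * Cmod k) (entireP _ _ D) (D c) Rlt_0_1.
  rewrite Rmult_1_r.
  have -> : (/ h * (Cderiv f (c + h) - Cderiv f c) - / k * (Cderiv f (c + k) - Cderiv f c) = q h - q k)%C.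
    by rewrite /q; field.
  move=> H; apply: Rle_trans (H _) _; last lra.
  move=> w Hw.
  have Hwc : Cmod w <= Cmod c + 1.
    rewrite (_ : (w = (w - c) + c)%C); last by ring.
    by apply: Rle_trans (Cmod_triangle _ _) _; lra.
  rewrite (_ : (E h w - E k w = (E h w - Cderiv f w) + - (E k w - Cderiv f w))%C); last by ring.
  apply: Rle_trans (Cmod_triangle _ _) _; rewrite Cmod_opp.
  by have := BE h w ltac:(lra) Hwc; have := BE k w ltac:(lra) Hwc; lra.
have [L HL] := quotient_limit q (8 * B) ltac:(lra) Hq.
exists L; apply/cdiff_derive => eps He.
exists (Rmin 1 (eps / (8 * B))); split.
  by apply: Rmin_glb_lt; [lra | apply: Rdiv_lt_0_compat; lra].
move=> w Hw.
have Hw1 : Cmod (w - c) < 1 by apply: Rlt_le_trans Hw (Rmin_l _ _).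
have : Cmod (w - c) < eps / (8 * B) by apply: Rlt_le_trans Hw (Rmin_r _ _).
move=> /Rlt_div_r Hw2.
have {}Hw2 := Hw2 ltac:(lra).
case: (Req_dec (Cmod (w - c)) 0) => [H0|H0].
  have E0 := Cmod_eq_0 _ H0.
  have -> : w = c by transitivity ((w - c) + c)%C; [ring | rewrite E0; ring].
  rewrite (_ : (Cderiv f c - Cderiv f c - L * (c - c) = 0)%C); last by ring.
  rewrite (_ : (c - c = 0)%C) ?Cmod_0; [lra | ring].
have Hp : 0 < Cmod (w - c) by have := Cmod_ge_0 (w - c); lra.
have Hwc : (w - c)%C <> 0%C by apply/Cmod_gt_0.
have := HL (w - c)%C ltac:(lra).
have -> : (q (w - c) - L = (Cderiv f w - Cderiv f c - L * (w - c)) / (w - c))%C.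
  by rewrite /q (_ : (c + (w - c) = w)%C); [field | ring].
rewrite Cmod_div //.
move=> /Rle_div_l H; have {}H := H Hp.
apply: Rle_trans H _; apply: Rmult_le_compat_r; lra.
Qed.

(** * Primitives by integration along rays *)

Lemma rc_ray (h : C -> C) z t : entire h -> ccontinuous (fun t => h (RtoC t * z)%C) t.
Proof.
move=> Hh; apply: (rc_comp h (fun t => RtoC t * z)%C); first exact: entire_ccont.
apply: (continuous_ext (fun t => 0 + z * RtoC t)%C); last exact: rc_affine.
by move=> s; change (0 + z * RtoC s = RtoC s * z)%C; ring.
Qed.

Lemma CI_derive_ray (h : C -> C) z : entire h ->
  CI (fun t => h (RtoC t * z) + RtoC t * z * Cderiv h (RtoC t * z))%C 0 1 = h z.
Proof.
move=> Hh.
pose H w := (w * h (w * z))%C.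
have DH w : cdiff H w (1 * h (w * z) + w * ((1 * z + w * 0) * Cderiv h (w * z)))%C.
  apply: cdiff_mult; first exact: cdiff_id.
  apply: (cdiff_comp h (fun w => w * z)%C); first exact: (proj1 (entire_cdiff h) Hh _).
  exact: cdiff_mult (cdiff_id w) (cdiff_const z w).
apply: (@is_RInt_unique C_R_CompleteNormedModule).
have -> : h z = minus (H (0 + RtoC 1 * 1)%C) (H (0 + RtoC 0 * 1)%C) :> C.
  change (h z = H (0 + RtoC 1 * 1) - H (0 + RtoC 0 * 1))%C.
  have E1 : ((0 + 1 * 1) * z = z)%C by ring.
  by rewrite /H E1; ring.
apply: (@is_RInt_derive C_R_CompleteNormedModule (fun t => H (0 + RtoC t * 1)%C)).
  move=> t _.
  have := cdiff_curve H 0 1 t _ (DH _).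
  rewrite (_ : (0 + t * 1 = t)%C); last by ring.
  by rewrite (_ : (_ * 1 = h (t * z) + t * z * Cderiv h (t * z))%C); last by ring.
move=> t _; apply: rc_plus; first exact: rc_ray.
apply: (rc_mult (fun t => t * z)%C); first exact: (rc_ray (fun w => w) z t entire_id).
exact: rc_ray (entire_Cderiv h Hh).
Qed.

(** The increment of [cint0 h] and, by [CI_derive_ray], the value [h z] are both integrals over
    [[0, 1]], so the error is one integral. Pointwise it is at most [K * |k|^2], where [4 * B * |z|]
    comes from Taylor's estimate and [2 * B] from the Lipschitz bound. *)
Lemma cdiff_cint0 (h : C -> C) z : entire h -> cdiff (cint0 h) z (h z).
Proof.
move=> Hh eps He.
have Hz := Cmod_ge_0 z.
have [B [HB0 HB]] := entire_bounded h (Cmod z + 3) Hh.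
pose K := 4 * B * Cmod z + 2 * B.
have HK : 0 < K by rewrite /K; nra.
exists (Rmin 1 (eps / K)); split.
  by apply: Rmin_glb_lt; [lra | apply: Rdiv_lt_0_compat].
move=> w; set k := (w - z)%C => Hk.
have Hk1 : Cmod k < 1 by apply: Rlt_le_trans Hk (Rmin_l _ _).
have : Cmod k < eps / K by apply: Rlt_le_trans Hk (Rmin_r _ _).
move=> /Rlt_div_r Hk2; have {}Hk2 := Hk2 HK.
have Ew : w = (z + k)%C by rewrite /k; ring.
rewrite Ew -{1}(CI_derive_ray h z Hh) /cint0.
have C1 u t : ccontinuous (fun t => h (RtoC t * u) * u)%C t.
  by apply: rc_mult; [exact: rc_ray | exact: rc_const].
have C2 t : ccontinuous (fun t => h (RtoC t * z) + RtoC t * z * Cderiv h (RtoC t * z))%C t.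
  apply: rc_plus; first exact: rc_ray.
  apply: (rc_mult (fun t => t * z)%C); first exact: (rc_ray (fun w => w) z t entire_id).
  exact: rc_ray (entire_Cderiv h Hh).
have C3 t : ccontinuous (fun t => k * (h (RtoC t * z) + RtoC t * z * Cderiv h (RtoC t * z)))%C t.
  exact: rc_scal.
have C4 t : ccontinuous (fun t => h (RtoC t * (z + k)) * (z + k) - h (RtoC t * z) * z)%C t.
  apply: (continuous_ext (fun t => h (RtoC t * (z + k)) * (z + k) + (-(1)) * (h (RtoC t * z) * z))%C).
    by move=> s; change (h (RtoC s * (z + k)) * (z + k) + (-(1)) * (h (RtoC s * z) * z) =
       h (RtoC s * (z + k)) * (z + k) - h (RtoC s * z) * z)%C; ring.
  by apply: rc_plus => //; apply: rc_scal.
rewrite (Cmult_comm _ k) -CI_scal // -CI_minus // -CI_minus //.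
apply: Rle_trans (CI_norm_const _ 0 1 (K * (Cmod k * Cmod k)) Rle_0_1 _ _) _; last 1 first.
- have := Cmod_ge_0 k; nra.
- move=> t.
  apply: (continuous_ext (fun t => (h (RtoC t * (z + k)) * (z + k) - h (RtoC t * z) * z) +
    (-(1)) * (k * (h (RtoC t * z) + RtoC t * z * Cderiv h (RtoC t * z))))%C).
    move=> s; set A := h _; set B' := h _; set D := Cderiv _ _.
    by change (A * (z + k) - B' * z + (-(1)) * (k * (B' + RtoC s * z * D)) =
      A * (z + k) - B' * z - k * (B' + RtoC s * z * D))%C; ring.
  by apply: rc_plus => //; apply: rc_scal.
move=> t Ht.
have Mt : Cmod (RtoC t) = t by rewrite Cmod_R Rabs_pos_eq; lra.
have H1 : Cmod (RtoC t * z) <= Cmod z by rewrite Cmod_mult Mt; nra.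
have Htk : Cmod (RtoC t * k) <= Cmod k by rewrite Cmod_mult Mt; have := Cmod_ge_0 k; nra.
have H2 : Cmod (RtoC t * k) <= 1 by lra.
have T1 := taylor_local h (Cmod z) B Hh HB _ _ H1 H2.
have T2 := local_lipschitz h (Cmod z) B Hh HB _ _ (ltac:(lra) : Cmod (RtoC t * z) <= Cmod z + 1) H2.
have -> : (RtoC t * (z + k) = RtoC t * z + RtoC t * k)%C by ring.
set A := h (_ + _)%C in T1 T2 *; set A0 := h _ in T1 T2 *; set A1 := Cderiv _ _ in T1 *.
have -> : (A * (z + k) - A0 * z - k * (A0 + RtoC t * z * A1) =
   (A - A0 - A1 * (RtoC t * k)) * z + (A - A0) * k)%C by ring.
apply: Rle_trans (Cmod_triangle _ _) _; rewrite !Cmod_mult.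
have Hk0 := Cmod_ge_0 k; have Htk0 := Cmod_ge_0 (RtoC t * k).
have U1 : Cmod (A - A0 - A1 * (RtoC t * k)) * Cmod z <= 4 * B * (Cmod k * Cmod k) * Cmod z.
  apply: Rmult_le_compat_r => //; apply: Rle_trans T1 _.
  by apply: Rmult_le_compat_l; [lra | apply: Rmult_le_compat].
have U2 : Cmod (A - A0) * Cmod k <= 2 * B * Cmod k * Cmod k.
  apply: Rmult_le_compat_r => //; apply: Rle_trans T2 _.
  by apply: Rmult_le_compat_l; lra.
rewrite /K; lra.
Qed.

Lemma entire_cint0 h : entire h -> entire (cint0 h).
Proof. by move=> Hh; apply: entireP => z; apply: cdiff_cint0. Qed.

Lemma Cmod_sub_sym z w : Cmod (z - w) = Cmod (w - z).
Proof. by rewrite -Cmod_opp; congr Cmod; ring. Qed.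

(** * Division by linear factors and the identity theorem *)

Lemma cdiff_inv (z : C) : z <> 0%C -> cdiff (fun w => / w)%C z (- (/ (z * z)))%C.
Proof.
move=> Hz eps He.
have Hz0 : 0 < Cmod z by apply/Cmod_gt_0.
exists (Rmin (Cmod z / 2) (eps * (Cmod z * Cmod z * Cmod z) / 2)); split.
  apply: Rmin_glb_lt; first lra.
  by apply: Rdiv_lt_0_compat; [repeat apply: Rmult_lt_0_compat | lra].
move=> w Hw.
have H1 := Rlt_le_trans _ _ _ Hw (Rmin_l _ _).
have H2 := Rlt_le_trans _ _ _ Hw (Rmin_r _ _).
have Hw0 : Cmod z / 2 < Cmod w.
  have := Cmod_triangle (z - w) w; rewrite (_ : (z - w + w = z)%C); last by ring.
  rewrite (Cmod_sub_sym z w); lra.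
have Hw' : w <> 0%C by apply/Cmod_gt_0; lra.
have -> : (/ w - / z - - / (z * z) * (w - z) = (w - z) * (w - z) / (w * (z * z)))%C by field.
rewrite Cmod_div; last by apply: Cmult_neq_0 => //; apply: Cmult_neq_0.
rewrite !Cmod_mult; apply/Rle_div_l; first by repeat apply: Rmult_lt_0_compat; lra.
have -> : eps * Cmod (w - z) * (Cmod w * (Cmod z * Cmod z)) =
   Cmod (w - z) * (eps * (Cmod z * Cmod z) * Cmod w) by ring.
apply: Rmult_le_compat_l; first exact: Cmod_ge_0.
have : eps * (Cmod z * Cmod z) * (Cmod z / 2) <= eps * (Cmod z * Cmod z) * Cmod w.
  by apply: Rmult_le_compat_l; [apply: Rmult_le_pos; [lra | nra] | lra].
lra.
Qed.

(** A removable singularity: at [c] the quotient has value [f' c] and derivative half of [f'' c].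
    Removing the quadratic Taylor polynomial leaves [g] with a derivative that is small compared
    with [v - c], and the mean value inequality yields the second order estimate. *)
Lemma entire_quotient f c : entire f ->
  exists Q, entire Q /\ forall w, (f w - f c = Q w * (w - c))%C.
Proof.
move=> Hf.
have Df := proj1 (entire_cdiff f) Hf.
pose Q w := match excluded_middle_informative (w = c) with
  | left _ => Cderiv f c | right _ => ((f w - f c) * / (w - c))%C end.
have Qc : Q c = Cderiv f c by rewrite /Q; case: excluded_middle_informative.
have Qn w : w <> c -> Q w = ((f w - f c) * / (w - c))%C.
  by move=> H; rewrite /Q; case: excluded_middle_informative.
have nz w : w <> c -> (w - c)%C <> 0%C.
  by move=> H E; apply: H; transitivity ((w - c) + c)%C; [ring | rewrite E; ring].
exists Q; split; last first.
  move=> w; case: (excluded_middle_informative (w = c)) => [->|H]; first by ring.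
  by rewrite Qn //; field; apply: nz.
move=> z; case: (excluded_middle_informative (z = c)) => [->|H]; last first.
  exists (Cderiv f z * / (z - c) + (f z - f c) * (1 * (- / ((z - c) * (z - c)))))%C.
  apply/cdiff_derive.
  have Hr : 0 < Cmod (z - c) by apply/Cmod_gt_0; apply: nz.
  apply: (cdiff_ext_loc (fun w => (f w - f c) * / (w - c))%C _ _ _ (Cmod (z - c))) => //.
    by move=> w Hw; rewrite Qn // => E; move: Hw; rewrite E Cmod_sub_sym; lra.
  apply: cdiff_mult.
    apply: (cdiff_eq _ _ (Cderiv f z - 0)%C); first by ring.
    exact: cdiff_minus (Df z) (cdiff_const _ _).
  apply: (cdiff_comp (fun w => / w)%C (fun w => w - c)%C).
    by apply: cdiff_inv; apply: nz.
  apply: (cdiff_eq _ _ (1 - 0)%C); first by ring.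
  exact: cdiff_minus (cdiff_id _) (cdiff_const _ _).
have Df' := proj1 (entire_cdiff _) (entire_Cderiv f Hf).
set L2 := Cderiv (Cderiv f) c.
exists (L2 / 2)%C; apply/cdiff_derive => eps He.
have [d [Hd K]] := Df' c eps He.
exists d; split=> // w Hw.
rewrite Qc; case: (excluded_middle_informative (w = c)) => [->|Hwc].
  rewrite Qc (_ : (Cderiv f c - Cderiv f c - L2 / 2 * (c - c) = 0)%C); last by ring.
  by rewrite (_ : (c - c = 0)%C) ?Cmod_0; [lra | ring].
rewrite Qn //; have Hnz := nz _ Hwc.
have Hp : 0 < Cmod (w - c) by apply/Cmod_gt_0.
pose g v := (f v - (Cderiv f c * v + L2 / 2 * ((v - c) * (v - c))))%C.
have Dg v : cdiff g v (Cderiv f v - (Cderiv f c * 1 + L2 / 2 * ((1 - 0) * (v - c) + (v - c) * (1 - 0))))%C.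
  apply: cdiff_minus => //; apply: cdiff_plus; first exact: cdiff_scal (cdiff_id _).
  have D1 : cdiff (fun v => v - c)%C v (1 - 0)%C by exact: cdiff_minus (cdiff_id _) (cdiff_const _ _).
  by apply: cdiff_scal; apply: cdiff_mult.
have := mean_value_ineq g c w (eps * Cmod (w - c)) (entireP _ _ Dg).
have -> : (g w - g c = f w - f c - Cderiv f c * (w - c) - L2 / 2 * ((w - c) * (w - c)))%C.
  by rewrite /g; ring.
have -> : ((f w - f c) * / (w - c) - Cderiv f c - L2 / 2 * (w - c) =
  (f w - f c - Cderiv f c * (w - c) - L2 / 2 * ((w - c) * (w - c))) / (w - c))%C by field.
move=> H; rewrite Cmod_div //; apply/Rle_div_l => //; apply: H => v Hv.
rewrite (cdiff_Cderiv _ _ _ (Dg v)).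
have -> : (Cderiv f v - (Cderiv f c * 1 + L2 / 2 * ((1 - 0) * (v - c) + (v - c) * (1 - 0))) =
  Cderiv f v - Cderiv f c - L2 * (v - c))%C by field.
apply: Rle_trans (K v _) _; first lra.
by apply: Rmult_le_compat_l; lra.
Qed.

Lemma vanishing_quotient f c n r : 0 < r -> entire f -> (forall w, Cmod (w - c) < r -> f w = 0%C) ->
  exists Q, entire Q /\ forall w, (f w = Q w * cpow (w - c) n)%C.
Proof.
move=> Hr Hf H0.
(* The induction also carries that [Q] vanishes on the disc, which is what permits the next
   division. *)
suff [Q [HQ [_ EQ]]] : exists Q, entire Q /\ (forall w, Cmod (w - c) < r -> Q w = 0%C) /\
   forall w, (f w = Q w * cpow (w - c) n)%C by exists Q.
elim: n => [|n [Q [HQ [HQ0 EQ]]]].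
  by exists f; split => //; split=> // w /=; ring.
have [Q' [HQ' EQ']] := entire_quotient Q c HQ.
have Qc : Q c = 0%C by apply: HQ0; rewrite (_ : (c - c = 0)%C) ?Cmod_0 //; ring.
have EQ'' w : (Q w = Q' w * (w - c))%C by rewrite -EQ' Qc; ring.
exists Q'; split=> //; split; last first.
  by move=> w; rewrite EQ EQ'' /=; ring.
have out w : Cmod (w - c) < r -> w <> c -> Q' w = 0%C.
  move=> Hw Hwc.
  have Hnz : (w - c)%C <> 0%C.
    by move=> E; apply: Hwc; transitivity ((w - c) + c)%C; [ring | rewrite E; ring].
  by have := EQ'' w; rewrite HQ0 // => E; apply: NNPP => /Cmult_neq_0 /(_ Hnz); rewrite -E.
move=> w Hw; case: (classic (w = c)) => [->|]; last exact: out.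
(* The value at the centre follows by continuity. *)
apply: Cmod_eq_0; apply: Rle_antisym; last exact: Cmod_ge_0.
apply: (entire_mean_bound Q' c (r / 2)) => //; first lra.
move=> v Hv; rewrite out ?Cmod_0; [lra | lra |].
by move=> E; move: Hv; rewrite E (_ : (c - c = 0)%C) ?Cmod_0; [lra | ring].
Qed.

(** Dividing by [(w - c)^n] for every [n] replaces a connectedness argument. On the circle of radius
    [rho] around [z] one has [|w - c| >= 2 * (d + 1)], against [|z - c| = d], so the mean bound for
    the quotient gives [|f z| <= B / 2^n]. *)
Lemma identity_theorem f c r : 0 < r -> entire f -> (forall w, Cmod (w - c) < r -> f w = 0%C) ->
  forall z, f z = 0%C.
Proof.
move=> Hr Hf H0 z.
pose d := Cmod (z - c).
have Hd : 0 <= d by apply: Cmod_ge_0.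
pose rho := 3 * (d + 1).
have [B [HB0 HB]] := entire_bounded f (Cmod z + rho) Hf.
have key n : Cmod (f z) * 2 ^ n <= B.
  have [Q [HQ EQ]] := vanishing_quotient f c n r Hr Hf H0.
  have Hp : 0 < (2 * (d + 1)) ^ n by apply: pow_lt; lra.
  have BQ : Cmod (Q z) <= B / (2 * (d + 1)) ^ n.
    apply: (entire_mean_bound Q z rho) => //; first by rewrite /rho; lra.
    move=> w Hw; apply/Rle_div_r => //.
    have Hwc : 2 * (d + 1) <= Cmod (w - c).
      have := Cmod_triangle (w - c) (- (z - c)); rewrite Cmod_opp.
      rewrite (_ : (w - c + - (z - c) = w - z)%C); last by ring.
      by rewrite Hw /rho /d in Hd *; lra.
    apply: Rle_trans (_ : Cmod (f w) <= B).
      rewrite EQ Cmod_mult Cmod_cpow; apply: Rmult_le_compat_l; first exact: Cmod_ge_0.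
      by apply: pow_incr; lra.
    apply: HB; rewrite (_ : (w = z + (w - z))%C); last by ring.
    by apply: Rle_trans (Cmod_triangle _ _) _; lra.
  have {}BQ : Cmod (Q z) * (2 * (d + 1)) ^ n <= B by apply/Rle_div_r.
  apply: Rle_trans BQ.
  rewrite EQ Cmod_mult Cmod_cpow -/d Rpow_mult_distr.
  have : d ^ n <= (d + 1) ^ n by apply: pow_incr; lra.
  have := Cmod_ge_0 (Q z); have : 0 < 2 ^ n by apply: pow_lt; lra.
  move=> H2 HQz Hdn.
  have : 0 <= Cmod (Q z) * 2 ^ n by nra.
  nra.
apply: NNPP => Hfz.
have Hpos : 0 < Cmod (f z) by apply/Cmod_gt_0.
have [n Hn] := pow_half_small (Cmod (f z) / (B + 1)) ltac:(apply: Rdiv_lt_0_compat; lra).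
have := key n; have Hp : 0 < 2 ^ n by apply: pow_lt; lra.
move: Hn => /Rlt_div_r H; have {}H := H ltac:(lra).
have : / 2 ^ n * 2 ^ n = 1 by field; lra.
nra.
Qed.

(** * Gaussian bounds for entire functions *)

Lemma le_exp_half_sq y : 0 <= y -> y <= exp ((y * y - 1) / 2).
Proof.
move=> Hy.
have H := exp_ineq1_le (y * y - 1).
have E : exp (y * y - 1) = exp ((y * y - 1) / 2) * exp ((y * y - 1) / 2).
  by rewrite -exp_plus; congr exp; field.
have := exp_pos ((y * y - 1) / 2).
case: (Rle_lt_dec y (exp ((y * y - 1) / 2))) => // *; nra.
Qed.

Lemma exp_le_mono x y : x <= y -> exp x <= exp y.
Proof. by case=> [/exp_increasing|->]; lra. Qed.

Lemma pow_exp x n : exp x ^ n = exp (INR n * x).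
Proof.
elim: n => [|n IH]; first by rewrite /= Rmult_0_l exp_0.
by rewrite S_INR /= IH -exp_plus; congr exp; ring.
Qed.

(** The function [x^k * exp (- x^2 / 2)] is largest at [x = sqrt k]; exponents [k = j * j] keep this
    maximiser an integer. *)
Lemma pow_le_gauss x j : 0 <= x -> (1 <= j)%nat ->
  x ^ (j * j) <= INR j ^ (j * j) * exp ((x * x - INR j * INR j) / 2).
Proof.
move=> Hx Hj.
have Hr : 0 < INR j by apply: lt_0_INR.
have H : x / INR j <= exp ((x / INR j * (x / INR j) - 1) / 2).
  by apply: le_exp_half_sq; apply: Rle_mult_inv_pos.
have {}H : (x / INR j) ^ (j * j) <= exp ((x * x - INR j * INR j) / 2).
  apply: Rle_trans (pow_incr _ _ (j * j) (conj _ H)) _; first exact: Rle_mult_inv_pos.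
  rewrite pow_exp mult_INR; apply: Req_le; congr exp; field; lra.
have -> : x = INR j * (x / INR j) by field; lra.
rewrite Rpow_mult_distr; apply: Rmult_le_compat_l; first by apply: pow_le; lra.
rewrite (_ : INR j * (x / INR j) = x) //; field; lra.
Qed.

Lemma Cmod2_fst_snd (z : C) : Cmod z ^ 2 = fst z ^ 2 + snd z ^ 2.
Proof. exact: Cmod2_alt. Qed.

Lemma Cmod_sqr (z : C) : Cmod z * Cmod z = fst z * fst z + snd z * snd z.
Proof. by have := Cmod2_fst_snd z => /=; rewrite !Rmult_1_r. Qed.

Section weighted_affine.
Variables (gam psi : C -> C) (K : R).
Hypothesis Hgam : entire gam.
Hypothesis Hpsi : entire psi.
Hypothesis HK : forall z, Cmod (gam z) * exp (/ 2 * (Cmod (psi z) ^ 2 - Cmod z ^ 2)) <= K * (1 + Cmod z).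

(* Translate [z0] and [psi z0] to the origin by a Weyl operator; Cauchy's estimate for
   [gam * psi ^ k] on the circle of radius [sqrt k], with [k = j * j], then bounds
   [|psi' z0| ^ k] by a linear function of [j]. *)
Lemma weighted_deriv_le1 z0 : gam z0 <> 0%C -> Cmod (Cderiv psi z0) <= 1.
Proof.
move=> Hz0.
pose v := psi z0.
pose Gam z := (gam z * cexp (Cconj v * psi z - Cconj z0 * z))%C.
pose phi z := (psi z - psi z0)%C.
have HGam : entire Gam.
  apply: entire_mult => //.
  apply: (entire_comp cexp) entire_cexp _.
  apply: entire_minus; apply: entire_mult => //; try exact: entire_const.
  exact: entire_id.
have Hphi : entire phi by apply: entire_minus Hpsi (entire_const _).
have HK0 : 0 <= K.
  have := HK 0%C; rewrite Cmod_0; have := Cmod_ge_0 (gam 0%C); have := exp_pos (/ 2 * (Cmod (psi 0%C) ^ 2 - 0 ^ 2)).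
  nra.
pose K1 := K * exp (/ 2 * (Cmod v ^ 2 - Cmod z0 ^ 2)) * (1 + Cmod z0).
have HK1 : 0 <= K1.
  rewrite /K1; apply: Rmult_le_pos; last by have := Cmod_ge_0 z0; lra.
  by apply: Rmult_le_pos => //; apply: Rlt_le; apply: exp_pos.
have B h : Cmod (Gam (z0 + h)%C) <= K1 * (1 + Cmod h) * exp ((Cmod h * Cmod h - Cmod (phi (z0 + h)%C) * Cmod (phi (z0 + h)%C)) / 2).
  set z := (z0 + h)%C.
  rewrite /Gam Cmod_mult Cmod_cexp.
  have E : fst (Cconj v * psi z - Cconj z0 * z)%C =
    / 2 * (Cmod (psi z) ^ 2 - Cmod z ^ 2) + / 2 * (Cmod v ^ 2 - Cmod z0 ^ 2) +
    (Cmod h * Cmod h - Cmod (phi z) * Cmod (phi z)) / 2.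
    have -> : h = (z - z0)%C by rewrite /z; ring.
    rewrite !Cmod2_fst_snd !Cmod_sqr /phi -/v.
    by rewrite /Cconj /Cmult /Cminus /Cplus /Copp /=; field.
  rewrite E !exp_plus -!Rmult_assoc; apply: Rmult_le_compat_r; first by apply: Rlt_le; apply: exp_pos.
  have E2 := exp_pos (/ 2 * (Cmod v ^ 2 - Cmod z0 ^ 2)).
  apply: Rle_trans (Rmult_le_compat_r _ _ _ (Rlt_le _ _ E2) (HK z)) _.
  rewrite /K1.
  have : 1 + Cmod z <= (1 + Cmod z0) * (1 + Cmod h).
    have := Cmod_triangle z0 h; rewrite -/z; have := Cmod_ge_0 z0; have := Cmod_ge_0 h; nra.
  set e := exp _ in E2 *; move=> Hz.
  have -> : K * (1 + Cmod z) * e = K * e * (1 + Cmod z) by ring.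
  rewrite [X in _ <= X]Rmult_assoc; apply: Rmult_le_compat_l => //; nra.
have D := proj1 (entire_cdiff psi) Hpsi z0.
have key j : (1 <= j)%nat -> Cmod (Gam z0) * Cmod (Cderiv psi z0) ^ (j * j) <= K1 * (1 + INR j).
  move=> Hj.
  have Hr : 0 < INR j by apply: lt_0_INR.
  pose f z := (Gam z * cpow (phi z) (j * j))%C.
  have Hf : entire f by apply: entire_mult => //; apply: entire_cpow.
  have HL : lead f z0 (j * j) (Gam z0 * cpow (Cderiv psi z0) (j * j))%C.
    apply: (lead_mult Gam (fun z => cpow (phi z) (j * j)) z0 0 (j * j)).
      by apply: lead_0; apply: entire_ccont.
    by apply: lead_cpow; apply: lead_1.
  have := cauchy_estimate f z0 (j * j) _ (INR j) (K1 * (1 + INR j) * INR j ^ (j * j)) Hf HL Hr.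
  rewrite Cmod_mult Cmod_cpow => H.
  have Hp : 0 < INR j ^ (j * j) by apply: pow_lt.
  apply: (Rmult_le_reg_r _ _ _ Hp); apply: H => h Hh.
  rewrite /f Cmod_mult Cmod_cpow.
  have H1 := B h; rewrite Hh in H1.
  have H2 := pow_le_gauss (Cmod (phi (z0 + h)%C)) j (Cmod_ge_0 _) Hj.
  set x := Cmod (phi _) in H1 H2 *.
  apply: Rle_trans (Rmult_le_compat _ _ _ _ (Cmod_ge_0 _) _ H1 H2) _.
    by apply: pow_le; apply: Cmod_ge_0.
  apply: Req_le.
  have : exp ((INR j * INR j - x * x) / 2) * exp ((x * x - INR j * INR j) / 2) = 1.
    by rewrite -exp_plus -exp_0; congr exp; field.
  set e1 := exp _; set e2 := exp _ => E.
  transitivity (K1 * (1 + INR j) * INR j ^ (j * j) * (e1 * e2)); first by ring.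
  by rewrite E; ring.
apply: Rnot_lt_le => Hgt.
have Hm : 0 < Cmod (Gam z0).
  rewrite /Gam Cmod_mult; apply: Rmult_lt_0_compat; first exact/Cmod_gt_0.
  by apply/Cmod_gt_0; apply: cexp_neq0.
set m := Cmod (Gam z0) in Hm key.
set x := Cmod (Cderiv psi z0) - 1.
have Hx : 0 < x by rewrite /x; lra.
(* By Bernoulli's inequality the left side of [key] is at least [m * N^2 * x], while the right side
   is at most [2 * K1 * N]; this [N] has [m * x * N > 2 * K1 + 1]. *)
have [N [HN1 HN2]] := archimed_cor1 (m * x / (2 * K1 + 1)) ltac:(apply: Rdiv_lt_0_compat; [nra | lra]).
have HN : 1 <= INR N by rewrite -[1]/(INR 1); apply: le_INR; lia.
have := key N ltac:(lia).
have : 1 + INR (N * N) * x <= Cmod (Cderiv psi z0) ^ (N * N).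
  by rewrite -{1}[x]Rmult_1_r (_ : Cmod (Cderiv psi z0) = 1 + x) ?Rmult_1_r; [apply: poly | rewrite /x; ring].
rewrite mult_INR.
move: HN1 => /Rlt_div_r H; have {}H := H ltac:(lra).
have H' : 2 * K1 + 1 < m * x * INR N.
  have E : / INR N * INR N = 1 by field; lra.
  nra.
set y := Cmod (Cderiv psi z0) ^ _ => P1 P2.
have P3 : m * (INR N * INR N * x) <= K1 * (1 + INR N) by nra.
nra.
Qed.

(** By the identity theorem the zeros of [gam] fill no disc, so continuity of [psi'] extends
    [|psi'| <= 1] to the whole plane. Cauchy's estimate on circles of radius [2 / eps] then kills
    the second derivative, as in Liouville's theorem. *)
Lemma weighted_affine : (exists z, gam z <> 0%C) ->
  exists a b, Cmod a <= 1 /\ forall z, psi z = (a * z + b)%C.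
Proof.
move=> [z1 Hz1].
have Hpsi' := entire_Cderiv psi Hpsi.
have D1 : forall z, Cmod (Cderiv psi z) <= 1.
  move=> z; apply: Rnot_lt_le => Hz.
  have [d [Hd Hc]] := entire_ccont _ z Hpsi' (Cmod (Cderiv psi z) - 1) ltac:(lra).
  apply: Hz1; apply: (identity_theorem gam z d Hd Hgam) => w Hw.
  apply: NNPP => /weighted_deriv_le1 H.
  have := Hc w Hw; have := Cmod_triangle (Cderiv psi z - Cderiv psi w) (Cderiv psi w).
  rewrite (_ : (Cderiv psi z - Cderiv psi w + Cderiv psi w = Cderiv psi z)%C); last by ring.
  rewrite Cmod_sub_sym.
  lra.
have D2 c : Cmod (Cderiv (Cderiv psi) c) <= 0.
  apply: le_epsilon => eps He.
  have := cauchy_deriv _ c _ (2 / eps) 1 Hpsi' (proj1 (entire_cdiff _) Hpsi' c) ltac:(apply: Rdiv_lt_0_compat; lra) (fun w _ => D1 w).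
  move=> /Rle_div_r H; have {}H := H ltac:(apply: Rdiv_lt_0_compat; lra).
  by move: H; rewrite (_ : 2 * 1 / (2 / eps) = eps); [lra | field; lra].
pose a := Cderiv psi 0.
have D3 z : Cderiv psi z = a.
  have := mean_value_ineq _ 0 z 0 Hpsi' (fun w _ => D2 w).
  rewrite Rmult_0_l => H.
  have E : (Cderiv psi z - Cderiv psi 0 = 0)%C.
    by apply: Cmod_eq_0; apply: Rle_antisym => //; apply: Cmod_ge_0.
  by transitivity (Cderiv psi z - Cderiv psi 0 + a)%C; [rewrite /a; ring | rewrite E; ring].
exists a, (psi 0%C); split; first exact: D1.
move=> z.
have Dg w : cdiff (fun w => psi w - a * w)%C w (Cderiv psi w - a * 1)%C.
  exact: cdiff_minus (proj1 (entire_cdiff _) Hpsi w) (cdiff_scal _ _ _ _ (cdiff_id w)).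
have := mean_value_ineq _ 0 z 0 (entireP _ _ Dg).
rewrite Rmult_0_l => H.
have E : (psi z - a * z - (psi 0 - a * 0) = 0)%C.
  apply: Cmod_eq_0; apply: Rle_antisym; last exact: Cmod_ge_0.
  apply: H => w _; rewrite (cdiff_Cderiv _ _ _ (Dg w)) D3.
  by rewrite (_ : (a - a * 1 = 0)%C) ?Cmod_0; [lra | ring].
transitivity ((psi z - a * z - (psi 0 - a * 0)) + (a * z + psi 0))%C; first by ring.
by rewrite E; ring.
Qed.
End weighted_affine.

(** * A Cauchy formula up to constants on rectangles *)

Lemma CI_linear_ge (k : C) (g : R -> C) a b m : a <= b -> (forall t, ccontinuous g t) ->
  (forall t, a <= t <= b -> m <= fst (k * g t)%C) -> m * (b - a) <= fst (k * CI g a b)%C.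
Proof.
move=> Hab Hg Hm; rewrite -CI_scal //.
have Hkg t : ccontinuous (fun t => k * g t)%C t by apply: rc_scal.
have H := is_RInt_fct_extend_fst _ _ _ _ (CI_correct _ a b Hkg).
have Hc : is_RInt (fun _ => m) a b ((b - a) * m) by apply: (is_RInt_const a b m).
rewrite Rmult_comm.
by apply: (is_RInt_le _ _ _ _ _ _ Hab Hc H) => t Ht; apply: Hm; lra.
Qed.

Lemma RInt_pos_enlarge (f : R -> R) a b c d : a <= b -> b <= c -> c <= d ->
  (forall t, continuous f t) -> (forall t, 0 <= f t) -> RInt f b c <= RInt f a d.
Proof.
move=> Hab Hbc Hcd Hf Hp.
have ex u v : ex_RInt f u v by apply: ex_RInt_continuous => t _; apply: Hf.
rewrite -(RInt_Chasles f a b d) // -(RInt_Chasles f b c d) //.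
have := RInt_ge_0 f a b Hab (ex _ _) (fun t _ => Hp t).
have := RInt_ge_0 f c d Hcd (ex _ _) (fun t _ => Hp t).
rewrite /plus /=; lra.
Qed.

Section rectangle_bound.
Variables (f : C -> C) (cx cy r : R).
Hypothesis Hf : entire f.
Hypothesis Hr : 0 < r.
Let c : C := (cx, cy).
Let inv (w : C) : C := (/ (w - c))%C.

Lemma inv_fst w : fst (inv w) = (fst w - cx) / ((fst w - cx) * (fst w - cx) + (snd w - cy) * (snd w - cy)).
Proof. by rewrite /inv /Cinv /=; congr Rdiv; ring. Qed.

Lemma inv_snd w : snd (inv w) = - (snd w - cy) / ((fst w - cx) * (fst w - cx) + (snd w - cy) * (snd w - cy)).
Proof. by rewrite /inv /Cinv /=; congr Rdiv; ring. Qed.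

(** One side's share of Goursat's theorem for the quotient [Q = (f - f c) / (w - c)]: [S] integrates
    [f / (w - c)] and [W] integrates [1 / (w - c)]. The factor [k] rotates the side so that [W]
    acquires a positive real part. *)
Lemma side_int (w : R -> C) (Q : C -> C) a b (k : C) : a + r <= b ->
  (forall t, ccontinuous w t) -> (forall t, w t <> c) -> entire Q ->
  (forall w, (f w - f c = Q w * (w - c))%C) ->
  (forall t, a <= t <= b -> / (4 * r) <= fst (k * inv (w t))%C) ->
  (forall t, r / 2 <= Cmod (w t - c)) ->
  exists W S, CI (fun t => Q (w t)) a b = (S - f c * W)%C :> C /\ / 4 <= fst (k * W)%C /\
    Cmod S <= 2 / r * RInt (fun t => Cmod (f (w t))) a b.
Proof.
move=> Hb Hw Hwc HQ EQ Hk Hd.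
have nz t : (w t - c)%C <> 0%C.
  by move=> E; apply: (Hwc t); transitivity ((w t - c) + c)%C; [ring | rewrite E; ring].
have Cinv t : ccontinuous (fun t => inv (w t)) t.
  apply: (rc_comp inv) => //; apply: cdiff_ccont.
  apply: (cdiff_comp (fun w => / w)%C (fun w => w - c)%C); first by apply: cdiff_inv.
  exact: cdiff_minus (cdiff_id _) (cdiff_const _ _).
have Cf t : ccontinuous (fun t => f (w t)) t by apply: (rc_comp f) => //; apply: entire_ccont.
have Cfi t : ccontinuous (fun t => f (w t) * inv (w t))%C t by apply: rc_mult.
have Cci t : ccontinuous (fun t => f c * inv (w t))%C t by apply: rc_scal.
exists (CI (fun t => inv (w t)) a b), (CI (fun t => f (w t) * inv (w t))%C a b); split; [|split].
- rewrite -CI_scal // -CI_minus //; apply: CI_ext => t.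
  rewrite /inv (_ : f (w t) = Q (w t) * (w t - c) + f c)%C; last by rewrite -EQ; ring.
  by field; apply: nz.
- apply: Rle_trans (CI_linear_ge k _ a b (/ (4 * r)) _ Cinv Hk); last lra.
  have -> : / 4 = / (4 * r) * r by field; lra.
  by apply: Rmult_le_compat_l; [apply: Rlt_le; apply: Rinv_0_lt_compat; lra | lra].
- apply: Rle_trans (CI_norm _ a b _ Cfi) _; first lra.
  have ex : ex_RInt (fun t => Cmod (f (w t))) a b.
    by apply: ex_RInt_continuous => t _; apply: rc_Cmod.
  rewrite -[X in _ <= X]/(scal (2 / r) (RInt (fun t => Cmod (f (w t))) a b)) -RInt_scal //.
  apply: RInt_le; first lra.
  + by apply: ex_RInt_continuous => t _; apply: rc_Cmod.
  + exact: ex_RInt_scal.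
  move=> t _; rewrite Cmod_mult /inv Cmod_inv // Rmult_comm.
  apply: Rmult_le_compat_r; first exact: Cmod_ge_0.
  rewrite (_ : 2 / r = / (r / 2)); last by field; lra.
  by apply: Rinv_le_contravar => //; lra.
Qed.

(** On a side at distance [s] from the centre the rotated real part of [1 / (w - c)] has this form.
    The sides have length at least [r], so each contributes at least 1/4. *)
Lemma quarter_bound u s : Rabs u <= r -> r / 2 <= s <= r -> / (4 * r) <= s / (u * u + s * s).
Proof.
move=> /Rabs_le_between Hu Hs.
have P : 0 < u * u + s * s by nra.
apply/Rle_div_r => //.
have -> : s = / (4 * r) * (4 * r * s) by field; lra.
apply: Rmult_le_compat_l; first by apply: Rlt_le; apply: Rinv_0_lt_compat; lra.
have E : / (4 * r) * (4 * r * s) = s by field; lra.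
rewrite E; nra.
Qed.

(** The four rotated shares [W] add up to [1 / i] times the boundary integral of [1 / (w - c)]; in
    place of its exact value [2 * PI], the lower bound 1 is enough. The sides stay free in strips of
    width [r / 2], so that averaging can select them later. *)
Lemma rectangle_bound X0 X1 Y0 Y1 :
  cx - r <= X0 <= cx - r / 2 -> cx + r / 2 <= X1 <= cx + r ->
  cy - r <= Y0 <= cy - r / 2 -> cy + r / 2 <= Y1 <= cy + r ->
  Cmod (f (cx, cy)) <= 2 / r *
   (RInt (fun t => Cmod (f (t, Y0))) (cx - r) (cx + r) + RInt (fun t => Cmod (f (t, Y1))) (cx - r) (cx + r) +
    RInt (fun t => Cmod (f (X0, t))) (cy - r) (cy + r) + RInt (fun t => Cmod (f (X1, t))) (cy - r) (cy + r)).
Proof.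
move=> HX0 HX1 HY0 HY1.
have [Q [HQ EQ]] := entire_quotient f c Hf.
have Hr2 : 0 < 2 / r by apply: Rdiv_lt_0_compat; lra.
have chor v t : ccontinuous (fun t => (t, v) : C) t.
  by apply: rc_pair; [exact: continuous_id | exact: continuous_const].
have cver v t : ccontinuous (fun t => (v, t) : C) t.
  by apply: rc_pair; [exact: continuous_const | exact: continuous_id].
have enl a b m (w : R -> C) : m - r <= a -> a <= b -> b <= m + r -> (forall t, ccontinuous w t) ->
    RInt (fun t => Cmod (f (w t))) a b <= RInt (fun t => Cmod (f (w t))) (m - r) (m + r).
  move=> H1 H2 H3 Hw; apply: RInt_pos_enlarge => //; last by move=> t; apply: Cmod_ge_0.
  by move=> t; apply: rc_Cmod; apply: (rc_comp f) => //; apply: entire_ccont.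
have far (w : C) d : Rabs (fst w - cx) = d \/ Rabs (snd w - cy) = d -> r / 2 <= d -> r / 2 <= Cmod (w - c).
  move=> [E|E] Hd.
    by have := Rabs_fst_Cmod (w - c); rewrite /= -/(fst w - cx) E; lra.
  by have := Rabs_snd_Cmod (w - c); rewrite /= -/(snd w - cy) E; lra.
have [W1 [S1 [E1 [HW1 HS1]]]] : exists W S, CI (fun t => Q (t, Y0)) X0 X1 = (S - f c * W)%C :> C /\
    / 4 <= fst (- Ci * W)%C /\ Cmod S <= 2 / r * RInt (fun t => Cmod (f (t, Y0))) X0 X1.
  apply: (side_int (fun t => (t, Y0))) => //; first lra.
  - by move=> t [_ E]; lra.
  - move=> t Ht.
    have -> : fst (- Ci * inv (t, Y0))%C = (cy - Y0) / ((t - cx) * (t - cx) + (cy - Y0) * (cy - Y0)).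
      transitivity (snd (inv (t, Y0))); first by rewrite /Ci /Cmult /Copp /=; ring.
      by rewrite inv_snd /=; congr Rdiv; ring.
    by apply: quarter_bound; [apply: Rabs_le; lra | lra].
  - move=> t; apply: (far _ (cy - Y0)); [right | lra].
    by rewrite /= Rabs_minus_sym Rabs_pos_eq; lra.
have [W2 [S2 [E2 [HW2 HS2]]]] : exists W S, CI (fun t => Q (X1, t)) Y0 Y1 = (S - f c * W)%C :> C /\
    / 4 <= fst (1 * W)%C /\ Cmod S <= 2 / r * RInt (fun t => Cmod (f (X1, t))) Y0 Y1.
  apply: (side_int (fun t => (X1, t))) => //; first lra.
  - by move=> t [E _]; lra.
  - move=> t Ht.
    have -> : fst (1 * inv (X1, t))%C = (X1 - cx) / ((t - cy) * (t - cy) + (X1 - cx) * (X1 - cx)).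
      transitivity (fst (inv (X1, t))); first by rewrite /Cmult /=; ring.
      by rewrite inv_fst /=; congr Rdiv; ring.
    by apply: quarter_bound; [apply: Rabs_le; lra | lra].
  - move=> t; apply: (far _ (X1 - cx)); [left | lra].
    by rewrite /= Rabs_pos_eq; lra.
have [W3 [S3 [E3 [HW3 HS3]]]] : exists W S, CI (fun t => Q (t, Y1)) X0 X1 = (S - f c * W)%C :> C /\
    / 4 <= fst (Ci * W)%C /\ Cmod S <= 2 / r * RInt (fun t => Cmod (f (t, Y1))) X0 X1.
  apply: (side_int (fun t => (t, Y1))) => //; first lra.
  - by move=> t [_ E]; lra.
  - move=> t Ht.
    have -> : fst (Ci * inv (t, Y1))%C = (Y1 - cy) / ((t - cx) * (t - cx) + (Y1 - cy) * (Y1 - cy)).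
      transitivity (- snd (inv (t, Y1))); first by rewrite /Ci /Cmult /Copp /=; ring.
      by rewrite inv_snd /= /Rdiv; ring.
    by apply: quarter_bound; [apply: Rabs_le; lra | lra].
  - move=> t; apply: (far _ (Y1 - cy)); [right | lra].
    by rewrite /= Rabs_pos_eq; lra.
have [W4 [S4 [E4 [HW4 HS4]]]] : exists W S, CI (fun t => Q (X0, t)) Y0 Y1 = (S - f c * W)%C :> C /\
    / 4 <= fst (-(1) * W)%C /\ Cmod S <= 2 / r * RInt (fun t => Cmod (f (X0, t))) Y0 Y1.
  apply: (side_int (fun t => (X0, t))) => //; first lra.
  - by move=> t [E _]; lra.
  - move=> t Ht.
    have -> : fst (-(1) * inv (X0, t))%C = (cx - X0) / ((t - cy) * (t - cy) + (cx - X0) * (cx - X0)).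
      transitivity (- fst (inv (X0, t))); first by rewrite /Cmult /Copp /=; ring.
      rewrite inv_fst /= (_ : (X0 - cx) * (X0 - cx) + (t - cy) * (t - cy) = (t - cy) * (t - cy) + (cx - X0) * (cx - X0)); last by ring.
      by rewrite /Rdiv; ring.
    by apply: quarter_bound; [apply: Rabs_le; lra | lra].
  - move=> t; apply: (far _ (cx - X0)); [left | lra].
    by rewrite /= Rabs_minus_sym Rabs_pos_eq; lra.
have := goursat Q X0 Y0 (X1 - X0) (Y1 - Y0) ltac:(lra) ltac:(lra) HQ.
rewrite /rectint (_ : X0 + (X1 - X0) = X1); last by ring.
rewrite (_ : Y0 + (Y1 - Y0) = Y1); last by ring.
rewrite E1 E2 E3 E4 => G.
pose W := (- Ci * W1 + 1 * W2 + Ci * W3 + -(1) * W4)%C.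
pose S := (- Ci * S1 + S2 + Ci * S3 - S4)%C.
have HCi : (Ci * Ci = -(1))%C by rewrite /Ci /Cmult /Copp /=; congr pair; ring.
have ES : (f c * W = S)%C.
  have : ((- Ci) * (S1 - f c * W1 + Ci * (S2 - f c * W2) - (S3 - f c * W3) - Ci * (S4 - f c * W4)) = (- Ci) * 0)%C by rewrite G.
  have -> : ((- Ci) * (S1 - f c * W1 + Ci * (S2 - f c * W2) - (S3 - f c * W3) - Ci * (S4 - f c * W4)) =
    - Ci * (S1 - f c * W1) - (Ci * Ci) * (S2 - f c * W2) + Ci * (S3 - f c * W3) + (Ci * Ci) * (S4 - f c * W4))%C by ring.
  rewrite HCi => H.
  have -> : S = (f c * W + (- Ci * (S1 - f c * W1) - - (1) * (S2 - f c * W2) + Ci * (S3 - f c * W3) + - (1) * (S4 - f c * W4)))%C.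
    by rewrite /S /W; ring.
  by rewrite H; ring.
have HW : 1 <= Cmod W.
  apply: Rle_trans (Rle_trans _ _ _ (Rle_abs _) (Rabs_fst_Cmod W)).
  by rewrite /W -[fst _]/(fst (- Ci * W1)%C + fst (1 * W2)%C + fst (Ci * W3)%C + fst (-(1) * W4)%C); lra.
apply: Rle_trans (_ : Cmod S <= _).
  by rewrite -ES Cmod_mult; have := Cmod_ge_0 (f c); rewrite -/c; nra.
have Z1 := enl X0 X1 cx (fun t => (t, Y0)) ltac:(lra) ltac:(lra) ltac:(lra) (chor _).
have Z3 := enl X0 X1 cx (fun t => (t, Y1)) ltac:(lra) ltac:(lra) ltac:(lra) (chor _).
have Z2 := enl Y0 Y1 cy (fun t => (X1, t)) ltac:(lra) ltac:(lra) ltac:(lra) (cver _).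
have Z4 := enl Y0 Y1 cy (fun t => (X0, t)) ltac:(lra) ltac:(lra) ltac:(lra) (cver _).
have := Cmod_triangle (- Ci * S1 + S2 + Ci * S3) (- S4).
have := Cmod_triangle (- Ci * S1 + S2) (Ci * S3).
have := Cmod_triangle (- Ci * S1) S2.
rewrite !Cmod_mult !Cmod_opp Cmod_Ci -/(Cminus _ S4) -/S.
have M1 := Rmult_le_compat_l _ _ _ (Rlt_le _ _ Hr2) Z1.
have M2 := Rmult_le_compat_l _ _ _ (Rlt_le _ _ Hr2) Z2.
have M3 := Rmult_le_compat_l _ _ _ (Rlt_le _ _ Hr2) Z3.
have M4 := Rmult_le_compat_l _ _ _ (Rlt_le _ _ Hr2) Z4.
lra.
Qed.
End rectangle_bound.

(* Splits the ray [0, z] at distance 1 from [z]: the Gaussian factor makes the far part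
   exponentially small, whatever the size of [h] there. *)
Lemma cint0_gauss_bound (h : C -> C) z N S : entire h -> 0 <= N -> 0 <= S ->
  (forall w, Cmod (w - z) <= 1 -> Cmod (h w) <= N * ((1 + Cmod w) * exp (Cmod w ^ 2 / 2))) ->
  (forall w, Cmod (h w) <= S * ((1 + Cmod w) * exp (Cmod w ^ 2 / 2))) ->
  Cmod (cint0 h z) <= exp (Cmod z ^ 2 / 2) *
    (3 * N + S * (Cmod z * (1 + Cmod z) * exp (- (Cmod z / 2)))).
Proof.
move=> Hh HN HS Bn Bf.
set r := Cmod z; have Hr : 0 <= r by apply: Cmod_ge_0.
pose c := S * (r * (1 + r) * exp (- (r / 2))).
(* A majorant with an explicit primitive. The part [r^2 * t] of the near integrand integrates
   exactly; the leftover [r] is replaced by [1 + r^2 / 4], with the larger exponential in [1 - t].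
   The terms in [N] contribute at most [5 / 2]. *)
pose Phi t := exp (r ^ 2 / 2) * (N * (t + / 2 * exp (- ((1 - t) * r ^ 2 / 2)) + exp (- ((1 - t * t) * r ^ 2 / 2))) + c * t).
pose phi t := exp (r ^ 2 / 2) * (N * (1 + r ^ 2 / 4 * exp (- ((1 - t) * r ^ 2 / 2)) + r ^ 2 * t * exp (- ((1 - t * t) * r ^ 2 / 2))) + c).
have HPhi : is_RInt phi 0 1 (Phi 1 - Phi 0).
  apply: (is_RInt_derive Phi phi).
    move=> t _; rewrite /Phi /phi; move: (r ^ 2) => q; auto_derive => //.
    set A := exp (- ((1 - t) * q / 2)); set B := exp (- ((1 - t * t) * q / 2)).
    change (exp (q / 2) * (N * (1 + / 2 * (- (- (1) * q * / 2) * A) +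
      - (- (1 * t + t * 1) * q * / 2) * B) + c * 1) =
      exp (q / 2) * (N * (1 + q / 4 * A + q * t * B) + c)).
    by field.
  move=> t _; apply: (ex_derive_continuous phi); rewrite /phi; auto_derive => //.
have Ch t : ccontinuous (fun t => h (RtoC t * z) * z)%C t.
  by apply: rc_mult; [exact: rc_ray | exact: rc_const].
have E0 := exp_pos (r ^ 2 / 2).
apply: Rle_trans (_ : Phi 1 - Phi 0 <= _).
  rewrite /cint0 -norm_C_R; apply: (norm_RInt_le _ phi 0 1) Rle_0_1 _ (CI_correct _ 0 1 Ch) HPhi.
  move=> t Ht; rewrite norm_C_R Cmod_mult -/r.
  have Mt : Cmod (RtoC t * z) = t * r by rewrite Cmod_mult -/r Cmod_R Rabs_pos_eq; lra.
  have Hc : 0 <= c.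
    rewrite /c; apply: Rmult_le_pos => //; apply: Rmult_le_pos; first nra.
    by apply: Rlt_le; apply: exp_pos.
  have P1 := exp_pos (- ((1 - t) * r ^ 2 / 2)).
  have P2 := exp_pos (- ((1 - t * t) * r ^ 2 / 2)).
  have Eq : exp ((t * r) ^ 2 / 2) = exp (r ^ 2 / 2) * exp (- ((1 - t * t) * r ^ 2 / 2)).
    by rewrite -exp_plus; congr exp; field.
  case: (Rle_dec ((1 - t) * r) 1) => Hnear.
  - have := Bn (RtoC t * z)%C; rewrite Mt => B.
    have {}B : Cmod (h (RtoC t * z)%C) <= N * ((1 + t * r) * exp ((t * r) ^ 2 / 2)).
      apply: B; rewrite (_ : (RtoC t * z - z = RtoC (t - 1) * z)%C); last by rewrite RtoC_minus; ring.
      by rewrite Cmod_mult -/r Cmod_R Rabs_minus_sym Rabs_pos_eq; lra.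
    apply: Rle_trans (Rmult_le_compat_r _ _ _ Hr B) _.
    rewrite Eq /phi.
    set e1 := exp (- ((1 - t) * r ^ 2 / 2)) in P1 *; set e2 := exp (- ((1 - t * t) * r ^ 2 / 2)) in P2 Eq *.
    have He1 : e1 <= 1.
      rewrite -exp_0; apply: exp_le_mono; have := pow2_ge_0 r; nra.
    have He2 : e2 <= e1.
      rewrite /e1 /e2; apply: exp_le_mono.
      by have := Rmult_le_pos (t - t * t) (r ^ 2) ltac:(nra) (pow2_ge_0 r); lra.
    have -> : N * ((1 + t * r) * (exp (r ^ 2 / 2) * e2)) * r =
       exp (r ^ 2 / 2) * (N * (r * e2 + r ^ 2 * t * e2)) by ring.
    apply: Rmult_le_compat_l; first lra.
    have : r * e2 <= 1 + r ^ 2 / 4 * e1.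
      have : r * e2 <= (1 + r ^ 2 / 4) * e1.
        apply: Rmult_le_compat => //; [lra|]; have := pow2_ge_0 (r / 2 - 1); nra.
      nra.
    nra.
  - have := Bf (RtoC t * z)%C; rewrite Mt => B.
    apply: Rle_trans (Rmult_le_compat_r _ _ _ Hr B) _.
    (* Here [(1 - t) * r > 1], and [1 - t * t >= 1 - t], so the exponent drops by at least
       [r / 2]. *)
    have He : exp ((t * r) ^ 2 / 2) <= exp (r ^ 2 / 2) * exp (- (r / 2)).
      rewrite -exp_plus; apply: exp_le_mono.
      have H1 : 1 * r <= (1 - t) * r * r by apply: Rmult_le_compat_r; lra.
      by have := Rmult_le_pos (t - t * t) (r * r) ltac:(nra) ltac:(nra); lra.
    apply: Rle_trans (_ : exp (r ^ 2 / 2) * c <= _).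
      have -> : exp (r ^ 2 / 2) * c = S * ((1 + r) * (exp (r ^ 2 / 2) * exp (- (r / 2)))) * r by rewrite /c; ring.
      apply: Rmult_le_compat_r => //; apply: Rmult_le_compat_l => //.
      by apply: Rmult_le_compat => //; [nra | apply: Rlt_le; apply: exp_pos | nra].
    apply: Rmult_le_compat_l; first lra.
    have : 0 <= N * (1 + r ^ 2 / 4 * exp (- ((1 - t) * r ^ 2 / 2)) + r ^ 2 * t * exp (- ((1 - t * t) * r ^ 2 / 2))).
      apply: Rmult_le_pos => //.
      have Q1 : 0 <= r ^ 2 / 4 by have := pow2_ge_0 r; lra.
      have Q2 : 0 <= r ^ 2 * t by have := pow2_ge_0 r; nra.
      nra.
    lra.
rewrite /Phi -/r -/c -Rmult_minus_distr_l; apply: Rmult_le_compat_l; first lra.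
have -> : - ((1 - 1) * r ^ 2 / 2) = 0 by field.
have -> : - ((1 - 1 * 1) * r ^ 2 / 2) = 0 by field.
rewrite exp_0.
have := exp_pos (- ((1 - 0) * r ^ 2 / 2)); have := exp_pos (- ((1 - 0 * 0) * r ^ 2 / 2)).
set e1 := exp _; set e2 := exp _ => H1 H2.
have := Rmult_le_pos _ _ HN (Rlt_le _ _ H1); have := Rmult_le_pos _ _ HN (Rlt_le _ _ H2).
lra.
Qed.

(** On the circle of radius [r = / (1 + |w|)] one has [|v|^2 <= |w|^2 + 2 * r * |w| + r^2 <= |w|^2 +
    3], whence [exp (3 / 2)]; dividing by [r] produces the factor [1 + |w|]. *)
Lemma deriv_gauss_bound (f : C -> C) w m : entire f ->
  (forall v, Cmod (v - w) <= 1 -> Cmod (f v) <= m * exp (Cmod v ^ 2 / 2)) ->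
  Cmod (Cderiv f w) <= 2 * exp (3 / 2) * m * ((1 + Cmod w) * exp (Cmod w ^ 2 / 2)).
Proof.
move=> Hf Hm.
have w0 := Cmod_ge_0 w.
have m0 : 0 <= m.
  have := Hm w; rewrite (_ : (w - w = 0)%C) ?Cmod_0; last by ring.
  have := Cmod_ge_0 (f w); have := exp_pos (Cmod w ^ 2 / 2) => E1 E2 /(_ Rle_0_1) H.
  nra.
pose r := / (1 + Cmod w).
have r0 : 0 < r by apply: Rinv_0_lt_compat; lra.
have rw : r * (1 + Cmod w) = 1 by rewrite /r; field; lra.
have r1 : r <= 1 by nra.
have := cauchy_deriv f w _ r (m * (exp (3 / 2) * exp (Cmod w ^ 2 / 2))) Hf (proj1 (entire_cdiff f) Hf w) r0.
move=> H; have {}H := H _.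
have {H} : Cmod (Cderiv f w) * r <= 2 * (m * (exp (3 / 2) * exp (Cmod w ^ 2 / 2))).
  apply: H => v Hv.
  apply: Rle_trans (Hm v _) _; first lra.
  apply: Rmult_le_compat_l => //; rewrite -exp_plus; apply: exp_le_mono.
  have Hvw : Cmod v <= Cmod w + r.
    rewrite (_ : (v = w + (v - w))%C); last by ring.
    by apply: Rle_trans (Cmod_triangle _ _) _; lra.
  have v0 := Cmod_ge_0 v.
  have : Cmod v ^ 2 <= (Cmod w + r) ^ 2 by apply: pow_incr.
  nra.
move=> H.
have -> : Cmod (Cderiv f w) = Cmod (Cderiv f w) * r * (1 + Cmod w) by rewrite Rmult_assoc rw; ring.
apply: Rle_trans (Rmult_le_compat_r _ _ _ _ H) _; first lra.
by apply: Req_le; ring.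
Qed.

Lemma linear_le_exp t x : 0 < t -> 0 <= x -> 1 + x <= (1 + / t) * exp (t * x).
Proof.
move=> t0 x0; have H := exp_ineq1_le (t * x).
have ti : 0 < / t by apply: Rinv_0_lt_compat.
have E : / t * (t * x) = x by field; lra.
have : (1 + / t) * (1 + t * x) <= (1 + / t) * exp (t * x) by apply: Rmult_le_compat_l; lra.
have : 0 <= t * x by nra.
nra.
Qed.

(** Using [1 + r <= 9 * exp (r / 8)] twice costs the factor 81 and half of the exponential decay. *)
Lemma far_kernel_bound r : 0 <= r -> r * (1 + r) * exp (- (r / 2)) <= 81 * exp (- (r / 4)).
Proof.
move=> r0.
have H := linear_le_exp (/ 8) r ltac:(lra) r0.
have E : exp (/ 8 * r) * exp (/ 8 * r) = exp (r / 2) * exp (- (r / 4)).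
  by rewrite -!exp_plus; congr exp; field.
have E2 : exp (r / 2) * exp (- (r / 2)) = 1.
  by rewrite -exp_plus -exp_0; congr exp; field.
have P1 := exp_pos (- (r / 2)); have P2 := exp_pos (- (r / 4)); have P3 := exp_pos (/ 8 * r).
rewrite Rinv_inv in H.
have : r * (1 + r) <= (9 * exp (/ 8 * r)) * (9 * exp (/ 8 * r)).
  by apply: Rmult_le_compat; lra.
move=> H2.
apply: Rle_trans (Rmult_le_compat_r _ _ _ (Rlt_le _ _ P1) H2) _.
have -> : 9 * exp (/ 8 * r) * (9 * exp (/ 8 * r)) * exp (- (r / 2)) =
  81 * (exp (/ 8 * r) * exp (/ 8 * r)) * exp (- (r / 2)) by ring.
rewrite E.
have -> : 81 * (exp (r / 2) * exp (- (r / 4))) * exp (- (r / 2)) =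
  81 * exp (- (r / 4)) * (exp (r / 2) * exp (- (r / 2))) by ring.
by rewrite E2; lra.
Qed.

From HB Require Import structures.
From mathcomp Require Import all_boot all_order all_algebra.
From mathcomp Require Import all_classical all_reals all_analysis.
From mathcomp Require Import Rstruct Rstruct_topology measurable_realfun.
Import Order.TTheory GRing.Theory Num.Theory.
Import numFieldNormedType.Exports.
Local Open Scope classical_set_scope.
Local Open Scope ereal_scope.
Local Open Scope R_scope.

(** * Measure and integration on the plane *)

Notation plane := (measurableTypeR R * measurableTypeR R)%type.
Notation leb := (@lebesgue_measure R).

Lemma rpow_ge0 x p : 0 <= rpow x p.
Proof. by apply/RleP; exact: powR_ge0. Qed.

Lemma rpow_gt0 x p : 0 < x -> 0 < rpow x p.
Proof. by move=> /RltP H; apply/RltP; exact: powR_gt0. Qed.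

Lemma rpow_le x y p : 0 <= p -> 0 <= x -> x <= y -> rpow x p <= rpow y p.
Proof.
move=> p0 x0 xy; apply/RleP.
by apply: ge0_ler_powR; rewrite ?nnegrE; apply/RleP => //; apply: Rle_trans xy.
Qed.

Lemma rpow_mul x y p : 0 <= x -> 0 <= y -> rpow (x * y) p = rpow x p * rpow y p.
Proof. by move=> /RleP x0 /RleP y0; exact: powRM. Qed.

Lemma rpow_rpow x p q : rpow (rpow x p) q = rpow x (p * q).
Proof. by rewrite /rpow [RHS]powRrM. Qed.

Lemma rpow_1 x : 0 <= x -> rpow x 1 = x.
Proof. by move=> /RleP x0; rewrite /rpow powRr1. Qed.

Lemma rpow_0 p : p <> 0 -> rpow 0 p = 0.
Proof. by move=> p0; rewrite /rpow powR0 //; apply/eqP. Qed.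

Lemma rpow_x0 x : rpow x 0 = 1.
Proof. by rewrite /rpow powRr0. Qed.

Lemma rpow_add x p q : 0 < x -> rpow x (p + q) = rpow x p * rpow x q.
Proof.
move=> /RltP x0; rewrite /rpow RmultE -powRD //.
by apply/implyP => _; rewrite gt_eqF.
Qed.

Lemma rpow_exp x p : rpow (exp x) p = exp (p * x).
Proof.
rewrite /rpow RexpE /powR gt_eqF ?expR_gt0 // expRK.
by rewrite RexpE.
Qed.

Lemma rpow_inv x p : 0 < p -> 0 <= x -> rpow (rpow x p) (/ p) = x.
Proof. by move=> p0 x0; rewrite rpow_rpow Rinv_r ?rpow_1 //; lra. Qed.

Lemma rpow_sum x y p : 0 < p -> 0 <= x -> 0 <= y ->
  rpow (x + y) p <= rpow 2 p * (rpow x p + rpow y p).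
Proof.
move=> p0 x0 y0.
have main u w : 0 <= u -> u <= w -> rpow (u + w) p <= rpow 2 p * rpow w p.
  move=> u0 uw; rewrite -rpow_mul; [|lra|lra].
  by apply: rpow_le; lra.
have H2 := rpow_ge0 2 p; have Hx := rpow_ge0 x p; have Hy := rpow_ge0 y p.
case: (Rle_dec x y) => xy.
  by apply: Rle_trans (main _ _ x0 xy) _; nra.
by rewrite Rplus_comm; apply: Rle_trans (main _ _ y0 _) _; [lra | nra].
Qed.

Lemma rpow_lt_inv x y p : 0 < p -> 0 <= x -> 0 <= y -> rpow x p <= rpow y p -> x <= y.
Proof.
move=> p0 x0 y0 H; rewrite -(rpow_inv x p) // -(rpow_inv y p) //.
apply: rpow_le => //; last exact: rpow_ge0.
by apply: Rlt_le; apply: Rinv_0_lt_compat.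
Qed.

Lemma rpow_small p eps : 0 < p -> 0 < eps -> exists d, 0 < d /\ forall x, 0 <= x < d -> rpow x p < eps.
Proof.
move=> p0 e0; exists (rpow (eps / 2) (/ p)); split; first by apply: rpow_gt0; lra.
move=> x [x0 xd].
have : rpow x p <= rpow (rpow (eps / 2) (/ p)) p by apply: rpow_le; lra.
by rewrite rpow_rpow Rinv_l ?rpow_1; lra.
Qed.

(** * Measurability of continuous functions; Lebesgue and Riemann integrals *)

Definition cont2 (u : C -> R) : Prop := forall z eps, 0 < eps ->
  exists d, 0 < d /\ forall w, Cmod (w - z) < d -> Rabs (u w - u z) < eps.

Definition ratR (q : rat) : R := ratr q.

Lemma rational_between (x d : R) : 0 < d -> exists q : rat, Rabs (ratR q - x) < d.
Proof.
move=> d0.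
have xd : ((x - d : R) < x + d)%O by apply/RltP; lra.
have [q] := @rat_in_itvoo R _ _ xd.
rewrite in_itv /= => /andP[/RltP H1 /RltP H2].
exists q; change (Rlt (x - d) (ratR q)) in H1; change (Rlt (ratR q) (x + d)) in H2.
by apply: Rabs_def1; lra.
Qed.

(** The plane carries the product sigma-algebra, so an open set has to be exhibited as a countable
    union of rectangles: [F] enumerates the rational boxes contained in the superlevel set. *)
Lemma measurable_cont2 (u : C -> R) : cont2 u -> measurable_fun [set: plane] (u : plane -> measurableTypeR R).
Proof.
move=> Hu.
apply: (measurability _ (RGenOInfty.measurableE R)) => //.
move=> _ [_ [a ->] <-]; rewrite setTI.
pose box (q : rat * rat * nat) : set plane :=
  (ball (ratR q.1.1) (/ INR (S q.2))) `*` (ball (ratR q.1.2) (/ INR (S q.2))).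
pose F n := if (unpickle n : option (rat * rat * nat)) is Some q then
   (if `[< box q `<=` [set z | a < u z] >] then box q else set0) else set0.
have mbox q : measurable (box q) by apply: measurableX; exact: measurable_ball.
rewrite [X in measurable X](_ : _ = \bigcup_n F n); last first.
  apply/seteqP; split => [[zx zy]|z].
  - rewrite /= in_itv /= andbT => /RltP Haz.
    have {}Haz : Rlt a (u (zx, zy)) := Haz.
    have [d [d0 Hd]] := Hu (zx, zy) (u (zx, zy) - a) ltac:(lra).
    (* Two points of one box differ by less than [2 / (N + 1)] in each coordinate, hence by less
       than [d] in modulus. *)
    have [N [HN1 HN2]] := archimed_cor1 (d / 4) ltac:(lra).
    have HN : / INR (S N) <= / INR N.
      apply: Rinv_le_contravar; first exact: lt_0_INR.
      by apply: le_INR; lia.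
    have Npos : 0 < / INR (S N) by apply: Rinv_0_lt_compat; apply: lt_0_INR; lia.
    have [q1 Hq1] := rational_between zx (/ INR (S N)) Npos.
    have [q2 Hq2] := rational_between zy (/ INR (S N)) Npos.
    exists (pickle (q1, q2, N)); [exact: I | rewrite /F pickleK].
    have ballE (x y e : R) : ball x e y <-> Rabs (x - y) < e.
      by rewrite /ball /= RabsE; split => /RltP.
    case: asboolP => [_|nbox]; first by split; apply/ballE.
    exfalso; apply: nbox => -[wx wy] [/ballE H1 /ballE H2] /=; change (Rabs (ratR q1 - wx) < / INR N.+1) in H1; change (Rabs (ratR q2 - wy) < / INR N.+1) in H2.
    have : Rabs (u (wx, wy) - u (zx, zy)) < u (zx, zy) - a.
      apply: Hd; apply: Rle_lt_trans (Cmod_le_Rabs _) _ => /=.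
      have := Rabs_triang (wx - ratR q1) (ratR q1 - zx).
      have := Rabs_triang (wy - ratR q2) (ratR q2 - zy).
      rewrite (Rabs_minus_sym wx) (Rabs_minus_sym wy).
      have -> : wx - ratR q1 + (ratR q1 - zx) = wx + - zx by ring.
      have -> : wy - ratR q2 + (ratR q2 - zy) = wy + - zy by ring.
      lra.
    move=> H; have [_ H'] := Rabs_def2 _ _ H.
    by have : Rlt a (u (wx, wy)) by lra.
  - move=> [n _]; rewrite /F; case: unpickle => [q|//].
    by case: asboolP => // H /H /= Hz; rewrite in_itv /= andbT; apply/RltP.
apply: bigcupT_measurable => n; rewrite /F; case: unpickle => [q|//].
by case: ifP.
Qed.

Lemma continuous_coq_mc (g : R -> R) x : @continuity_pt g x -> {for x, continuous g}.
Proof. by move/continuity_pt_cvg. Qed.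

Lemma is_derive_coq_mc (F : R -> R) x (l : R) : @Coquelicot.Derive.is_derive R_AbsRing R_NormedModule F x l ->
  @derive.is_derive R R^o R^o x 1%R F l.
Proof.
move=> /is_derive_Reals H.
have cv : ((fun h : R => (F (x + h) - F x) / h) : R^o -> R^o) @ (0 : R^o)^' --> (l : R^o).
  apply/cvgrPdist_lt => e /RltP e0.
  have [d Hd] := H e e0.
  near=> h.
  have h0 : h <> 0 by apply/eqP; near: h; exact: nbhs_dnbhs_neq.
  have hd : Rabs h < d.
    apply/RltP; rewrite RabsE; near: h; apply: dnbhs0_lt.
    by apply/RltP; apply: cond_pos.
  apply/RltP; have := Hd h h0 hd.
  by rewrite Rabs_minus_sym.
have {}cv : (h^-1 *: (((F : R^o -> R^o) \o shift (x : R^o)) (h *: (1%R : R^o)) - (F : R^o -> R^o) x))%R @[h --> (0%R : R^o)^'] --> (l : R^o).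
  apply: cvg_trans cv; apply: near_eq_cvg; near=> h.
  by rewrite /GRing.scale /= mulr1 [(h + x)%R]addrC mulrC.
apply: DeriveDef; first by apply/cvg_ex; exists (l : R^o).
exact: cvg_lim.
Unshelve. all: by end_near.
Qed.

(** Both integrals are the increment of the primitive [RInt g a]. *)
Lemma integral_RInt (g : R -> R) a b : a < b -> (forall t, @Coquelicot.Continuity.continuous R_UniformSpace R_UniformSpace g t) ->
  (\int[leb]_(x in `[a, b]) (g x)%:E = (RInt g a b)%:E)%E.
Proof.
move=> ab Hg.
have Hd x : @derive.is_derive R R^o R^o x 1%R (fun y => RInt g a y) (g x).
  apply: is_derive_coq_mc.
  apply: (is_derive_RInt g (fun y => RInt g a y) a x) => //.
  by exists (mkposreal 1 Rlt_0_1) => y _; apply: RInt_correct; apply: ex_RInt_continuous => t _.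
have Hc x : {for x, continuous ((fun y => RInt g a y) : R^o -> R^o)}.
  apply: differentiable_continuous; apply/derivable1_diffP.
  by have [] := Hd x.
have E := @continuous_FTC2 R g (fun y => RInt g a y) a b.
rewrite E.
- by rewrite RInt_point /zero /= sube0.
- exact/RltP.
- apply: continuous_subspaceT => x; apply: continuous_coq_mc.
  exact: (proj2 (continuity_pt_filterlim g x) (Hg x)).
- split; first by move=> x _; have [] := Hd x.
  + by apply: cvg_at_right_filter; exact: Hc.
  + by apply: cvg_at_left_filter; exact: Hc.
- by move=> x _; rewrite derive1E; have [_] := Hd x.
Qed.

(* Loading MathComp made [%R] denote [ring_scope]. *)
Delimit Scope R_scope with real.

Lemma cont2_Cmod (f : C -> C) : (forall z, ccont f z) -> cont2 (fun z => Cmod (f z)).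
Proof.
move=> Hf z eps e0; have [d [d0 Hd]] := Hf z eps e0.
exists d; split=> // w /Hd; apply: Rle_lt_trans.
have := Cmod_triangle (f w - f z)%C (f z); have := Cmod_triangle (f z - f w)%C (f w).
rewrite (_ : (f w - f z + f z)%C = f w); last by ring.
rewrite (_ : (f z - f w + f w)%C = f z); last by ring.
rewrite (Cmod_sub_sym (f z)) => ? ?; apply: Rabs_le; lra.
Qed.

Lemma measurable_Cmod (f : C -> C) : entire f ->
  measurable_fun [set: plane] ((fun z => Cmod (f z)) : plane -> measurableTypeR R).
Proof. by move=> Hf; apply: measurable_cont2; apply: cont2_Cmod => z; apply: entire_ccont. Qed.

(** * Squares in the plane and Tonelli's theorem *)

Definition box (c : C) (r : R) : set plane :=
  `[(c.1 - r)%real, (c.1 + r)%real] `*` `[(c.2 - r)%real, (c.2 + r)%real].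

Lemma boxE c r (z : C) : box c r z <-> Rabs (z.1 - c.1) <= r /\ Rabs (z.2 - c.2) <= r.
Proof.
rewrite /box /= !in_itv /=; split.
  by move=> [/andP[/RleP H1 /RleP H2] /andP[/RleP H3 /RleP H4]]; split; apply: Rabs_le; lra.
by move=> [/Rabs_le_between H1 /Rabs_le_between H2]; split; apply/andP; split; apply/RleP; lra.
Qed.

Lemma measurable_box c r : measurable (box c r).
Proof. by apply: measurableX; exact: measurable_itv. Qed.

Lemma leb_itv a b : a <= b -> (leb `[a, b] = (b - a)%real%:E)%E.
Proof.
move=> ab; rewrite lebesgue_measure_itv /= lte_fin.
case: ifP => [_|/negP H]; first by rewrite -EFinB.
have -> : a = b by apply: Rle_antisym ab _; apply: Rnot_lt_le => H'; apply: H; apply/RltP.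
by congr EFin; change (0 = b - b :> R); ring.
Qed.

Lemma area_box c r : 0 <= r -> (area (box c r) = (4 * (r * r))%real%:E)%E.
Proof.
move=> r0; rewrite /area /box product_measure1E; [|exact: measurable_itv..].
transitivity ((c.1 + r - (c.1 - r))%real%:E * (c.2 + r - (c.2 - r))%real%:E)%E.
  by congr (_ * _)%E; apply: leb_itv; lra.
rewrite -EFinM; congr EFin.
by change ((c.1 + r - (c.1 - r)) * (c.2 + r - (c.2 - r)) = 4 * (r * r) :> R); ring.
Qed.

Lemma measurable_slice_int1 (u : plane -> \bar R) (B : set (measurableTypeR R)) :
  measurable B -> measurable_fun [set: plane] u -> (forall z, (0 <= u z)%E) ->
  measurable_fun setT (fun x => \int[leb]_(y in B) u (x, y))%E.
Proof.
move=> mB mu u0; pose uB : plane -> \bar R := u \_ (setT `*` B).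
have muB : measurable_fun setT uB.
  by apply/(measurable_restrictT u (measurableX measurableT mB)); exact: measurable_funTS.
have uB0 z : (0 <= uB z)%E by rewrite /uB patchE; case: ifP.
have -> : (fun x => \int[leb]_(y in B) u (x, y))%E = fubini_F leb uB.
  apply/funext => x; rewrite /fubini_F [LHS]integral_mkcond; apply: eq_integral => y _.
  rewrite /uB !patchE; congr (if _ then _ else _).
  by apply/idP/idP; rewrite !inE /setX /=; tauto.
exact: (@measurable_fun_fubini_tonelli_F _ _ _ _ _ leb uB).
Qed.

Lemma measurable_slice_int2 (u : plane -> \bar R) (A : set (measurableTypeR R)) :
  measurable A -> measurable_fun [set: plane] u -> (forall z, (0 <= u z)%E) ->
  measurable_fun setT (fun y => \int[leb]_(x in A) u (x, y))%E.
Proof.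
move=> mA mu u0; pose uA : plane -> \bar R := u \_ (A `*` setT).
have muA : measurable_fun setT uA.
  by apply/(measurable_restrictT u (measurableX mA measurableT)); exact: measurable_funTS.
have uA0 z : (0 <= uA z)%E by rewrite /uA patchE; case: ifP.
have -> : (fun y => \int[leb]_(x in A) u (x, y))%E = fubini_G leb uA.
  apply/funext => y; rewrite /fubini_G [LHS]integral_mkcond; apply: eq_integral => x _.
  rewrite /uA !patchE; congr (if _ then _ else _).
  by apply/idP/idP; rewrite !inE /setX /=; tauto.
exact: (@measurable_fun_fubini_tonelli_G _ _ _ _ _ leb uA).
Qed.

Section tonelli_rectangle.
Variables (u : plane -> \bar R) (A B : set (measurableTypeR R)).
Hypotheses (mA : measurable A) (mB : measurable B).
Hypothesis mu : measurable_fun [set: plane] u.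
Hypothesis u0 : forall z, (0 <= u z)%E.

Lemma tonelli_rectangle :
  (\int[area]_(z in A `*` B) u z = \int[leb]_(x in A) \int[leb]_(y in B) u (x, y))%E /\
  (\int[area]_(z in A `*` B) u z = \int[leb]_(y in B) \int[leb]_(x in A) u (x, y))%E.
Proof.
pose g := u \_ (A `*` B).
have mg : measurable_fun setT g.
  by apply/(measurable_restrictT u (measurableX mA mB)); exact: measurable_funTS.
have g0 z : (0 <= g z)%E by rewrite /g patchE; case: ifP.
have gE x y : g (x, y) = if (x \in A) && (y \in B) then u (x, y) else 0%E.
  rewrite /g patchE; congr (if _ then _ else _).
  by apply/idP/andP; rewrite !inE /setX /=; tauto.
rewrite /area; split.
- rewrite integral_mkcond -/g fubini_tonelli1 // [RHS]integral_mkcond.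
  apply: eq_integral => x _; rewrite /fubini_F patchE; case: ifPn => xA.
    rewrite [RHS]integral_mkcond; apply: eq_integral => y _.
    by rewrite gE xA patchE.
  by apply: integral0_eq => y _; rewrite gE (negbTE xA).
- rewrite integral_mkcond -/g fubini_tonelli2 // [RHS]integral_mkcond.
  apply: eq_integral => y _; rewrite /fubini_G patchE; case: ifPn => yB.
    rewrite [RHS]integral_mkcond; apply: eq_integral => x _.
    by rewrite gE yB andbT patchE.
  by apply: integral0_eq => x _; rewrite gE (negbTE yB) andbF.
Qed.
End tonelli_rectangle.

(** If [h] exceeded this level on the whole window of length [d], its integral would exceed [i]; the
    slack [eps] makes the contradiction strict. This selects good sides for [rectangle_bound]. *)
Lemma exists_below_mean (H : measurableTypeR R -> \bar R) (h : R -> R) l m a d i eps :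
  measurable_fun setT H -> (forall x, (0 <= H x)%E) -> (forall x, H x = (h x)%:E) ->
  l <= a -> a + d <= m -> 0 < d -> 0 < eps -> (\int[leb]_(x in `[l, m]) H x <= i%:E)%E ->
  exists X, a <= X <= a + d /\ h X <= i / d + eps.
Proof.
move=> mH H0 HE la am d0 e0 Hi; apply: NNPP => Hn.
have Hall X : a <= X <= a + d -> i / d + eps < h X.
  by move=> HX; apply: Rnot_le_lt => H'; apply: Hn; exists X.
have i0 : 0 <= i.
  by apply/RleP; rewrite -lee_fin; apply: le_trans Hi; apply: integral_ge0.
have k0 : 0 <= i / d + eps by have := Rle_mult_inv_pos i d i0 d0; rewrite /Rdiv; lra.
have : ((i + eps * d)%real%:E <= i%:E)%E.
  apply: le_trans Hi.
  apply: (@le_trans _ _ (\int[leb]_(x in `[a, (a + d)%real]) (i / d + eps)%real%:E)%E).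
    rewrite integral_cst //; set L := (X in (_ * X)%E).
    have -> : L = (a + d - a)%real%:E by apply: leb_itv; lra.
    rewrite -EFinM lee_fin; apply/RleP; apply: Req_le.
    change (i + eps * d = (i / d + eps) * ((a + d) - a)); field; lra.
  apply: (@le_trans _ _ (\int[leb]_(x in `[a, (a + d)%real]) H x)%E).
    apply: ge0_le_integral => //.
    - by move=> x _; rewrite lee_fin; apply/RleP.
    - exact: measurable_funTS.
    move=> x; rewrite /= in_itv /= => /andP[/RleP H1 /RleP H2].
    by rewrite HE lee_fin; apply/RleP; apply: Rlt_le; apply: Hall.
  apply: ge0_subset_integral => //.
    exact: measurable_funTS.
  move=> x; rewrite /= !in_itv /= => /andP[/RleP H1 /RleP H2].
  by apply/andP; split; apply/RleP; [change (l <= x); change (a <= x) in H1 | change (x <= m); change (x <= a + d) in H2]; lra.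
rewrite lee_fin => /RleP; change (i + eps * d <= i -> False); nra.
Qed.

(** By Tonelli's theorem each side of a rectangle can slide in its strip of width [r / 2] to a
    position where the line integral is at most [i / (r / 2) + e]; four sides and the factor [2 / r]
    of [rectangle_bound] give 16. *)
Lemma box_mean_bound (f : C -> C) c r i : entire f -> 0 < r ->
  (\int[area]_(z in box c r) (Cmod (f z))%:E <= i%:E)%E ->
  Cmod (f c) * (r * r) <= 16 * i.
Proof.
case: c => cx cy Hf r0 Hi.
have mu : measurable_fun [set: plane] (fun z : plane => (Cmod (f z))%:E).
  by apply/measurable_EFinP; exact: measurable_Cmod.
have u0 (z : plane) : (0 <= (Cmod (f z))%:E)%E by rewrite lee_fin; apply/RleP; exact: Cmod_ge_0.
have mI (a b : R) : measurable (`[a, b] : set (measurableTypeR R)) by exact: measurable_itv.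
have [T1 T2] := @tonelli_rectangle _ _ _ (mI (cx - r) (cx + r)) (mI (cy - r) (cy + r)) mu u0.
have Hi1 := Hi; rewrite [X in (X <= _)%E]T1 in Hi1.
have Hi2 := Hi; rewrite [X in (X <= _)%E]T2 in Hi2.
have cont1 X t : Continuity.continuous (fun t => Cmod (f (X, t))) t.
  by apply: (rc_Cmod (fun t => f (X, t))); apply: rc_ver => z; apply: entire_ccont.
have cont2 X t : Continuity.continuous (fun t => Cmod (f (t, X))) t.
  by apply: (rc_Cmod (fun t => f (t, X))); apply: rc_hor => z; apply: entire_ccont.
have slice1 a eps : 0 < eps -> cx - r <= a -> a + r / 2 <= cx + r ->
    exists X, a <= X <= a + r / 2 /\ RInt (fun t => Cmod (f (X, t))) (cy - r) (cy + r) <= i / (r / 2) + eps.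
  move=> e0 H1 H2.
  apply: (exists_below_mean _ _ (cx - r) (cx + r) a (r / 2) i eps _ _ _ H1 H2 _ e0 Hi1).
  - exact: (measurable_slice_int1 (fun z : plane => (Cmod (f z))%:E)).
  - by move=> x; apply: integral_ge0.
  - by move=> x; apply: integral_RInt => //; lra.
  - lra.
have slice2 a eps : 0 < eps -> cy - r <= a -> a + r / 2 <= cy + r ->
    exists X, a <= X <= a + r / 2 /\ RInt (fun t => Cmod (f (t, X))) (cx - r) (cx + r) <= i / (r / 2) + eps.
  move=> e0 H1 H2.
  apply: (exists_below_mean _ _ (cy - r) (cy + r) a (r / 2) i eps _ _ _ H1 H2 _ e0 Hi2).
  - exact: (measurable_slice_int2 (fun z : plane => (Cmod (f z))%:E)).
  - by move=> x; apply: integral_ge0.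
  - by move=> x; apply: integral_RInt => //; lra.
  - lra.
apply: le_epsilon => eps e0.
pose e := eps / (8 * r).
have He : 0 < e by apply: Rdiv_lt_0_compat; lra.
have [X0 [HX0 B1]] := slice1 (cx - r) e He ltac:(lra) ltac:(lra).
have [X1 [HX1 B2]] := slice1 (cx + r / 2) e He ltac:(lra) ltac:(lra).
have [Y0 [HY0 B3]] := slice2 (cy - r) e He ltac:(lra) ltac:(lra).
have [Y1 [HY1 B4]] := slice2 (cy + r / 2) e He ltac:(lra) ltac:(lra).
have := rectangle_bound f cx cy r Hf r0 X0 X1 Y0 Y1 ltac:(lra) ltac:(lra) ltac:(lra) ltac:(lra).
set S := _ + _ => HS.
have HS' : S <= 4 * (i / (r / 2) + e) by rewrite /S; lra.
have H2r : 0 < 2 / r by apply: Rdiv_lt_0_compat; lra.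
have {}HS : Cmod (f (cx, cy)) <= 2 / r * (4 * (i / (r / 2) + e)).
  by apply: Rle_trans HS _; apply: Rmult_le_compat_l; lra.
have -> : 16 * i + eps = 2 / r * (4 * (i / (r / 2) + e)) * (r * r) by rewrite /e; field; lra.
by apply: Rmult_le_compat_r => //; nra.
Qed.

(** * From the mean bound for the modulus to its powers *)

Definition rmeas (u : C -> R) := measurable_fun [set: plane] (u : plane -> measurableTypeR R).

Lemma rmeas_EFin D u : rmeas u -> measurable_fun D (fun z : plane => (u z)%:E).
Proof. by move=> mu; apply: measurable_funTS; apply/measurable_EFinP. Qed.

Lemma integral_affine_le (D : set plane) (u w : C -> R) k0 k1 a i :
  measurable D -> area D = a%:E -> rmeas u -> rmeas w ->
  (forall z, 0 <= u z) -> (forall z, 0 <= w z) -> 0 <= k0 -> 0 <= k1 ->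
  (forall z, D z -> u z <= k0 + k1 * w z) ->
  (\int[area]_(z in D) (w z)%:E <= i%:E)%E ->
  (\int[area]_(z in D) (u z)%:E <= (k0 * a + k1 * i)%real%:E)%E.
Proof.
move=> mD aD mu mw u0 w0 k00 k10 H Hi.
have e0 (x : R) : 0 <= x -> (0 <= x%:E)%E by move=> ?; rewrite lee_fin; apply/RleP.
apply: (@le_trans _ _ (\int[area]_(z in D) (k0%:E + k1%:E * (w z)%:E))%E).
  apply: ge0_le_integral => //.
  - by move=> z _; apply: e0.
  - exact: rmeas_EFin.
  - apply: emeasurable_funD; first exact: measurable_cst.
    by apply: measurable_funeM; exact: rmeas_EFin.
  - move=> z Dz; rewrite -EFinM -EFinD lee_fin; apply/RleP; exact: H.
have w0' z : D z -> (0 <= (w z)%:E)%E by move=> _; apply: e0.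
have k0w z : D z -> (0 <= k1%:E * (w z)%:E)%E by move=> _; apply: mule_ge0; apply: e0.
have k00' (z : plane) : D z -> (0 <= k0%:E)%E by move=> _; apply: e0.
have mw' : measurable_fun D (fun z : plane => (w z)%:E) by exact: rmeas_EFin.
have mkw : measurable_fun D (fun z : plane => k1%:E * (w z)%:E)%E by exact: measurable_funeM.
have k10' : (0 <= k1%:E)%E by exact: e0.
rewrite ge0_integralD // ge0_integralZl //.
rewrite integral_cst //.
rewrite EFinD 2!EFinM; apply: leeD.
  by rewrite -aD; exact: lexx.
by apply: lee_wpmul2l => //; exact: e0.
Qed.

Lemma rmeas_rpow u p : rmeas u -> rmeas (fun z => rpow (u z) p).
Proof.
move=> mu; have mp := @measurable_powR R p.
exact (measurableT_comp mp mu).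
Qed.

Lemma rmeas_mul u v : rmeas u -> rmeas v -> rmeas (fun z => u z * v z).
Proof. by move=> mu mv; exact: measurable_funM. Qed.

Lemma rmeas_exp u : rmeas u -> rmeas (fun z => exp (u z)).
Proof.
move=> mu; rewrite /rmeas (_ : (fun z => exp (u z)) = (fun z => expR (u z))).
  exact (measurableT_comp (@measurable_expR R) mu).
by apply/funext => z; rewrite RexpE.
Qed.

Lemma rmeas_Cmod f : entire f -> rmeas (fun z => Cmod (f z)).
Proof. exact: measurable_Cmod. Qed.

Lemma rpow_split x p : 0 < x -> rpow x (1 - p) * rpow x p = x.
Proof.
move=> x0; rewrite -rpow_add // (_ : 1 - p + p = 1); last by ring.
by apply: rpow_1; lra.
Qed.

(* For [p < 1] the mean value property is applied at a point nearly maximising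
   [d z ^ (2/p) * |f z|], [d z] being the distance to the boundary of the box, where [|f|] is
   comparable to its maximum on a box of radius [d z / 2]. *)
Lemma box_pow_bound p : 0 < p -> exists K, 0 < K /\
  forall f c i, entire f ->
   (\int[area]_(z in box c 1) (rpow (Cmod (f z)) p)%:E <= i%:E)%E -> rpow (Cmod (f c)) p <= K * i.
Proof.
move=> p0.
have ab c r : 0 <= r -> area (box c r) = (4 * (r * r))%real%:E := area_box c r.
case: (Rle_lt_dec 1 p) => p1.
- exists (rpow 128 p / 4); split; first by have := rpow_gt0 128 p; lra.
  move=> f c i Hf Hi.
  have mf := rmeas_Cmod f Hf.
  have i0 : 0 <= i.
    apply/RleP; rewrite -lee_fin; apply: le_trans Hi; apply: integral_ge0 => z _.
    by rewrite lee_fin; apply/RleP; exact: rpow_ge0.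
  case: (Req_dec (Cmod (f c)) 0) => [->|fc0].
    rewrite rpow_0; last lra.
    by apply: Rmult_le_pos => //; have := rpow_gt0 128 p; lra.
  have {}fc0 : 0 < Cmod (f c) by have := Cmod_ge_0 (f c); lra.
  (* Splitting at the level [l] gives [x <= l + l^(1-p) * x^p]. On a box of area 4 the constant [l]
     contributes [16 * 4 * l] to the mean bound, which is half of [Cmod (f c)]. *)
  pose l := Cmod (f c) / 128.
  have l0 : 0 < l by rewrite /l; lra.
  have lp (x : R) : 0 <= x -> x <= l + rpow l (1 - p) * rpow x p.
    move=> x0; case: (Rle_lt_dec x l) => xl.
      by have := rpow_ge0 l (1 - p); have := rpow_ge0 x p; nra.
    rewrite -{1}(rpow_split x p); last lra.
    have : rpow x (1 - p) <= rpow l (1 - p).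
      have E y : 0 < y -> rpow y (1 - p) = / rpow y (p - 1).
        move=> y0; have := rpow_gt0 y (p - 1) y0.
        have := rpow_add y (1 - p) (p - 1) y0.
        rewrite (_ : 1 - p + (p - 1) = 0) ?rpow_x0; last by ring.
        by move=> E1 E2; apply: (Rmult_eq_reg_r (rpow y (p - 1))); [rewrite -E1; field|]; lra.
      rewrite !E; try lra.
      apply: Rinv_le_contravar; first exact: rpow_gt0.
      by apply: rpow_le; lra.
    by have := rpow_ge0 x p; nra.
  have Hi2 := integral_affine_le (box c 1) _ _ l (rpow l (1 - p)) _ i (measurable_box _ _) (ab c 1 ltac:(lra)) mf (rmeas_rpow _ p mf)
    (fun z => Cmod_ge_0 (f z)) (fun z => rpow_ge0 _ _) (Rlt_le _ _ l0) (rpow_ge0 _ _) (fun z _ => lp _ (Cmod_ge_0 _)) Hi.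
  have := box_mean_bound f c 1 _ Hf ltac:(lra) Hi2.
  rewrite (_ : Cmod (f c) = 128 * l); last by rewrite /l; field.
  rewrite rpow_mul; try lra.
  have E : rpow l p * rpow l (1 - p) = l.
    by rewrite Rmult_comm; apply: rpow_split.
  have Q := rpow_gt0 l (1 - p) l0; have Q2 := rpow_gt0 128 p ltac:(lra).
  move=> H.
  have H' : 4 * l <= rpow l (1 - p) * i by lra.
  have : 4 * rpow l p <= i by rewrite -{1}E in H'; nra.
  nra.
- pose K := 32 * rpow 2 (2 / p).
  have K0 : 0 < K by have := rpow_gt0 2 (2 / p); rewrite /K; lra.
  exists K; split => //.
  move=> f c i Hf Hi.
  have mf := rmeas_Cmod f Hf.
  have i0 : 0 <= i.
    apply/RleP; rewrite -lee_fin; apply: le_trans Hi; apply: integral_ge0 => z _.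
    by rewrite lee_fin; apply/RleP; exact: rpow_ge0.
  pose d (z : C) := 1 - Rmax (Rabs (z.1 - c.1)) (Rabs (z.2 - c.2)).
  (* The exponent [2 / p] is such that its [p]-th power restores [r * r], the area factor of
     [box_mean_bound] (see [E3]). *)
  pose val z := rpow (d z) (2 / p) * Cmod (f z).
  have p20 : 0 < 2 / p by apply: Rdiv_lt_0_compat; lra.
  have dc : d c = 1 by rewrite /d !Rminus_diag Rabs_R0 Rmax_left; lra.
  have d1 z : d z <= 1.
    by have := Rmax_l (Rabs (z.1 - c.1)) (Rabs (z.2 - c.2)); have := Rabs_pos (z.1 - c.1); rewrite /d; lra.
  have [B [B0 HB]] := entire_bounded f (Cmod c + 2) Hf.
  have dB z : 0 <= d z -> Cmod (f z) <= B.
    move=> dz; apply: HB.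
    have := Cmod_le_Rabs (z - c)%C; have := Cmod_triangle (z - c)%C c.
    rewrite (_ : (z - c + c)%C = z); last by ring.
    have := Rmax_l (Rabs (z.1 - c.1)) (Rabs (z.2 - c.2)); have := Rmax_r (Rabs (z.1 - c.1)) (Rabs (z.2 - c.2)).
    rewrite /d in dz; rewrite /= -/(z.1 - c.1) -/(z.2 - c.2); lra.
  pose E x := exists z, 0 <= d z /\ x = val z.
  have [||S [ubS lubS]] := completeness E.
  + exists B => x [z [dz ->]]; rewrite /val.
    have := dB z dz; have := Cmod_ge_0 (f z).
    have := rpow_le (d z) 1 (2 / p) ltac:(lra) dz (d1 z).
    rewrite {2}/rpow powR1 -[(1%R : R)]/(IZR 1); have := rpow_ge0 (d z) (2 / p); nra.
  + by exists (val c), c; rewrite dc; split=> //; lra.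
  have S1 : Cmod (f c) <= S.
    have : val c <= S by apply: ubS; exists c; rewrite dc; split => //; lra.
    by rewrite /val dc /rpow powR1 -[(1%R : R)]/(IZR 1); lra.
  case: (Req_dec S 0) => [S0|S0].
    have -> : Cmod (f c) = 0 by have := Cmod_ge_0 (f c); lra.
    by rewrite rpow_0; [nra | lra].
  have {}S0 : 0 < S by have := Cmod_ge_0 (f c); lra.
  have [z [dz Hz]] : exists z, 0 <= d z /\ S / 2 < val z.
    apply: NNPP => Hn.
    have : S <= S / 2 by apply: lubS => x [z [dz ->]]; apply: Rnot_lt_le => Hlt; apply: Hn; exists z.
    lra.
  have {}dz : 0 < d z.
    case: (Req_dec (d z) 0) => [E0|]; last lra.
    by move: Hz; rewrite /val E0 rpow_0; lra.
  pose r := d z / 2; have r0 : 0 < r by rewrite /r; lra.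
  have sub (w : C) : box z r w -> r <= d w.
    move=> /boxE [H1 H2]; rewrite /d.
    have : Rmax (Rabs (w.1 - c.1)) (Rabs (w.2 - c.2)) <= Rmax (Rabs (z.1 - c.1)) (Rabs (z.2 - c.2)) + r.
      apply: Rmax_lub.
      * have := Rabs_triang (w.1 - z.1) (z.1 - c.1); rewrite (_ : w.1 - z.1 + (z.1 - c.1) = w.1 - c.1); last by ring.
        by have := Rmax_l (Rabs (z.1 - c.1)) (Rabs (z.2 - c.2)); lra.
      * have := Rabs_triang (w.2 - z.2) (z.2 - c.2); rewrite (_ : w.2 - z.2 + (z.2 - c.2) = w.2 - c.2); last by ring.
        by have := Rmax_r (Rabs (z.1 - c.1)) (Rabs (z.2 - c.2)); lra.
    by rewrite /r /d; lra.
  have subb : (box z r `<=` box c 1)%classic.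
    move=> [w1 w2] Hw; have := sub (w1, w2) Hw; rewrite /d => H; apply/boxE.
    have R1 := Rmax_l (Rabs (w1 - c.1)) (Rabs (w2 - c.2)); have R2 := Rmax_r (Rabs (w1 - c.1)) (Rabs (w2 - c.2)).
    change (r <= 1 - Rmax (Rabs (w1 - c.1)) (Rabs (w2 - c.2))) in H.
    by split; [change (Rabs (w1 - c.1) <= 1) | change (Rabs (w2 - c.2) <= 1)]; lra.
  pose m := S / rpow r (2 / p).
  have rp := rpow_gt0 r (2 / p) r0.
  have m0 : 0 < m by apply: Rdiv_lt_0_compat.
  have fm w : box z r w -> Cmod (f w) <= m.
    move=> Hw; have Hd := sub w Hw; apply/(Rle_div_r _ _ _ rp).
    have : val w <= S by apply: ubS; exists w; split=> //; lra.
    have := rpow_le r (d w) (2 / p) ltac:(lra) ltac:(lra) Hd; have := Cmod_ge_0 (f w).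
    rewrite /val; nra.
  have Hb w : box z r w -> Cmod (f w) <= 0 + rpow m (1 - p) * rpow (Cmod (f w)) p.
    move=> /fm H; rewrite Rplus_0_l.
    case: (Req_dec (Cmod (f w)) 0) => [->|w0].
      by rewrite rpow_0; lra.
    have {}w0 : 0 < Cmod (f w) by have := Cmod_ge_0 (f w); lra.
    have Ex : rpow (Cmod (f w)) (1 - p) * rpow (Cmod (f w)) p = Cmod (f w).
      exact: rpow_split.
    rewrite -{1}Ex.
    apply: Rmult_le_compat_r; first exact: rpow_ge0.
    by apply: rpow_le; lra.
  have Hi1 : (\int[area]_(w in box z r) (rpow (Cmod (f w)) p)%:E <= i%:E)%E.
    apply: le_trans Hi; apply: ge0_subset_integral => //.
    - exact: measurable_box.
    - exact: measurable_box.
    - exact: rmeas_EFin (rmeas_rpow _ _ mf).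
    - by move=> w _; rewrite lee_fin; apply/RleP; exact: rpow_ge0.
  have Hi2 := integral_affine_le (box z r) _ _ 0 (rpow m (1 - p)) _ i (measurable_box _ _) (ab z r (Rlt_le _ _ r0)) mf (rmeas_rpow _ p mf)
    (fun z => Cmod_ge_0 (f z)) (fun z => rpow_ge0 _ _) (Rle_refl 0) (rpow_ge0 _ _) Hb Hi1.
  have := box_mean_bound f z r _ Hf r0 Hi2.
  rewrite Rmult_0_l Rplus_0_l => H.
  have E1 : rpow (d z) (2 / p) = rpow 2 (2 / p) * rpow r (2 / p).
    by rewrite -rpow_mul; [congr rpow; rewrite /r; field | lra | lra].
  have E2 : rpow m (1 - p) * rpow m p = m.
    exact: rpow_split.
  have E3 : rpow m p * (r * r) = rpow S p.
    have -> : S = m * rpow r (2 / p) by rewrite /m; field; lra.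
    rewrite rpow_mul; try lra.
    rewrite rpow_rpow (_ : 2 / p * p = 1 + 1); last by field; lra.
    by rewrite rpow_add // rpow_1; lra.
  have mp := rpow_gt0 m (1 - p) m0.
  have P2 := rpow_gt0 2 (2 / p) ltac:(lra).
  apply: Rle_trans (rpow_le _ _ p ltac:(lra) (Cmod_ge_0 _) S1) _.
  (* [S / 2 < 2^(2/p) r^(2/p) |f z|] and [r^(2/p) m = S] *)
  have H1 : m < 2 * rpow 2 (2 / p) * Cmod (f z).
    apply: (Rmult_lt_reg_r (rpow r (2 / p))) => //.
    have -> : m * rpow r (2 / p) = S by rewrite /m; field; lra.
    by move: Hz; rewrite /val E1; lra.
  have H2 : rpow m (1 - p) * (rpow m p * (r * r)) <= rpow m (1 - p) * (K * i).
    rewrite -Rmult_assoc E2 /K; nra.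
  by rewrite E3 in H2; apply: Rmult_le_reg_l H2.
Qed.

(** * Local estimates in the Fock space *)

Definition dens (p : R) (f : C -> C) (z : C) : R :=
  rpow (Cmod (f z)) p * exp (- (p / 2) * Cmod z ^ 2).

Definition gv (f : C -> C) (z : C) : R := Cmod (f z) * exp (- (Cmod z ^ 2 / 2)).

Lemma gv_ge0 f z : 0 <= gv f z.
Proof. by apply: Rmult_le_pos; [exact: Cmod_ge_0 | apply: Rlt_le; exact: exp_pos]. Qed.

Lemma dens_gv p f z : dens p f z = rpow (gv f z) p.
Proof.
rewrite /dens /gv rpow_mul; [|exact: Cmod_ge_0|apply: Rlt_le; exact: exp_pos].
by rewrite rpow_exp; congr (_ * exp _); field.
Qed.

Lemma dens_ge0 p f z : 0 <= dens p f z.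
Proof. by rewrite dens_gv; exact: rpow_ge0. Qed.

Lemma fock_integralE p f : fock_integral p f = (\int[area]_(z in setT) (dens p f z)%:E)%E.
Proof. by []. Qed.

Lemma rmeas_gauss (k : R) (c : C) : rmeas (fun z => exp (k * Cmod (z - c) ^ 2)).
Proof.
apply: rmeas_exp; apply: measurable_cont2 => z eps e0.
pose K := (Rabs k + 1) * (2 * Cmod (z - c) + 2).
have K0 : 0 < K by have := Rabs_pos k; have := Cmod_ge_0 (z - c)%C; rewrite /K; nra.
exists (Rmin 1 (eps / K)); split.
  by apply: Rmin_glb_lt; [lra | apply: Rdiv_lt_0_compat].
move=> w Hw.
have H1 := Rlt_le_trans _ _ _ Hw (Rmin_l _ _).
have H2 := Rlt_le_trans _ _ _ Hw (Rmin_r _ _).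
have {}H2 : Cmod (w - z) * K < eps by apply/Rlt_div_r.
set x := Cmod (w - c); set y := Cmod (z - c) in K K0 Hw H2 *.
have D1 : x <= y + Cmod (w - z).
  by rewrite /x (_ : (w - c = (z - c) + (w - z))%C); [exact: Cmod_triangle | ring].
have D2 : y <= x + Cmod (w - z).
  rewrite (Cmod_sub_sym w z) /y /x (_ : (z - c = (w - c) + (z - w))%C); [exact: Cmod_triangle | ring].
have x0 : 0 <= x by exact: Cmod_ge_0.
have y0 : 0 <= y by exact: Cmod_ge_0.
have d0 := Cmod_ge_0 (w - z)%C.
have -> : k * x ^ 2 - k * y ^ 2 = k * ((x - y) * (x + y)) by ring.
rewrite !Rabs_mult (Rabs_pos_eq (x + y)); last lra.
have D : Rabs (x - y) <= Cmod (w - z) by apply: Rabs_le; lra.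
apply: Rle_lt_trans H2.
have -> : Cmod (w - z) * K = (Rabs k + 1) * (Cmod (w - z) * (2 * y + 2)) by rewrite /K; ring.
have k0 := Rabs_pos k; have xy0 := Rabs_pos (x - y).
apply: Rmult_le_compat; [lra | nra | lra |].
by apply: Rmult_le_compat; lra.
Qed.

Lemma rmeas_dens p f : entire f -> rmeas (dens p f).
Proof.
move=> Hf; apply: rmeas_mul; first by apply: rmeas_rpow; exact: rmeas_Cmod.
have := rmeas_gauss (- (p / 2)) 0%C.
by congr rmeas; apply/funext => z; rewrite (_ : (z - 0)%C = z) //; ring.
Qed.

Lemma Cmod_le_sqrt2 (z : C) r : Rabs z.1 <= r -> Rabs z.2 <= r -> Cmod z * Cmod z <= 2 * (r * r).
Proof.
move=> /Rabs_le_between H1 /Rabs_le_between H2; rewrite Cmod_sqr -!/(z.1) -!/(z.2).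
nra.
Qed.

(* The Weyl twist [f z * exp (- conj c z)] turns the Gaussian weight at [z] into one
   centred at [c], which is bounded below on a box around [c]. *)
Lemma dens_box_bound p : 0 < p -> exists K, 0 < K /\ forall f c i, entire f ->
  (\int[area]_(z in box c 1) (dens p f z)%:E <= i%:E)%E -> dens p f c <= K * i.
Proof.
move=> p0; have [K [K0 HK]] := box_pow_bound p p0.
(* On the box [|z - c|^2 <= 2], so recentring the weight costs at most [exp p]. *)
exists (K * exp p); split; first by apply: Rmult_lt_0_compat => //; exact: exp_pos.
move=> f c i Hf Hi.
pose fc z := (f z * cexp (- Cconj c * z))%C.
have Hfc : entire fc.
  apply: entire_mult => //; apply: (entire_comp cexp (fun z => - Cconj c * z)%C) entire_cexp _.
  exact: entire_mult (entire_const _) entire_id.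
have E z : rpow (Cmod (fc z)) p = exp (- (p / 2) * Cmod c ^ 2) * exp (p / 2 * Cmod (z - c) ^ 2) * dens p f z.
  rewrite /fc Cmod_mult Cmod_cexp rpow_mul; [|exact: Cmod_ge_0|apply: Rlt_le; exact: exp_pos].
  rewrite rpow_exp /dens; transitivity (rpow (Cmod (f z)) p * (exp (- (p / 2) * Cmod c ^ 2) *
    exp (p / 2 * Cmod (z - c) ^ 2) * exp (- (p / 2) * Cmod z ^ 2))); last by ring.
  congr (_ * _); rewrite -!exp_plus; congr exp.
  rewrite !Cmod2_fst_snd; case: z => x y; case: c {Hi fc Hfc} => u v.
  by rewrite /Cconj /Cmult /Cminus /Cplus /Copp /=; field.
have mf := rmeas_dens p f Hf.
have Hi2 : (\int[area]_(z in box c 1) (rpow (Cmod (fc z)) p)%:E <=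
    (0 * 4 + exp (- (p / 2) * Cmod c ^ 2) * exp p * i)%real%:E)%E.
  apply: (integral_affine_le (box c 1) _ (dens p f)) => //.
  - exact: measurable_box.
  - by rewrite area_box; [congr EFin; change (4 * (1 * 1) = 4 :> R); ring | lra].
  - by apply: rmeas_rpow; exact: rmeas_Cmod.
  - by move=> z; exact: rpow_ge0.
  - by move=> z; exact: dens_ge0.
  - lra.
  - by apply: Rmult_le_pos; apply: Rlt_le; exact: exp_pos.
  - move=> z /boxE [H1 H2]; rewrite E Rplus_0_l.
    apply: Rmult_le_compat_r; first exact: dens_ge0.
    apply: Rmult_le_compat_l; first by apply: Rlt_le; exact: exp_pos.
    apply: exp_le_mono.
    have := Cmod_le_sqrt2 (z - c)%C 1 H1 H2; rewrite /= Rmult_1_r; nra.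
have := HK fc c _ Hfc Hi2; rewrite E.
rewrite (_ : (c - c)%C = 0%C); last by ring.
rewrite Cmod_0 (_ : p / 2 * 0 ^ 2 = 0); last by ring.
rewrite exp_0 Rmult_1_r => H.
have e0 := exp_pos (- (p / 2) * Cmod c ^ 2).
apply: (Rmult_le_reg_l _ _ _ e0).
by apply: Rle_trans H _; apply: Req_le; ring.
Qed.

(* The library's sigma-finite instance on [\x] is only inferred for finite factors. *)
Definition planar_area : set plane -> \bar R := (leb \x leb)%E.
HB.instance Definition _ := Measure.copy planar_area (leb \x leb)%E.

Lemma planar_area_sigma_finite : sigma_finite setT planar_area.
Proof.
exists (fun n => box 0%C (INR n)).
  apply/esym/seteqP; split => // -[x y] _.
  have [n Hn] := INR_unbounded (Rabs x + Rabs y).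
  exists n => //; apply/boxE => /=; rewrite !Rminus_0_r.
  by have := Rabs_pos x; have := Rabs_pos y; split; lra.
move=> n; split; first exact: measurable_box.
by rewrite [X in (X < _)%E](area_box 0%C (INR n) (pos_INR n)) ltry.
Qed.

HB.instance Definition _ :=
  Measure_isSigmaFinite.Build _ _ _ planar_area planar_area_sigma_finite.

Lemma in_Fock_finite p f : in_Fock p f -> entire f /\ exists I, 0 <= I /\ fock_integral p f = I%:E.
Proof.
move=> [Hf Hlt]; split => //.
have H0 : (0 <= fock_integral p f)%E.
  by rewrite fock_integralE; apply: integral_ge0 => z _; rewrite lee_fin; apply/RleP; exact: dens_ge0.
exists (fine (fock_integral p f)); split; first by apply/RleP; exact: fine_ge0.
by rewrite fineK // ge0_fin_numE.
Qed.

(** Real-valued, so that real powers of it can be taken; [fine] loses nothing when the Fock integral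
    is finite, by [boxintE]. *)
Definition boxint p f r c : R := fine (\int[area]_(z in box c r) (dens p f z)%:E)%E.

Section boxint.
Variables (p : R) (f : C -> C) (I : R).
Hypotheses (Hf : entire f) (HI : fock_integral p f = I%:E).

Lemma boxint_le_fock D : measurable D -> (\int[area]_(z in D) (dens p f z)%:E <= I%:E)%E.
Proof.
move=> mD; rewrite -HI fock_integralE; apply: ge0_subset_integral => //.
- exact: rmeas_EFin (rmeas_dens p f Hf).
- by move=> z _; rewrite lee_fin; apply/RleP; exact: dens_ge0.
Qed.

Lemma boxintE r c : (\int[area]_(z in box c r) (dens p f z)%:E = (boxint p f r c)%:E)%E.
Proof.
rewrite /boxint fineK // ge0_fin_numE.
  by apply: le_lt_trans (boxint_le_fock _ (measurable_box c r)) _; rewrite ltry.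
by apply: integral_ge0 => z _; rewrite lee_fin; apply/RleP; exact: dens_ge0.
Qed.

Lemma boxint_ge0 r c : 0 <= boxint p f r c.
Proof.
apply/RleP; rewrite -lee_fin -boxintE.
by apply: integral_ge0 => z _; rewrite lee_fin; apply/RleP; exact: dens_ge0.
Qed.

Lemma boxint_le r c : boxint p f r c <= I.
Proof. by apply/RleP; rewrite -lee_fin -boxintE; apply: boxint_le_fock; exact: measurable_box. Qed.

Lemma boxint_mono r c r' c' : r + Cmod (c - c') <= r' -> boxint p f r c <= boxint p f r' c'.
Proof.
move=> H; apply/RleP; rewrite -lee_fin -!boxintE; apply: ge0_subset_integral => //.
- exact: measurable_box.
- exact: measurable_box.
- exact: rmeas_EFin (rmeas_dens p f Hf).
- by move=> z _; rewrite lee_fin; apply/RleP; exact: dens_ge0.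
move=> [z1 z2] /boxE [H1 H2]; apply/boxE.
rewrite -/(_ (z1, z2)).1 in H1 *.
have D1 := Rabs_fst_Cmod (c - c'); have D2 := Rabs_snd_Cmod (c - c').
rewrite /= -!/(_ - _) in D1 D2.
split.
- apply: Rle_trans (_ : Rabs ((z1 - c.1) + (c.1 - c'.1)) <= _); first by apply: Req_le; congr Rabs; rewrite /=; ring.
  by apply: Rle_trans (Rabs_triang _ _) _; move: H1 => /=; lra.
- apply: Rle_trans (_ : Rabs ((z2 - c.2) + (c.2 - c'.2)) <= _); first by apply: Req_le; congr Rabs; rewrite /=; ring.
  by apply: Rle_trans (Rabs_triang _ _) _; move: H2 => /=; lra.
Qed.

End boxint.

(** The incidence relation between [z] and the box around [a * z + b], over which Tonelli's theorem
    exchanges the integrals of [integral_boxint_affine]; it is cut out by two real affine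
    functions. *)
Lemma measurable_affine_box (a b : C) r :
  measurable [set x : plane * plane | box (a * x.1 + b)%C r x.2].
Proof.
have m11 : measurable_fun [set: plane * plane] (fun x => x.1.1 : measurableTypeR R).
  exact: (measurableT_comp measurable_fst measurable_fst).
have m12 : measurable_fun [set: plane * plane] (fun x => x.1.2 : measurableTypeR R).
  exact: (measurableT_comp measurable_snd measurable_fst).
have m21 : measurable_fun [set: plane * plane] (fun x => x.2.1 : measurableTypeR R).
  exact: (measurableT_comp measurable_fst measurable_snd).
have m22 : measurable_fun [set: plane * plane] (fun x => x.2.2 : measurableTypeR R).
  exact: (measurableT_comp measurable_snd measurable_snd).
have lin (u v w : R) (g : plane * plane -> measurableTypeR R) : measurable_fun [set: plane * plane] g ->
    measurable_fun [set: plane * plane] (fun x => g x - (u * x.1.1 + v * x.1.2 + w) : measurableTypeR R).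
  move=> mg; apply: measurable_funB => //; apply: measurable_funD; last exact: measurable_cst.
  by apply: measurable_funD; apply: measurable_funM => //; exact: measurable_cst.
have L1 := lin a.1 (- a.2) b.1 _ m21; have L2 := lin a.2 a.1 b.2 _ m22.
have mI : measurable (`[- r, r] : set (measurableTypeR R)) by exact: measurable_itv.
have := measurableI _ _ (L1 measurableT _ mI) (L2 measurableT _ mI).
congr measurable; apply/seteqP; split => -[[z1 z2] [w1 w2]].
- move=> [[_]]; rewrite /= in_itv /= => /andP[/RleP H1 /RleP H2] [_].
  rewrite in_itv /= => /andP[/RleP H3 /RleP H4].
  apply/boxE; split; apply: Rabs_le.
    change (- r <= w1 - (a.1 * z1 - a.2 * z2 + b.1) <= r).
    by change (- r <= w1 - (a.1 * z1 + - a.2 * z2 + b.1)) in H1; change (w1 - (a.1 * z1 + - a.2 * z2 + b.1) <= r) in H2; lra.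
  change (- r <= w2 - (a.1 * z2 + a.2 * z1 + b.2) <= r).
  by change (- r <= w2 - (a.2 * z1 + a.1 * z2 + b.2)) in H3; change (w2 - (a.2 * z1 + a.1 * z2 + b.2) <= r) in H4; lra.
- move=> /boxE [/Rabs_le_between H1 /Rabs_le_between H2].
  change (- r <= w1 - (a.1 * z1 - a.2 * z2 + b.1) <= r) in H1.
  change (- r <= w2 - (a.1 * z2 + a.2 * z1 + b.2) <= r) in H2.
  split; split => //; rewrite /= in_itv /=; apply/andP; split; apply/RleP.
  + by change (- r <= w1 - (a.1 * z1 + - a.2 * z2 + b.1)); lra.
  + by change (w1 - (a.1 * z1 + - a.2 * z2 + b.1) <= r); lra.
  + by change (- r <= w2 - (a.2 * z1 + a.1 * z2 + b.2)); lra.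
  + by change (w2 - (a.2 * z1 + a.1 * z2 + b.2) <= r); lra.
Qed.

Section affine_average.
Variables (p : R) (f : C -> C) (I : R) (a b : C) (r : R).
Hypotheses (Hf : entire f) (HI : fock_integral p f = I%:E) (Ha : a <> 0%C) (Hr : 0 <= r).

Let S : set (plane * plane) := [set x : plane * plane | box (a * x.1 + b)%C r x.2].
Let h : plane * plane -> \bar R := (fun x => (dens p f x.2)%:E) \_ S.

Let mh : measurable_fun setT h.
Proof.
apply/(measurable_restrictT _ (measurable_affine_box a b r)); apply: measurable_funTS.
exact: (measurableT_comp (rmeas_EFin setT _ (rmeas_dens p f Hf)) measurable_snd).
Qed.

Let h0 x : (0 <= h x)%E.
Proof. by rewrite /h patchE; case: ifP => // _; rewrite lee_fin; apply/RleP; exact: dens_ge0. Qed.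

Let hE z : (\int[area]_w h (z, w) = (boxint p f r (a * z + b)%C)%:E)%E.
Proof.
rewrite -(boxintE p f I Hf HI) [RHS]integral_mkcond; apply: eq_integral => w _.
by rewrite /h !patchE; congr (if _ then _ else _).
Qed.

Lemma rmeas_boxint_affine : rmeas (fun z => boxint p f r (a * z + b)%C).
Proof.
apply/measurable_EFinP.
have := @measurable_fun_fubini_tonelli_F _ _ _ _ _ planar_area h mh h0.
by congr measurable_fun; apply/funext => z; rewrite /fubini_F hE.
Qed.

(** Tonelli's theorem does the change of variables: the integral is that of [dens p f w] times the
    area of the set of [z] incident with [w]. Such a [z] is within [2 * r / |a|] of
    [(w - b) / a]. *)
Lemma integral_boxint_affine :
  (\int[area]_z (boxint p f r (a * z + b)%C)%:E <= (4 * (2 * r / Cmod a * (2 * r / Cmod a)) * I)%real%:E)%E.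
Proof.
have a0 : 0 < Cmod a by apply/Cmod_gt_0.
set rho := 2 * r / Cmod a.
have rho0 : 0 <= rho by apply: Rle_mult_inv_pos => //; lra.
have -> : (\int[area]_z (boxint p f r (a * z + b)%C)%:E = \int[area]_z \int[area]_w h (z, w))%E.
  by apply: eq_integral => z _; rewrite hE.
rewrite [X in (X <= _)%E](@fubini_tonelli _ _ _ _ _ planar_area planar_area h mh h0).
have e0 w : (0 <= (dens p f w)%:E)%E by rewrite lee_fin; apply/RleP; exact: dens_ge0.
have k0 : (0 <= (4 * (rho * rho))%real%:E)%E by rewrite lee_fin; apply/RleP; change (0 <= 4 * (rho * rho)); nra.
have md : measurable_fun [set: plane] (fun w : plane => (dens p f w)%:E) by exact: rmeas_EFin (rmeas_dens p f Hf).
apply: (@le_trans _ _ (\int[area]_w ((4 * (rho * rho))%real%:E * (dens p f w)%:E))%E); last first.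
  by rewrite ge0_integralZl // -fock_integralE HI -EFinM; exact: lexx.
apply: ge0_le_integral => //.
- by move=> w _; apply: integral_ge0.
- exact: (@measurable_fun_fubini_tonelli_G _ _ _ _ _ planar_area h mh h0).
- exact: measurable_funeM.
move=> w _.
pose B := box ((w - b) / a)%C rho.
apply: (@le_trans _ _ (\int[area]_(z in B) (dens p f w)%:E)%E); last first.
  rewrite integral_cst; last exact: measurable_box.
  set L := (X in (_ * X)%E); have -> : L = (4 * (rho * rho))%real%:E by exact: area_box.
  by rewrite muleC.
rewrite [X in (_ <= X)%E]integral_mkcond; apply: ge0_le_integral => //.
- exact: measurable_fun_pair1.
- by apply/(measurable_restrictT _ (measurable_box _ _)); exact: measurable_cst.
move=> z _; rewrite /h !patchE; case: ifPn => [|_]; last by case: ifP.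
rewrite inE => /boxE [H1 H2].
case: ifPn => // /negP; case; rewrite inE /B; apply/boxE.
have E : (z - (w - b) / a = ((a * z + b) - w) / a)%C by field.
have Hm : Cmod (z - (w - b) / a) <= rho.
  rewrite E Cmod_div //; apply/Rle_div_l => //; rewrite /rho.
  have -> : 2 * r / Cmod a * Cmod a = 2 * r by field; lra.
  rewrite Cmod_sub_sym; apply: Rle_trans (Cmod_le_Rabs _) _.
  by move: H1 H2; rewrite /= -!/(_ - _); lra.
have D1 := Rabs_fst_Cmod (z - (w - b) / a)%C; have D2 := Rabs_snd_Cmod (z - (w - b) / a)%C.
by split; [apply: Rle_trans Hm; exact: D1 | apply: Rle_trans Hm; exact: D2].
Qed.
End affine_average.

(** * Integrable majorants *)

Lemma integral_le_RInt (g : R -> R) K :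
  (forall t, @Continuity.continuous R_UniformSpace R_UniformSpace g t) -> (forall t, 0 <= g t) ->
  (forall a b, a < b -> RInt g a b <= K) -> (\int[leb]_x (g x)%:E <= K%:E)%E.
Proof.
move=> cg g0 HK.
(* The shift to [n.+1] keeps the interval nondegenerate, as [integral_RInt] requires. *)
pose F (n : nat) : set (measurableTypeR R) := `[(- INR n.+1)%real, INR n.+1].
have mg : measurable_fun [set: measurableTypeR R] (fun x => (g x)%:E).
  apply/measurable_EFinP; apply: continuous_measurable_fun => x.
  by apply: continuous_coq_mc; exact: (proj2 (continuity_pt_filterlim g x) (cg x)).
have nF : nondecreasing_seq F.
  move=> m n mn; apply/subsetPset => x; rewrite /F /= !in_itv /= => /andP[/RleP H1 /RleP H2].
  have H : INR m.+1 <= INR n.+1 by apply: le_INR; apply: le_n_S; apply/ssrnat.leP.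
  change (- INR m.+1 <= x) in H1; change (x <= INR m.+1) in H2.
  by apply/andP; split; apply/RleP; [change (- INR n.+1 <= x) | change (x <= INR n.+1)]; lra.
have UF : \bigcup_n F n = setT.
  apply/seteqP; split => // x _; have [n Hn] := INR_unbounded (Rabs x).
  have [H1 H2] := Rabs_def2 _ _ Hn; have H3 := S_INR n.
  exists n => //; rewrite /F /= in_itv /=; apply/andP; split; apply/RleP.
    by change (- INR n.+1 <= x); rewrite H3; lra.
  by change (x <= INR n.+1); rewrite H3; lra.
have g0' n x : F n x -> (0 <= (g x)%:E)%E by move=> _; rewrite lee_fin; apply/RleP.
have cv := @ge0_nondecreasing_set_cvg_integral _ _ _ F (fun x => (g x)%:E) leb nF (fun=> measurable_itv _) (fun n => measurable_funTS mg)
  g0'.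
rewrite UF in cv.
apply: (cvge_le _ cv); apply: nearW => n.
have n0 := lt_0_INR n.+1 (Nat.lt_0_succ n).
by rewrite /F integral_RInt //; [rewrite lee_fin; apply/RleP; apply: HK; lra | lra].
Qed.

Lemma continuous_inv_quadratic m t :
  @Continuity.continuous R_UniformSpace R_UniformSpace (fun x => / (1 + (x - m) ^ 2)) t.
Proof.
apply: ex_derive_continuous; auto_derive => //.
by have := pow2_ge_0 (t - m); rewrite /=; lra.
Qed.

Lemma inv_quadratic_gt0 m t : 0 < / (1 + (t - m) ^ 2).
Proof. by apply: Rinv_0_lt_compat; have := pow2_ge_0 (t - m); lra. Qed.

Lemma integral_inv_quadratic m : (\int[leb]_x (/ (1 + (x - m) ^ 2))%real%:E <= 4%real%:E)%E.
Proof.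
apply: (integral_le_RInt (fun x => / (1 + (x - m) ^ 2))) => [t|t|a b ab].
- exact: continuous_inv_quadratic.
- by apply: Rlt_le; exact: inv_quadratic_gt0.
- rewrite (is_RInt_unique _ _ _ (Ratan.atan (b - m) - Ratan.atan (a - m))).
    have := Ratan.atan_bound (b - m); have := Ratan.atan_bound (a - m); have := PI_4; lra.
  apply: (is_RInt_derive (fun x => Ratan.atan (x - m))) => x _; last exact: continuous_inv_quadratic.
  by auto_derive => //; rewrite /Rsqr; field; have := pow2_ge_0 (x - m); lra.
Qed.

(** A product of unnormalised Cauchy densities, the common integrable majorant of Gaussians,
    exponential tails and indicators of discs. Each factor has an arctangent as primitive, and
    [PI <= 4] gives the bound 16 on the integral. *)
Definition qker (c z : C) : R := / (1 + (z.1 - c.1) ^ 2) * / (1 + (z.2 - c.2) ^ 2).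

Lemma qker_gt0 c z : 0 < qker c z.
Proof. by apply: Rmult_lt_0_compat; exact: inv_quadratic_gt0. Qed.

Lemma measurable_inv_quadratic m : measurable_fun [set: measurableTypeR R] (fun x => (/ (1 + (x - m) ^ 2))%real : measurableTypeR R).
Proof.
apply: continuous_measurable_fun => x; apply: continuous_coq_mc.
exact: (proj2 (continuity_pt_filterlim _ x) (continuous_inv_quadratic m x)).
Qed.

Lemma rmeas_qker c : rmeas (qker c).
Proof.
apply: rmeas_mul.
- exact (measurableT_comp (measurable_inv_quadratic c.1) measurable_fst).
- exact (measurableT_comp (measurable_inv_quadratic c.2) measurable_snd).
Qed.

Lemma integral_qker c : (\int[area]_z (qker c z)%:E <= 16%real%:E)%E.
Proof.
have mq := rmeas_EFin setT _ (rmeas_qker c).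
have q0 z : (0 <= (qker c z)%:E)%E by rewrite lee_fin; apply/RleP; apply: Rlt_le; exact: qker_gt0.
have [T _] := @tonelli_rectangle (fun z => (qker c z)%:E) setT setT measurableT measurableT mq q0.
rewrite setXTT in T; rewrite [X in (X <= _)%E]T.
have k0 m x : (0 <= (/ (1 + (x - m) ^ 2))%real%:E)%E by rewrite lee_fin; apply/RleP; apply: Rlt_le; exact: inv_quadratic_gt0.
have mk m : measurable_fun [set: measurableTypeR R] (fun x => (/ (1 + (x - m) ^ 2))%real%:E).
  by apply/measurable_EFinP; exact: measurable_inv_quadratic.
have p4 : (0 <= 4%real%:E :> \bar R)%E by rewrite lee_fin; apply/RleP; change (0 <= 4); lra.
apply: (@le_trans _ _ (\int[leb]_x (4%real%:E * (/ (1 + (x - c.1) ^ 2))%real%:E))%E).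
  apply: ge0_le_integral => //.
  - by move=> x _; apply: integral_ge0.
  - exact: (measurable_slice_int1 _ _ measurableT mq q0).
  - exact: measurable_funeM.
  move=> x _.
  rewrite (_ : (\int[leb]_(y in setT) (qker c (x, y))%:E =
     \int[leb]_y ((/ (1 + (x - c.1) ^ 2))%real%:E * (/ (1 + (y - c.2) ^ 2))%real%:E))%E); last first.
    by apply: eq_integral => y _; rewrite -EFinM.
  rewrite ge0_integralZl // muleC; apply: lee_wpmul2r => //.
  exact: integral_inv_quadratic.
rewrite ge0_integralZl //.
have -> : (16%real%:E = 4%real%:E * 4%real%:E :> \bar R)%E by rewrite -EFinM; congr EFin; change (16 = 4 * 4 :> R); ring.
apply: lee_wpmul2l => //; exact: integral_inv_quadratic.
Qed.

Lemma integral_lin2_le (u w1 w2 : C -> R) k1 k2 i1 i2 :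
  rmeas u -> rmeas w1 -> rmeas w2 ->
  (forall z, 0 <= u z) -> (forall z, 0 <= w1 z) -> (forall z, 0 <= w2 z) -> 0 <= k1 -> 0 <= k2 ->
  (forall z, u z <= k1 * w1 z + k2 * w2 z) ->
  (\int[area]_z (w1 z)%:E <= i1%:E)%E -> (\int[area]_z (w2 z)%:E <= i2%:E)%E ->
  (\int[area]_z (u z)%:E <= (k1 * i1 + k2 * i2)%real%:E)%E.
Proof.
move=> mu m1 m2 u0 w10 w20 k10 k20 H Hi1 Hi2.
have e0 (x : R) : 0 <= x -> (0 <= x%:E)%E by move=> ?; rewrite lee_fin; apply/RleP.
have mm1 := rmeas_EFin setT _ m1; have mm2 := rmeas_EFin setT _ m2.
have k10' := e0 _ k10; have k20' := e0 _ k20.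
have z1 (z : plane) : [set: plane] z -> (0 <= (w1 z)%:E)%E by move=> _; exact: e0.
have z2 (z : plane) : [set: plane] z -> (0 <= (w2 z)%:E)%E by move=> _; exact: e0.
have mk1 : measurable_fun [set: plane] (fun z : plane => k1%:E * (w1 z)%:E)%E by exact: measurable_funeM.
have mk2 : measurable_fun [set: plane] (fun z : plane => k2%:E * (w2 z)%:E)%E by exact: measurable_funeM.
have y1 (z : plane) : [set: plane] z -> (0 <= k1%:E * (w1 z)%:E)%E by move=> _; apply: mule_ge0; [|apply: z1].
have y2 (z : plane) : [set: plane] z -> (0 <= k2%:E * (w2 z)%:E)%E by move=> _; apply: mule_ge0; [|apply: z2].
apply: (@le_trans _ _ (\int[area]_z (k1%:E * (w1 z)%:E + k2%:E * (w2 z)%:E))%E).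
  apply: ge0_le_integral => //.
  - by move=> z _; apply: e0.
  - exact: rmeas_EFin.
  - exact: emeasurable_funD.
  - move=> z _; rewrite -2!EFinM -EFinD lee_fin; apply/RleP; exact: H.
rewrite ge0_integralD // !ge0_integralZl //.
rewrite EFinD 2!EFinM; apply: leeD.
  by apply: lee_wpmul2l.
by apply: lee_wpmul2l.
Qed.

(** Since [qker 0 z] is at least [(1 + |z|)^(-4)], the fourth power of [linear_le_exp] at rate
    [q / 16] uses up exactly the decay [exp (- q * |z| / 4)] left by [far_kernel_bound]. *)
Lemma far_kernel_qker q : 0 < q -> exists K, 0 < K /\
  forall z, rpow (Cmod z * (1 + Cmod z) * exp (- (Cmod z / 2))) q <= K * qker 0%C z.
Proof.
move=> q0.
pose c := 1 + / (q / 16).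
have c0 : 0 < c by have := Rinv_0_lt_compat (q / 16) ltac:(lra); rewrite /c; lra.
have K0 : 0 < rpow 81 q * c ^ 4.
  by apply: Rmult_lt_0_compat; [apply: rpow_gt0; lra | apply: pow_lt].
exists (rpow 81 q * c ^ 4); split => // z.
have r0 := Cmod_ge_0 z; set r := Cmod z in r0 *.
have H1 : rpow (r * (1 + r) * exp (- (r / 2))) q <= rpow 81 q * exp (q * (- (r / 4))).
  rewrite -rpow_exp -rpow_mul; [|lra|by apply: Rlt_le; exact: exp_pos].
  apply: rpow_le; [lra | | exact: far_kernel_bound].
  by apply: Rmult_le_pos; [nra | apply: Rlt_le; exact: exp_pos].
apply: Rle_trans H1 _; rewrite Rmult_assoc; apply: Rmult_le_compat_l; first exact: rpow_ge0.
have X : z.1 ^ 2 + z.2 ^ 2 = r ^ 2 by rewrite /r Cmod2_fst_snd.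
have P1 := inv_quadratic_gt0 0 z.1; have P2 := inv_quadratic_gt0 0 z.2.
have H2 : exp (q * (- (r / 4))) * (1 + r) ^ 4 <= c ^ 4.
  have H := linear_le_exp (q / 16) r ltac:(lra) r0; rewrite -/c in H.
  have : (1 + r) ^ 4 <= (c * exp (q / 16 * r)) ^ 4 by apply: pow_incr; lra.
  rewrite Rpow_mult_distr pow_exp => H'.
  have E : exp (q * (- (r / 4))) * exp (INR 4 * (q / 16 * r)) = 1.
    by rewrite -exp_plus -exp_0; congr exp; rewrite /=; field.
  have := exp_pos (q * (- (r / 4))) => e0.
  apply: Rle_trans (Rmult_le_compat_l _ _ _ (Rlt_le _ _ e0) H') _.
  have -> : exp (q * - (r / 4)) * (c ^ 4 * exp (INR 4 * (q / 16 * r))) =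
     c ^ 4 * (exp (q * - (r / 4)) * exp (INR 4 * (q / 16 * r))) by ring.
  by rewrite E; lra.
rewrite /qker.
set e := exp _ in H2 *; have e0 : 0 < e by exact: exp_pos.
have Q1 : 1 + (z.1 - 0) ^ 2 <= (1 + r) ^ 2 by have := pow2_ge_0 z.2; rewrite Rminus_0_r; nra.
have Q2 : 1 + (z.2 - 0) ^ 2 <= (1 + r) ^ 2 by have := pow2_ge_0 z.1; rewrite Rminus_0_r; nra.
change (e <= c ^ 4 * (/ (1 + (z.1 - 0) ^ 2) * / (1 + (z.2 - 0) ^ 2))).
set u := 1 + (z.1 - 0) ^ 2 in P1 Q1 *; set v := 1 + (z.2 - 0) ^ 2 in P2 Q2 *.
have u0 : 0 < u by rewrite /u; have := pow2_ge_0 (z.1 - 0); lra.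
have v0 : 0 < v by rewrite /v; have := pow2_ge_0 (z.2 - 0); lra.
rewrite -Rinv_mult; apply/Rle_div_r; first exact: Rmult_lt_0_compat.
apply: Rle_trans H2; apply: Rmult_le_compat_l; first lra.
have -> : (1 + r) ^ 4 = (1 + r) ^ 2 * (1 + r) ^ 2 by ring.
by apply: Rmult_le_compat; lra.
Qed.

Lemma gauss_qker s c z : 0 < s -> exp (- (s * Cmod (z - c) ^ 2)) <= (1 + / s) ^ 2 * qker c z.
Proof.
move=> s0.
rewrite Cmod2_fst_snd (_ : - (s * (fst (z - c)%C ^ 2 + snd (z - c)%C ^ 2)) =
  - (s * (z.1 - c.1) ^ 2) + - (s * (z.2 - c.2) ^ 2)); last by rewrite /Cminus /Cplus /Copp /=; ring.
have one x : exp (- (s * x ^ 2)) <= (1 + / s) * / (1 + x ^ 2).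
  have x2 := pow2_ge_0 x.
  apply/Rle_div_r; first lra.
  have H := linear_le_exp s (x ^ 2) s0 x2.
  have E : exp (- (s * x ^ 2)) * exp (s * x ^ 2) = 1.
    by rewrite -exp_plus -exp_0; congr exp; ring.
  have e0 := exp_pos (- (s * x ^ 2)).
  apply: Rle_trans (Rmult_le_compat_l _ _ _ (Rlt_le _ _ e0) H) _; apply: Req_le.
  by rewrite -Rmult_assoc (Rmult_comm _ (1 + / s)) Rmult_assoc E Rmult_1_r.
rewrite exp_plus /qker.
have -> : (1 + / s) ^ 2 * (/ (1 + (z.1 - c.1) ^ 2) * / (1 + (z.2 - c.2) ^ 2)) =
  ((1 + / s) * / (1 + (z.1 - c.1) ^ 2)) * ((1 + / s) * / (1 + (z.2 - c.2) ^ 2)) by ring.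
by apply: Rmult_le_compat; (exact: one || (apply: Rlt_le; exact: exp_pos)).
Qed.

Lemma rpow_1x p : rpow 1 p = 1.
Proof. by rewrite /rpow powR1. Qed.

Lemma rpow_sum3 x y u q : 0 < q -> 0 <= x -> 0 <= y -> 0 <= u ->
  rpow (x + y + u) q <= rpow 2 q * rpow 2 q * (rpow x q + rpow y q + rpow u q).
Proof.
move=> q0 x0 y0 u0.
have H2 : 1 <= rpow 2 q by rewrite -{1}(rpow_1x q); apply: rpow_le; lra.
have H1 := rpow_sum (x + y) u q q0 ltac:(lra) u0.
have H3 := rpow_sum x y q q0 x0 y0.
have U0 := rpow_ge0 u q.
have H4 := Rmult_le_compat_l (rpow 2 q) _ _ ltac:(lra) H3.
have H5 : 1 * (rpow 2 q * rpow u q) <= rpow 2 q * (rpow 2 q * rpow u q) by apply: Rmult_le_compat_r => //; nra.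
lra.
Qed.

(** * The norm estimate *)

Section norm_estimate.
Variables (p q : R) (a b : C).
Hypotheses (p0 : 0 < p) (pq : p <= q) (a0 : a <> 0%C) (a1 : Cmod a <= 1).

Lemma rpow_ratio A I : 0 <= A -> A <= I -> rpow A (q / p) <= rpow I (q / p - 1) * A.
Proof.
move=> A0 AI.
have qp : 1 <= q / p by apply/Rle_div_r; lra.
case: (Req_dec A 0) => [->|An].
  by rewrite rpow_0; lra.
have {1}-> : q / p = (q / p - 1) + 1 by ring.
rewrite rpow_add ?rpow_1 //; last lra.
apply: Rmult_le_compat_r => //.
by apply: rpow_le; lra.
Qed.

Lemma rpow_ratio_eq I : 0 <= I -> rpow I (q / p - 1) * I = rpow I (q / p).
Proof.
move=> I0.
have qp : 1 <= q / p by apply/Rle_div_r; lra.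
case: (Req_dec I 0) => [->|In].
  by rewrite Rmult_0_r rpow_0; lra.
have {2}-> : q / p = (q / p - 1) + 1 by ring.
by rewrite rpow_add ?rpow_1 //; lra.
Qed.

(* Bounding [dens q] by the single power [I ^ (q/p - 1) * boxint] is where [p <= q] enters;
   integrating the local averages over the plane only costs the Jacobian of [a z + b]. *)
Lemma norm_estimate : exists K, 0 < K /\ forall f I h eps delta rho,
  entire f -> 0 <= I -> fock_integral p f = I%:E -> entire h -> 0 <= eps -> 0 <= delta -> 0 <= rho ->
  (forall z, Cmod (h z) <= (eps * rpow (boxint p f 2 (a * z + b)%C) (/ p) + (if Rle_dec (Cmod z) rho then delta else 0)) *
     ((1 + Cmod z) * exp (Cmod z ^ 2 / 2))) ->
  (fock_integral q (cint0 h) <=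
    (K * (rpow eps q * rpow I (q / p) + rpow delta q * (1 + (rho + 1) ^ 2) ^ 2))%real%:E)%E.
Proof.
have q0 : 0 < q by lra.
have [G [G0 HG]] := far_kernel_qker q q0.
pose c2 := rpow 2 q * rpow 2 q.
have c20 : 0 < c2 by apply: Rmult_lt_0_compat; apply: rpow_gt0; lra.
have c30 : 0 < rpow 3 q by apply: rpow_gt0; lra.
have d20 : 0 < rpow 2 q by apply: rpow_gt0; lra.
have ca0 : 0 < Cmod a by apply/Cmod_gt_0.
pose kap := 4 * (2 * 3 / Cmod a * (2 * 3 / Cmod a)).
have kap0 : 0 <= kap by have := pow2_ge_0 (2 * 3 / Cmod a); rewrite /kap; nra.
pose K := c2 * (rpow 3 q * kap + rpow 3 q * 16 + rpow 2 q * G * 16).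
have K0 : 0 < K by rewrite /K; have := Rmult_lt_0_compat _ _ d20 G0; have := Rmult_le_pos _ _ (Rlt_le _ _ c30) kap0; nra.
exists K; split => // f I h eps delta rho Hf I0 HI Hh e0 de0 r0 Hb.
(* For [|w - z| <= 1] and [|a| <= 1], the box of radius 2 around [a * w + b] lies in the box of
   radius 3 around [a * z + b], so one average controls the near part of the ray. *)
pose A3 z := boxint p f 3 (a * z + b)%C.
have A30 z : 0 <= A3 z by exact: (boxint_ge0 p f I Hf HI).
have A3I z : A3 z <= I by exact: (boxint_le p f I Hf HI).
have pinv : 0 <= / p by apply: Rlt_le; apply: Rinv_0_lt_compat.
(* The radius grows to [rho + 1] because points within 1 of [z] have to be covered. *)
pose chi z := if Rle_dec (Cmod z) (rho + 1) then delta else 0.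
have chi0 z : 0 <= chi z by rewrite /chi; case: Rle_dec => ? /=; lra.
(* A bound on the same factor over the whole plane; it only multiplies the exponentially small far
   part. *)
pose S := eps * rpow I (/ p) + delta.
have S0 : 0 <= S by have := rpow_ge0 I (/ p); rewrite /S; nra.
pose N z := eps * rpow (A3 z) (/ p) + chi z.
have N0 z : 0 <= N z by have := rpow_ge0 (A3 z) (/ p); have := chi0 z; rewrite /N; nra.
have wt0 z : 0 <= (1 + Cmod z) * exp (Cmod z ^ 2 / 2).
  by have := Cmod_ge_0 z; have := exp_pos (Cmod z ^ 2 / 2); nra.
pose F := cint0 h.
have HF : entire F by exact: entire_cint0.
have gvF z : gv F z <= 3 * (eps * rpow (A3 z) (/ p)) + 3 * chi z + S * (Cmod z * (1 + Cmod z) * exp (- (Cmod z / 2))).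
  have H := cint0_gauss_bound h z (N z) S Hh (N0 z) S0.
  have {}H : Cmod (cint0 h z) <= exp (Cmod z ^ 2 / 2) * (3 * N z + S * (Cmod z * (1 + Cmod z) * exp (- (Cmod z / 2)))).
    apply: H => w.
    - move=> Hw; apply: Rle_trans (Hb w) _; apply: Rmult_le_compat_r => //.
      rewrite /N; apply: Rplus_le_compat.
        apply: Rmult_le_compat_l => //; apply: rpow_le => //; first exact: (boxint_ge0 p f I Hf HI).
        apply: (boxint_mono p f I Hf HI).
        rewrite (_ : (a * w + b - (a * z + b) = a * (w - z))%C); last by ring.
        by rewrite Cmod_mult; have := Cmod_ge_0 (w - z)%C; nra.
      rewrite /chi; case: Rle_dec => Hw1; case: Rle_dec => Hz1 /=; try lra.
      exfalso; apply: Hz1; rewrite (_ : z = (w + (z - w))%C); last by ring.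
      by apply: Rle_trans (Cmod_triangle _ _) _; rewrite (Cmod_sub_sym z); lra.
    - apply: Rle_trans (Hb w) _; apply: Rmult_le_compat_r => //.
      rewrite /S; apply: Rplus_le_compat; last by case: Rle_dec => ? /=; lra.
      apply: Rmult_le_compat_l => //; apply: rpow_le => //; first exact: (boxint_ge0 p f I Hf HI).
      exact: (boxint_le p f I Hf HI).
  rewrite /gv -/F in H *.
  have E : exp (Cmod z ^ 2 / 2) * exp (- (Cmod z ^ 2 / 2)) = 1.
    by rewrite -exp_plus -exp_0; congr exp; ring.
  have P := exp_pos (- (Cmod z ^ 2 / 2)).
  apply: Rle_trans (Rmult_le_compat_r _ _ _ (Rlt_le _ _ P) H) _.
  rewrite (Rmult_comm (exp (Cmod z ^ 2 / 2))) Rmult_assoc E Rmult_1_r /N; lra.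
pose k1 := c2 * rpow 3 q * rpow eps q * rpow I (q / p - 1).
(* The inverse of a lower bound of [qker 0] on the disc of radius [rho + 1]: thus [R4 * qker 0]
   dominates the indicator of that disc. *)
pose R4 := (1 + (rho + 1) ^ 2) ^ 2.
pose k2 := c2 * (rpow 3 q * rpow delta q * R4 + rpow S q * G).
have R41 : 1 <= R4 by rewrite /R4; have := pow2_ge_0 (rho + 1); nra.
have e0q := rpow_ge0 eps q; have d0q := rpow_ge0 delta q; have S0q := rpow_ge0 S q.
have chiq z : rpow (chi z) q <= rpow delta q * R4 * qker 0%C z.
  rewrite /chi; case: Rle_dec => Hz /=; last first.
    rewrite rpow_0; last lra.
    by apply: Rmult_le_pos; [nra | apply: Rlt_le; exact: qker_gt0].
  suff : 1 <= R4 * qker 0%C z by nra.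
  rewrite /qker -Rinv_mult; apply/Rle_div_r.
    by apply: Rmult_lt_0_compat; apply: Rplus_lt_le_0_compat; [lra | exact: pow2_ge_0 | lra | exact: pow2_ge_0].
  rewrite Rmult_1_l /R4.
  have X : z.1 ^ 2 + z.2 ^ 2 = Cmod z ^ 2 by rewrite Cmod2_fst_snd.
  have Y : Cmod z ^ 2 <= (rho + 1) ^ 2 by apply: pow_incr; split => //; exact: Cmod_ge_0.
  change ((1 + (z.1 - 0) ^ 2) * (1 + (z.2 - 0) ^ 2) <= (1 + (rho + 1) ^ 2) ^ 2).
  rewrite !Rminus_0_r (_ : (1 + (rho + 1) ^ 2) ^ 2 = (1 + (rho + 1) ^ 2) * (1 + (rho + 1) ^ 2)); last by ring.
  by have := pow2_ge_0 z.1; have := pow2_ge_0 z.2; move=> *; apply: Rmult_le_compat; lra.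
have Hpt z : dens q F z <= k1 * A3 z + k2 * qker 0%C z.
  rewrite dens_gv.
  apply: Rle_trans (rpow_le _ _ q (Rlt_le _ _ q0) (gv_ge0 _ _) (gvF z)) _.
  have g0 : 0 <= Cmod z * (1 + Cmod z) * exp (- (Cmod z / 2)).
    by apply: Rmult_le_pos; [have := Cmod_ge_0 z; nra | apply: Rlt_le; exact: exp_pos].
  have ep0 : 0 <= eps * rpow (A3 z) (/ p) by have := rpow_ge0 (A3 z) (/ p); nra.
  apply: Rle_trans (rpow_sum3 _ _ _ q q0 _ _ _) _; try (have := chi0 z; nra).
  rewrite -/c2 (rpow_mul 3) ?(rpow_mul eps) ?(rpow_mul 3 (chi z)) ?(rpow_mul S) //; try lra; try exact: rpow_ge0.
  rewrite rpow_rpow (_ : / p * q = q / p); last by rewrite /Rdiv; ring.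
  have B1 := rpow_ratio _ _ (A30 z) (A3I z).
  have B2 := chiq z; have B3 := HG z.
  have T1 : rpow 3 q * (rpow eps q * rpow (A3 z) (q / p)) <= rpow 3 q * (rpow eps q * (rpow I (q / p - 1) * A3 z)).
    by apply: Rmult_le_compat_l; [lra | apply: Rmult_le_compat_l].
  have T2 : rpow 3 q * rpow (chi z) q <= rpow 3 q * (rpow delta q * R4 * qker 0%C z).
    by apply: Rmult_le_compat_l; [lra|].
  have T3 : rpow S q * rpow (Cmod z * (1 + Cmod z) * exp (- (Cmod z / 2))) q <= rpow S q * (G * qker 0%C z).
    by apply: Rmult_le_compat_l.
  have -> : k1 * A3 z + k2 * qker 0%C z = c2 * (rpow 3 q * (rpow eps q * (rpow I (q / p - 1) * A3 z)) +
    rpow 3 q * (rpow delta q * R4 * qker 0%C z) + rpow S q * (G * qker 0%C z)) by rewrite /k1 /k2; ring.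
  by apply: Rmult_le_compat_l; lra.
have Iq0 := rpow_ge0 I (q / p - 1).
have k10 : 0 <= k1 by rewrite /k1; do 3 (apply: Rmult_le_pos => //); lra.
have k20 : 0 <= k2.
  rewrite /k2; apply: Rmult_le_pos; first lra.
  by apply: Rplus_le_le_0_compat; [apply: Rmult_le_pos; [apply: Rmult_le_pos|]|apply: Rmult_le_pos]; lra.
have := integral_lin2_le _ _ _ k1 k2 _ _ (rmeas_dens q F HF) (rmeas_boxint_affine p f I a b 3 Hf HI) (rmeas_qker 0%C)
  (fun z => dens_ge0 q F z) A30 (fun z => Rlt_le _ _ (qker_gt0 0%C z)) k10 k20 Hpt
  (integral_boxint_affine p f I a b 3 Hf HI a0 ltac:(lra)) (integral_qker 0%C).
rewrite -fock_integralE -/F => H; apply: le_trans H _; rewrite lee_fin; apply/RleP.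
rewrite -/kap.
have -> : k1 * (kap * I) = c2 * (rpow 3 q * kap) * (rpow eps q * rpow I (q / p)).
  by rewrite -(rpow_ratio_eq I I0) /k1; ring.
have Sq : rpow S q <= rpow 2 q * (rpow eps q * rpow I (q / p) + rpow delta q).
  have HIp := rpow_ge0 I (/ p).
  apply: Rle_trans (rpow_sum _ _ q q0 _ de0) _; first nra.
  rewrite rpow_mul // rpow_rpow (_ : / p * q = q / p); last by rewrite /Rdiv; ring.
  exact: Rle_refl.
have X0 : 0 <= rpow eps q * rpow I (q / p) by apply: Rmult_le_pos => //; exact: rpow_ge0.
rewrite /k2 {Hpt k20 k2}.
set X := rpow eps q * rpow I (q / p) in Sq X0 *.
set Y := rpow delta q in d0q chiq Sq *.
have YR : Y <= Y * R4 by nra.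
rewrite -/R4 /K.
have : rpow S q * G <= rpow 2 q * (X + Y * R4) * G.
  apply: Rmult_le_compat_r; first lra.
  by apply: Rle_trans Sq _; apply: Rmult_le_compat_l; lra.
move=> HS.
have Z0 : 0 <= Y * R4 by nra.
have U1 : 0 <= rpow 3 q * kap * (Y * R4) by apply: Rmult_le_pos => //; apply: Rmult_le_pos; lra.
have U2 : 0 <= rpow 3 q * X by apply: Rmult_le_pos; lra.
have -> : c2 * (rpow 3 q * kap) * X + c2 * (rpow 3 q * Y * R4 + rpow S q * G) * 16 =
   c2 * (rpow 3 q * kap * X + 16 * (rpow 3 q * (Y * R4)) + 16 * (rpow S q * G)) by ring.
have -> : c2 * (rpow 3 q * kap + rpow 3 q * 16 + rpow 2 q * G * 16) * (X + Y * R4) =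
  c2 * (rpow 3 q * kap * X + rpow 3 q * kap * (Y * R4) + 16 * (rpow 3 q * X) + 16 * (rpow 3 q * (Y * R4)) +
   16 * (rpow 2 q * (X + Y * R4) * G)) by ring.
apply: Rmult_le_compat_l; lra.
Qed.
End norm_estimate.

(** * Fock norms, point evaluations and decay *)

Lemma fock_norm_finite p f I : fock_integral p f = I%:E ->
  fock_norm p f = rpow (p / (2 * PI) * I) (1 / p).
Proof. by rewrite /fock_norm => ->. Qed.

Lemma in_Fock_of_bound p f J : entire f -> (fock_integral p f <= J%:E)%E -> in_Fock p f.
Proof. by move=> Hf HJ; split=> //; apply: le_lt_trans HJ _; rewrite ltry. Qed.

Lemma two_PI_ratio_gt0 p : 0 < p -> 0 < p / (2 * PI).
Proof. by move=> p0; have := PI_RGT_0; move=> ?; apply: Rdiv_lt_0_compat; lra. Qed.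

Lemma one_div_ge0 p : 0 < p -> 0 <= 1 / p.
Proof. by move=> p0; apply: Rlt_le; apply: Rdiv_lt_0_compat; lra. Qed.

Lemma fock_norm_le_of_bound p f J : 0 < p -> entire f -> (fock_integral p f <= J%:E)%E ->
  fock_norm p f <= rpow (p / (2 * PI) * J) (1 / p).
Proof.
move=> p0 Hf HJ; have [_ [I [I0 HI]]] := in_Fock_finite p f (in_Fock_of_bound p f J Hf HJ).
rewrite (fock_norm_finite p f I HI).
have IJ : I <= J by move: HJ; rewrite HI lee_fin => /RleP.
have c0 := two_PI_ratio_gt0 p p0.
apply: rpow_le; [exact: one_div_ge0 | nra | nra].
Qed.

Lemma fock_norm_ge0 p f : 0 <= fock_norm p f.
Proof. exact: rpow_ge0. Qed.

Lemma fock_integral_of_norm p f I : 0 < p -> 0 <= I -> fock_integral p f = I%:E ->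
  I = 2 * PI / p * rpow (fock_norm p f) p.
Proof.
move=> p0 I0 HI; rewrite (fock_norm_finite p f I HI) rpow_rpow.
have c0 := two_PI_ratio_gt0 p p0; have PI0 := PI_RGT_0.
rewrite (_ : 1 / p * p = 1); last by field; lra.
by rewrite rpow_1; [field; lra | nra].
Qed.

Lemma gv_le_norm p : 0 < p -> exists K, 0 < K /\ forall f z, in_Fock p f -> gv f z <= K * fock_norm p f.
Proof.
move=> p0; have [K [K0 HK]] := dens_box_bound p p0.
have PI0 := PI_RGT_0.
have c0 : 0 < K * (2 * PI / p) by apply: Rmult_lt_0_compat => //; apply: Rdiv_lt_0_compat; lra.
exists (rpow (K * (2 * PI / p)) (/ p)); split; first exact: rpow_gt0.
move=> f z HF; have [Hf [I [I0 HI]]] := in_Fock_finite p f HF.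
apply: (rpow_lt_inv _ _ p p0 (gv_ge0 f z)).
  by apply: Rmult_le_pos; exact: rpow_ge0.
rewrite rpow_mul; [|exact: rpow_ge0|exact: rpow_ge0].
rewrite rpow_rpow Rinv_l ?rpow_1; [|lra|lra].
rewrite Rmult_assoc -(fock_integral_of_norm p f I p0 I0 HI) -dens_gv.
apply: HK => //; apply: (boxint_le_fock p f I Hf HI); exact: measurable_box.
Qed.

(** By monotone convergence a central box carries all but [eta] of the integral, and the unit box
    around a distant [z] is disjoint from it. *)
Lemma fock_tail p f eta : in_Fock p f -> 0 < eta ->
  exists r, forall z, r < Cmod z -> boxint p f 1 z < eta.
Proof.
move=> HF eta0; have [Hf [I [I0 HI]]] := in_Fock_finite p f HF.
pose F (n : nat) : set plane := box 0%C (INR n).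
have md := rmeas_EFin setT _ (rmeas_dens p f Hf).
have d0 (z : plane) : (0 <= (dens p f z)%:E)%E by rewrite lee_fin; apply/RleP; exact: dens_ge0.
have nF : nondecreasing_seq F.
  move=> m n mn; apply/subsetPset => -[x y] /boxE [H1 H2]; apply/boxE.
  have H : INR m <= INR n by apply: le_INR; apply/ssrnat.leP.
  by split; [apply: Rle_trans H1 H | apply: Rle_trans H2 H].
have UF : \bigcup_n F n = setT.
  apply/seteqP; split => // -[x y] _.
  have [n Hn] := INR_unbounded (Rabs x + Rabs y).
  exists n => //; apply/boxE => /=; rewrite !Rminus_0_r.
  by have := Rabs_pos x; have := Rabs_pos y; split; lra.
have cv := @ge0_nondecreasing_set_cvg_integral _ _ _ F (fun z => (dens p f z)%:E) planar_area nF
  (fun n => measurable_box _ _) (fun n => measurable_funTS md) (fun n z _ => d0 z).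
rewrite UF in cv.
have [n Hn] : exists n, I - eta < boxint p f (INR n) 0%C.
  apply: NNPP => Hno.
  have : ((I%:E : \bar R) <= (I - eta)%real%:E)%E.
    rewrite -HI fock_integralE; apply: (cvge_le _ cv); apply: nearW => n.
    rewrite [X in (X <= _)%E](boxintE p f I Hf HI) lee_fin; apply/RleP.
    by apply: Rnot_lt_le => H; apply: Hno; exists n.
  by rewrite lee_fin => /RleP H; change (I <= I - eta) in H; lra.
exists (2 * (INR n + 1)) => z Hz.
have disj : [disjoint box z 1 & F n].
  apply/disj_set2P; apply/seteqP; split => // -[w1 w2] [/boxE [H1 H2] /boxE [H3 H4]].
  exfalso.
  change (Rabs (w1 - z.1) <= 1) in H1; change (Rabs (w2 - z.2) <= 1) in H2.
  change (Rabs (w1 - 0) <= INR n) in H3; change (Rabs (w2 - 0) <= INR n) in H4.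
  move/Rabs_le_between: H1 => H1; move/Rabs_le_between: H2 => H2.
  move/Rabs_le_between: H3 => H3; move/Rabs_le_between: H4 => H4.
  have := Cmod_le_Rabs z.
  have : Rabs (fst z) <= INR n + 1 by apply: Rabs_le; lra.
  have : Rabs (snd z) <= INR n + 1 by apply: Rabs_le; lra.
  lra.
have U := @ge0_integral_setU _ _ _ planar_area (box z 1) (F n) (measurable_box _ _) (measurable_box _ _) (fun z => (dens p f z)%:E)
  (measurable_funTS md) (fun z _ => d0 z) disj.
have : ((boxint p f 1 z + boxint p f (INR n) 0%C)%real%:E <= I%:E)%E.
  rewrite EFinD -!(boxintE p f I Hf HI) -[X in (X <= _)%E]U.
  by apply: (boxint_le_fock p f I Hf HI); apply: measurableU; exact: measurable_box.
by rewrite lee_fin => /RleP H; change (boxint p f 1 z + boxint p f (INR n) 0%C <= I) in H; lra.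
Qed.

Lemma fock_decay p f eps : 0 < p -> in_Fock p f -> 0 < eps ->
  exists r, forall z, r < Cmod z -> gv f z < eps.
Proof.
move=> p0 HF e0; have [K [K0 HK]] := dens_box_bound p p0.
have [Hf [I [I0 HI]]] := in_Fock_finite p f HF.
have ep := rpow_gt0 eps p e0.
have [r Hr] := fock_tail p f (rpow eps p / (2 * K)) HF ltac:(apply: Rdiv_lt_0_compat; lra).
exists r => z /Hr Hz; apply: Rnot_le_lt => Hge.
have H1 : dens p f z <= K * boxint p f 1 z.
  by apply: HK => //; rewrite (boxintE p f I Hf HI); exact: lexx.
have H2 : rpow eps p <= dens p f z by rewrite dens_gv; apply: rpow_le; lra.
have : K * boxint p f 1 z <= K * (rpow eps p / (2 * K)) by apply: Rmult_le_compat_l; lra.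
rewrite (_ : K * (rpow eps p / (2 * K)) = rpow eps p / 2); last by field; lra.
lra.
Qed.

Lemma Cmod_gv f z : Cmod (f z) = gv f z * exp (Cmod z ^ 2 / 2).
Proof.
rewrite /gv Rmult_assoc -exp_plus (_ : - (Cmod z ^ 2 / 2) + Cmod z ^ 2 / 2 = 0); last by ring.
by rewrite exp_0; ring.
Qed.

Lemma deriv_gv_bound f w m : entire f -> (forall v, Cmod (v - w) <= 1 -> gv f v <= m) ->
  gv (Cderiv f) w <= 2 * exp (3 / 2) * m * (1 + Cmod w).
Proof.
move=> Hf Hm.
have H : Cmod (Cderiv f w) <= 2 * exp (3 / 2) * m * ((1 + Cmod w) * exp (Cmod w ^ 2 / 2)).
  apply: deriv_gauss_bound => // v /Hm H; rewrite Cmod_gv.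
  by apply: Rmult_le_compat_r => //; apply: Rlt_le; exact: exp_pos.
rewrite Cmod_gv -Rmult_assoc in H.
exact: Rmult_le_reg_r (exp_pos _) H.
Qed.

(** The reproducing kernel of the Hilbert case [p = 2], normalised so that [gv (fker w)] is a
    Gaussian centred at [w]; hence its norm is bounded uniformly in [w] for every [p]. *)
Definition fker (w z : C) : C := cexp (Cconj w * z - RtoC (Cmod w ^ 2 / 2)).

Lemma cdiff_fker w z : cdiff (fker w) z (Cconj w * fker w z).
Proof.
apply: (cdiff_eq _ _ ((Cconj w * 1 - 0) * fker w z)%C); first by ring.
apply: (cdiff_comp cexp (fun z => Cconj w * z - RtoC (Cmod w ^ 2 / 2))%C); first exact: cdiff_cexp.
apply: cdiff_minus; last exact: cdiff_const.
apply: cdiff_scal; exact: cdiff_id.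
Qed.

Lemma entire_fker w : entire (fker w).
Proof. by apply: entireP => z; exact: cdiff_fker. Qed.

Lemma gv_fker w z : gv (fker w) z = exp (- (/ 2 * Cmod (z - w) ^ 2)).
Proof.
rewrite /gv /fker Cmod_cexp -exp_plus; congr exp.
rewrite !Cmod2_fst_snd; case: z => x y; case: w => u v.
by rewrite /Cconj /Cmult /Cminus /Cplus /Copp /RtoC /=; field.
Qed.

Lemma fock_integral_fker p : 0 < p -> exists J, forall w, (fock_integral p (fker w) <= J%:E)%E.
Proof.
move=> p0; pose k := (1 + / (p / 2)) ^ 2.
(* The null second term fits the two-term shape of [integral_lin2_le]. *)
exists (k * 16 + 0 * 16) => w; rewrite fock_integralE.
have k0 : 0 <= k by exact: pow2_ge_0.
apply: (integral_lin2_le (dens p (fker w)) (qker w) (qker w) k 0%real 16%real 16%real) => //;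
  try exact: integral_qker; try exact: rmeas_qker; try (by move=> z; apply: Rlt_le; exact: qker_gt0).
- exact: rmeas_dens (entire_fker w).
- by move=> z; exact: dens_ge0.
- exact: Rle_refl.
move=> z; rewrite Rmult_0_l Rplus_0_r dens_gv gv_fker rpow_exp.
rewrite (_ : p * - (/ 2 * Cmod (z - w) ^ 2) = - (p / 2 * Cmod (z - w) ^ 2)); last by field.
by apply: gauss_qker; lra.
Qed.

Lemma fock_integral_id p : 0 < p -> exists J, (fock_integral p (fun z => z) <= J%:E)%E.
Proof.
move=> p0; pose k := rpow 2 p * (1 + / (p / 4)) ^ 2.
exists (k * 16 + 0 * 16); rewrite fock_integralE.
have k0 : 0 <= k by apply: Rmult_le_pos; [exact: rpow_ge0 | exact: pow2_ge_0].
apply: (integral_lin2_le (dens p (fun z => z)) (qker 0%C) (qker 0%C) k 0%real 16%real 16%real) => //;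
  try exact: integral_qker; try exact: rmeas_qker; try (by move=> z; apply: Rlt_le; exact: qker_gt0).
- exact: rmeas_dens entire_id.
- by move=> z; exact: dens_ge0.
- exact: Rle_refl.
move=> z; rewrite Rmult_0_l Rplus_0_r dens_gv /k Rmult_assoc.
have G := gauss_qker (p / 4) 0%C z ltac:(lra).
apply: Rle_trans (Rmult_le_compat_l _ _ _ (rpow_ge0 2 p) G).
rewrite (_ : (z - 0)%C = z); last by ring.
have -> : exp (- (p / 4 * Cmod z ^ 2)) = rpow (exp (- (Cmod z ^ 2 / 4))) p by rewrite rpow_exp; congr exp; field.
rewrite -rpow_mul; [|lra|by apply: Rlt_le; exact: exp_pos].
apply: rpow_le; [lra | exact: gv_ge0|].
rewrite /gv; have H := le_exp_half_sq (Cmod z / 2) ltac:(have := Cmod_ge_0 z; lra).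
have H2 : exp ((Cmod z / 2 * (Cmod z / 2) - 1) / 2) <= exp (Cmod z ^ 2 / 4).
  by apply: exp_le_mono; have := pow2_ge_0 (Cmod z); nra.
have e0 := exp_pos (- (Cmod z ^ 2 / 2)).
have -> : exp (- (Cmod z ^ 2 / 4)) = exp (Cmod z ^ 2 / 4) * exp (- (Cmod z ^ 2 / 2)).
  by rewrite -exp_plus; congr exp; field.
rewrite -Rmult_assoc; apply: Rmult_le_compat_r; lra.
Qed.

(** * Montel's theorem *)

Section ultralimits.
Variable G : set_system nat.
Hypothesis UG : UltraFilter G.

Let ultra_or (A : set nat) : G A \/ G (~` A).
Proof. exact: in_ultra_setVsetC. Qed.

Lemma ultra_ex (A : set nat) : G A -> exists n, A n.
Proof. by move=> /filter_ex [n An]; exists n. Qed.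

(** The limit is the supremum of the levels that [u] reaches along [G]; the ultrafilter dichotomy
    bounds [u] from above. *)
Lemma ultra_limR (u : nat -> R) B : (forall n, Rabs (u n) <= B) ->
  exists l, forall eps, 0 < eps -> G [set n | Rabs (u n - l) < eps].
Proof.
move=> HB.
have GT : G setT by exact: filterT.
pose E x := G [set n | x <= u n].
have [||l [ub lub]] := completeness E.
- exists B => x /ultra_ex [n Hn]; have := HB n; have := Rle_abs (u n); rewrite /= in Hn; lra.
- exists (- B); apply: filterS GT => n _ /=.
  by have /Rabs_le_between := HB n; lra.
exists l => eps e0.
have H1 : G [set n | l - eps < u n].
  have [x [Ex Hx]] : exists x, E x /\ l - eps < x.
    apply: NNPP => Hno.
    have : l <= l - eps by apply: lub => x Ex; apply: Rnot_lt_le => H; apply: Hno; exists x.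
    lra.
  by apply: filterS Ex => n /= H; lra.
have H2 : G [set n | u n < l + eps].
  case: (ultra_or [set n | l + eps / 2 <= u n]) => [/ub|]; first lra.
  by apply: filterS => n /= H; have := Rnot_le_lt _ _ H; lra.
apply: filterS (filterI H1 H2) => n [/= A1 A2].
by apply: Rabs_def1; lra.
Qed.

Lemma ultra_limC (u : nat -> C) B : (forall n, Cmod (u n) <= B) ->
  exists l, forall eps, 0 < eps -> G [set n | Cmod (u n - l) < eps].
Proof.
move=> HB.
have [l1 H1] := ultra_limR (fun n => fst (u n)) B (fun n => Rle_trans _ _ _ (Rabs_fst_Cmod _) (HB n)).
have [l2 H2] := ultra_limR (fun n => snd (u n)) B (fun n => Rle_trans _ _ _ (Rabs_snd_Cmod _) (HB n)).
exists (l1, l2) => eps e0.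
have e2 : 0 < eps / 2 by lra.
apply: filterS (filterI (H1 _ e2) (H2 _ e2)) => n [/= A1 A2].
apply: Rle_lt_trans (Cmod_le_Rabs _) _.
by change (Rabs (fst (u n) - l1) + Rabs (snd (u n) - l2) < eps); lra.
Qed.

Variable fn : nat -> C -> C.
Hypothesis Hfn : forall n, entire (fn n).
Hypothesis Hloc : forall r, exists B, forall n z, Cmod z <= r -> Cmod (fn n z) <= B.

(* Limits along an ultrafilter exist pointwise for all [z] at once, which replaces the
   diagonal extraction. *)
Lemma montel_ultra : exists f, entire f /\ forall r eps, 0 < eps ->
  G [set n | forall z, Cmod z <= r -> Cmod (fn n z - f z) < eps].
Proof.
have Hl z : exists l, forall eps, 0 < eps -> G [set n | Cmod (fn n z - l) < eps].
  have [B HB] := Hloc (Cmod z).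
  by apply: (ultra_limC (fun n => fn n z) B) => n; apply: HB; exact: Rle_refl.
have [f Hf] := boolp.choice Hl.
have Hl' z : exists l, forall eps, 0 < eps -> G [set n | Cmod (Cderiv (fn n) z - l) < eps].
  have [B HB] := Hloc (Cmod z + 3).
  apply: (ultra_limC (fun n => Cderiv (fn n) z) (2 * B)) => n.
  by apply: (deriv_local_bound (fn n) (Cmod z) B (Hfn n) (HB n)); lra.
have [g Hg] := boolp.choice Hl'.
exists f; split.
  apply: (entireP f g) => z eps e0.
  have [B HB] := Hloc (Cmod z + 3).
  have B0 : 0 <= B by apply: Rle_trans (Cmod_ge_0 _) (HB 0%N 0%C _); rewrite Cmod_0; have := Cmod_ge_0 z; lra.
  exists (Rmin 1 (eps / (4 * B + 1))); split.
    by apply: Rmin_glb_lt; [lra | apply: Rdiv_lt_0_compat; lra].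
  move=> w Hw.
  have H1 := Rlt_le_trans _ _ _ Hw (Rmin_l _ _).
  have H2 : Cmod (w - z) * (4 * B + 1) < eps.
    by apply/Rlt_div_r; [lra | exact: Rlt_le_trans Hw (Rmin_r _ _)].
  set h := (w - z)%C in H1 H2 *.
  have Ew : w = (z + h)%C by rewrite /h; ring.
  have h0 := Cmod_ge_0 h.
  apply: Rle_trans (_ : 4 * B * (Cmod h * Cmod h) <= _); last nra.
  apply: le_epsilon => eta et0.
  have et4 : 0 < eta / 4 by lra.
  have [n [[N1 N2] N3]] := ultra_ex _ (filterI (filterI (Hf w _ et4) (Hf z _ et4)) (Hg z _ et4)).
  have T := taylor_local (fn n) (Cmod z) B (Hfn n) (HB n) z h (Rle_refl _) (Rlt_le _ _ H1).
  rewrite -Ew in T.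
  have -> : (f w - f z - g z * h = (fn n w - fn n z - Cderiv (fn n) z * h) + - (fn n w - f w) + (fn n z - f z)
     + (Cderiv (fn n) z - g z) * h)%C by ring.
  have := Cmod_triangle (fn n w - fn n z - Cderiv (fn n) z * h + - (fn n w - f w) + (fn n z - f z)) ((Cderiv (fn n) z - g z) * h).
  have := Cmod_triangle (fn n w - fn n z - Cderiv (fn n) z * h + - (fn n w - f w)) (fn n z - f z).
  have := Cmod_triangle (fn n w - fn n z - Cderiv (fn n) z * h) (- (fn n w - f w)).
  rewrite Cmod_opp (Cmod_mult (Cderiv (fn n) z - g z)).
  change (Cmod (fn n w - f w) < eta / 4) in N1; change (Cmod (fn n z - f z) < eta / 4) in N2.
  change (Cmod (Cderiv (fn n) z - g z) < eta / 4) in N3.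
  have : Cmod (Cderiv (fn n) z - g z) * Cmod h <= eta / 4 * 1.
    by apply: Rmult_le_compat; try lra; exact: Cmod_ge_0.
  lra.
move=> r eps e0.
have r0 := Rabs_pos r; have rr := Rle_abs r.
have [B HB] := Hloc (3 * Rabs r + 3 + 3).
have B0 : 0 <= B by apply: Rle_trans (Cmod_ge_0 _) (HB 0%N 0%C _); rewrite Cmod_0; lra.
(* Pointwise limits become uniform by bisection, [P] being the failure of uniform closeness on a
   square. The condition [Cmod z <= 3 * Rabs r] keeps the limit point of the bisection in the disc
   where [B] applies. *)
pose P x y s := ~ G [set n | forall z, x <= z.1 <= x + 2 * Rabs r * s -> y <= z.2 <= y + 2 * Rabs r * s ->
    Cmod z <= 3 * Rabs r -> Cmod (fn n z - f z) < eps].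
apply: NNPP => Hno.
have [||X [Y H]] := bisection (2 * Rabs r) (2 * Rabs r) (- Rabs r) (- Rabs r) P ltac:(lra) ltac:(lra).
- move=> HG; apply: Hno; apply: filterS HG => n /= HG z Hz.
  have /Rabs_le_between H1 := Rle_trans _ _ _ (Rabs_fst_Cmod z) Hz.
  have /Rabs_le_between H2 := Rle_trans _ _ _ (Rabs_snd_Cmod z) Hz.
  by apply: HG; change (- Rabs r <= fst z <= - Rabs r + 2 * Rabs r * 1) || change (- Rabs r <= snd z <= - Rabs r + 2 * Rabs r * 1) || idtac; lra.
- move=> x y s s0 HP; apply: NNPP => Hnot; apply: HP.
  have Q i j : (i = 0 \/ i = 1) -> (j = 0 \/ j = 1) -> G [set n | forall z,
      x + i * (2 * Rabs r * (s / 2)) <= z.1 <= x + i * (2 * Rabs r * (s / 2)) + 2 * Rabs r * (s / 2) ->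
      y + j * (2 * Rabs r * (s / 2)) <= z.2 <= y + j * (2 * Rabs r * (s / 2)) + 2 * Rabs r * (s / 2) ->
      Cmod z <= 3 * Rabs r -> Cmod (fn n z - f z) < eps].
    by move=> Hi Hj; apply: NNPP => HQ; apply: Hnot; exists i, j.
  have Q1 := Q 0 0 (or_introl erefl) (or_introl erefl).
  have Q2 := Q 0 1 (or_introl erefl) (or_intror erefl).
  have Q3 := Q 1 0 (or_intror erefl) (or_introl erefl).
  have Q4 := Q 1 1 (or_intror erefl) (or_intror erefl).
  apply: filterS (filterI (filterI Q1 Q2) (filterI Q3 Q4)) => n [[R1 R2] [R3 R4]] z Hz1 Hz2 Hz.
  case: (Rle_dec z.1 (x + 2 * Rabs r * (s / 2))) => Hu; case: (Rle_dec z.2 (y + 2 * Rabs r * (s / 2))) => Hv.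
  + by apply: R1 => //; lra.
  + by apply: R2 => //; lra.
  + by apply: R3 => //; lra.
  + by apply: R4 => //; lra.
have d0 : 0 < Rmin (/ (4 * Rabs r + 1)) (eps / 8 / ((2 * B + 1) * (4 * Rabs r + 1))).
  by apply: Rmin_glb_lt; [apply: Rinv_0_lt_compat; lra | apply: Rdiv_lt_0_compat; [lra | apply: Rmult_lt_0_compat; lra]].
have [x [y [s [[s0 sd] [HP [HX HY]]]]]] := H _ d0.
have s1 : s * (4 * Rabs r + 1) < 1.
  have /(Rmult_lt_compat_r (4 * Rabs r + 1)) := Rlt_le_trans _ _ _ sd (Rmin_l _ _).
  by rewrite Rinv_l; [apply; lra | lra].
have s2 : s * ((2 * B + 1) * (4 * Rabs r + 1)) < eps / 8.
  by apply/Rlt_div_r; [apply: Rmult_lt_0_compat; lra | exact: Rlt_le_trans sd (Rmin_r _ _)].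
have dist (z : C) : x <= z.1 <= x + 2 * Rabs r * s -> y <= z.2 <= y + 2 * Rabs r * s ->
    Cmod (z - (X, Y)) <= 4 * Rabs r * s.
  move=> H1 H2; apply: Rle_trans (Cmod_le_Rabs _) _.
  change (Rabs (z.1 - X) + Rabs (z.2 - Y) <= 4 * Rabs r * s).
  have : Rabs (z.1 - X) <= 2 * Rabs r * s by apply: Rabs_le; lra.
  have : Rabs (z.2 - Y) <= 2 * Rabs r * s by apply: Rabs_le; lra.
  lra.
apply: HP.
case: (Classical_Prop.classic (exists z : C, x <= z.1 <= x + 2 * Rabs r * s /\ y <= z.2 <= y + 2 * Rabs r * s /\ Cmod z <= 3 * Rabs r)); last first.
  move=> Hempty; have GT : G setT by exact: filterT.
  by apply: filterS GT => n _ z H1 H2 H3; exfalso; apply: Hempty; exists z.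
move=> [z0 [Hz1 [Hz2 Hz3]]].
have XY : Cmod (X, Y) <= 3 * Rabs r + 3 + 1.
  have := dist z0 Hz1 Hz2; rewrite Cmod_sub_sym => D.
  have Ec (c : C) : Cmod c = Cmod (c - z0 + z0) by congr Cmod; ring.
  rewrite (Ec (X, Y)).
  by apply: Rle_trans (Cmod_triangle _ _) _; nra.
have HB' n z : Cmod z <= (3 * Rabs r + 3) + 3 -> Cmod (fn n z) <= B by move=> ?; apply: HB.
have e4 : 0 < eps / 8 by lra.
apply: filterS (Hf (X, Y) _ e4) => n Hn z H1 H2 H3.
change (Cmod (fn n (X, Y) - f (X, Y)) < eps / 8) in Hn.
have D := dist z H1 H2.
set h := (z - (X, Y))%C in D.
have Ez : z = ((X, Y) + h)%C.
  have Ec (c d : C) : d = (c + (d - c))%C by ring.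
  exact: Ec.
have hs : 2 * B * Cmod h <= eps / 8.
  have : 2 * B * Cmod h <= 2 * B * (4 * Rabs r * s) by apply: Rmult_le_compat_l; lra.
  nra.
have h1 : Cmod h <= 1 by nra.
have L m : Cmod (fn m z - fn m (X, Y)) <= eps / 8.
  by apply: Rle_trans hs; rewrite Ez; apply: (local_lipschitz (fn m) (3 * Rabs r + 3) B (Hfn m) (HB' m)).
(* A second index [m], allowed to depend on [z], compares [f z] with [f (X, Y)]; the set of
   admissible [n] was fixed beforehand, from the behaviour at [(X, Y)] alone. *)
have [m [N1 N2]] := ultra_ex _ (filterI (Hf z _ e4) (Hf (X, Y) _ e4)).
change (Cmod (fn m z - f z) < eps / 8) in N1; change (Cmod (fn m (X, Y) - f (X, Y)) < eps / 8) in N2.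
have := Cmod_triangle (fn n z - fn n (X, Y) + (fn n (X, Y) - f (X, Y)) + - (fn m (X, Y) - f (X, Y)) + - (fn m z - fn m (X, Y))) (fn m z - f z).
have := Cmod_triangle (fn n z - fn n (X, Y) + (fn n (X, Y) - f (X, Y)) + - (fn m (X, Y) - f (X, Y))) (- (fn m z - fn m (X, Y))).
have := Cmod_triangle (fn n z - fn n (X, Y) + (fn n (X, Y) - f (X, Y))) (- (fn m (X, Y) - f (X, Y))).
have := Cmod_triangle (fn n z - fn n (X, Y)) (fn n (X, Y) - f (X, Y)).
rewrite !Cmod_opp.
set u1 := fn n (X, Y); set u2 := f (X, Y); set u3 := fn m (X, Y).
rewrite (_ : (fn n z - u1 + (u1 - u2) + - (u3 - u2) + - (fn m z - u3) + (fn m z - f z) = fn n z - f z)%C); last by ring.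
by have := L n; have := L m; rewrite -/u1 -/u2 -/u3 in N2 Hn *; lra.
Qed.
End ultralimits.

(** For an ultrafilter finer than the filter at infinity, every member meets every tail. So
    increasing indices can be picked with error below [/ INR k.+1] on the disc of radius [INR k]. *)
Lemma montel (fn : nat -> C -> C) : (forall n, entire (fn n)) ->
  (forall r, exists B, forall n z, Cmod z <= r -> Cmod (fn n z) <= B) ->
  exists (phi : nat -> nat) f, (forall n, (phi n < phi n.+1)%N) /\ entire f /\
    forall r eps, 0 < eps -> exists N, forall k, (N <= k)%coq_nat -> forall z, Cmod z <= r ->
      Cmod (fn (phi k) z - f z) < eps.
Proof.
move=> Hfn Hloc.
have [G [UG HG]] := @ultraFilterLemma _ \oo _.
have [f [Hf Hlim]] := montel_ultra G UG fn Hfn Hloc.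
have step (kN : nat * nat) : exists n, (kN.2 < n)%N /\ forall z, Cmod z <= INR kN.1 -> Cmod (fn n z - f z) < / INR kN.1.+1.
  have e0 : 0 < / INR kN.1.+1 by apply: Rinv_0_lt_compat; exact: lt_0_INR (Nat.lt_0_succ _).
  have GN : G [set n | (kN.2 < n)%N] by apply: HG; exists kN.2.+1.
  have [n [H1 H2]] := ultra_ex G UG _ (filterI GN (Hlim (INR kN.1) _ e0)).
  by exists n.
have [nx Hnx] := boolp.choice step.
pose phi := fix phi k := if k is k'.+1 then nx (k, phi k') else nx (0%N, 0%N).
have Hphi k : forall z, Cmod z <= INR k -> Cmod (fn (phi k) z - f z) < / INR k.+1.
  by case: k => [|k]; [exact: (Hnx (0%N, 0%N)).2 | exact: (Hnx (k.+1, phi k)).2].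
exists phi, f; split; [|split] => //.
  by move=> n; exact: (Hnx (n.+1, phi n)).1.
move=> r eps e0.
have [N1 [HN1 HN1']] := archimed_cor1 eps e0.
have [N2 HN2] := INR_unbounded r.
exists (N1 + N2)%coq_nat => k Hk z Hz.
have k1 : INR N1 <= INR k by apply: le_INR; lia.
have k2 : INR N2 <= INR k by apply: le_INR; lia.
apply: Rlt_trans (Hphi k z _) _; first lra.
apply: Rle_lt_trans HN1; apply: Rinv_le_contravar; first exact: lt_0_INR.
by rewrite S_INR; lra.
Qed.

Lemma fock_integral_le_of_boxes p f J : entire f ->
  (forall n, (\int[area]_(z in box (RtoC 0) (INR n)) (dens p f z)%:E <= J%:E)%E) -> (fock_integral p f <= J%:E)%E.
Proof.
move=> Hf HJ.
pose F (n : nat) : set plane := box 0%C (INR n).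
have md := rmeas_EFin setT _ (rmeas_dens p f Hf).
have d0 (z : plane) : (0 <= (dens p f z)%:E)%E by rewrite lee_fin; apply/RleP; exact: dens_ge0.
have nF : nondecreasing_seq F.
  move=> m n mn; apply/subsetPset => -[x y] /boxE [H1 H2]; apply/boxE.
  have H : INR m <= INR n by apply: le_INR; apply/ssrnat.leP.
  by split; [apply: Rle_trans H1 H | apply: Rle_trans H2 H].
have UF : \bigcup_n F n = setT.
  apply/seteqP; split => // -[x y] _.
  have [n Hn] := INR_unbounded (Rabs x + Rabs y).
  exists n => //; apply/boxE => /=; rewrite !Rminus_0_r.
  by have := Rabs_pos x; have := Rabs_pos y; split; lra.
have cv := @ge0_nondecreasing_set_cvg_integral _ _ _ F (fun z => (dens p f z)%:E) planar_area nF
  (fun n => measurable_box _ _) (fun n => measurable_funTS md) (fun n z _ => d0 z).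
rewrite UF in cv.
by rewrite fock_integralE; apply: (cvge_le _ cv); apply: nearW => n; exact: HJ.
Qed.

Lemma dens_sum_le p f g h : 0 < p -> (forall z, Cmod (h z) <= Cmod (f z) + Cmod (g z)) ->
  forall z, dens p h z <= rpow 2 p * dens p f z + rpow 2 p * dens p g z.
Proof.
move=> p0 H z; rewrite !dens_gv -Rmult_plus_distr_l.
apply: Rle_trans (rpow_sum _ _ p p0 (gv_ge0 _ _) (gv_ge0 _ _)).
apply: rpow_le; [lra | exact: gv_ge0|].
rewrite /gv -Rmult_plus_distr_r; apply: Rmult_le_compat_r => //.
by apply: Rlt_le; exact: exp_pos.
Qed.

Lemma fock_integral_sum_le p f g h I J : 0 < p -> entire f -> entire g -> entire h ->
  (forall z, Cmod (h z) <= Cmod (f z) + Cmod (g z)) ->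
  (fock_integral p f <= I%:E)%E -> (fock_integral p g <= J%:E)%E ->
  (fock_integral p h <= (rpow 2 p * I + rpow 2 p * J)%real%:E)%E.
Proof.
move=> p0 Hf Hg Hh H HI HJ; rewrite fock_integralE.
have c0 := rpow_ge0 2 p.
apply: (integral_lin2_le _ (dens p f) (dens p g)) => //;
  try (exact: rmeas_dens); try (by move=> z; exact: dens_ge0).
exact: dens_sum_le.
Qed.

(** A weak form of Fatou's lemma. On each box uniform convergence makes the density of the error at
    most [/ (a + 1)], where [a] is the area, so it integrates to at most 1 whatever the box. *)
Lemma fock_closed p (g : nat -> C -> C) f J : 0 < p -> (forall n, entire (g n)) -> entire f ->
  (forall n, (fock_integral p (g n) <= J%:E)%E) ->
  (forall r eps, 0 < eps -> exists N, forall k, (N <= k)%coq_nat -> forall z, Cmod z <= r ->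
      Cmod (g k z - f z) < eps) ->
  (fock_integral p f <= (rpow 2 p * (J + 1))%real%:E)%E.
Proof.
move=> p0 Hg Hf HJ Hlim; apply: fock_integral_le_of_boxes => // n.
set a := 4 * (INR n * INR n).
have n0 := pos_INR n.
have a0 : 0 <= a by rewrite /a; nra.
have c0 := rpow_ge0 2 p.
have [d [d0 Hd]] := rpow_small p (/ (a + 1)) p0 ltac:(apply: Rinv_0_lt_compat; lra).
have [N HN] := Hlim (2 * INR n) d d0.
have {}HN := HN N (le_n N).
have Hle : (\int[area]_(z in box (RtoC 0) (INR n)) (dens p (g N) z)%:E <= J%:E)%E.
  apply: le_trans (HJ N); rewrite fock_integralE; apply: ge0_subset_integral => //.
  - exact: measurable_box.
  - exact: rmeas_EFin (rmeas_dens p _ (Hg N)).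
  - by move=> z _; rewrite lee_fin; apply/RleP; exact: dens_ge0.
have := integral_affine_le (box 0%C (INR n)) (dens p f) (dens p (g N)) (rpow 2 p * / (a + 1)) (rpow 2 p) a J
  (measurable_box _ _) (area_box _ _ n0) (rmeas_dens p f Hf) (rmeas_dens p _ (Hg N)) (dens_ge0 p f) (dens_ge0 p _) _ c0 _ Hle.
have ai : 0 < / (a + 1) by apply: Rinv_0_lt_compat; lra.
move=> H; apply: le_trans (H _ _) _.
- by apply: Rmult_le_pos; lra.
- move=> [x y] /boxE [H1 H2]; set z : C := (x, y).
  have Hz : Cmod z <= 2 * INR n.
    apply: Rle_trans (Cmod_le_Rabs z) _; change (Rabs x + Rabs y <= 2 * INR n).
    change (Rabs (x - 0) <= INR n) in H1; change (Rabs (y - 0) <= INR n) in H2.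
    by rewrite !Rminus_0_r in H1 H2; lra.
  have D := dens_sum_le p (fun z => g N z - f z)%C (g N) f p0 _ z.
  apply: Rle_trans (D _) _.
    move=> w; have E : f w = (- (g N w - f w) + g N w)%C by ring.
    by rewrite {1}E; apply: Rle_trans (Cmod_triangle _ _) _; rewrite Cmod_opp; exact: Rle_refl.
  apply: Rplus_le_compat_r; apply: Rmult_le_compat_l => //.
  rewrite dens_gv; apply: Rlt_le; apply: Hd; split; first exact: gv_ge0.
  apply: Rle_lt_trans (HN z Hz); rewrite /gv.
  rewrite -[X in _ <= X]Rmult_1_r; apply: Rmult_le_compat_l; first exact: Cmod_ge_0.
  by rewrite -exp_0; apply: exp_le_mono; have := pow2_ge_0 (Cmod z); lra.
rewrite lee_fin; apply/RleP; rewrite Rmult_plus_distr_l Rmult_1_r.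
have : / (a + 1) * a <= 1 by rewrite Rmult_comm; apply/Rle_div_l; lra.
move=> Ha.
have : rpow 2 p * (/ (a + 1) * a) <= rpow 2 p * 1 by apply: Rmult_le_compat_l.
change (rpow 2 p * (/ (a + 1) * a) <= rpow 2 p * 1 -> rpow 2 p * / (a + 1) * a + rpow 2 p * J <= rpow 2 p * J + rpow 2 p); lra.
Qed.

(** * Continuity and essential bounds of the symbols *)

Lemma cont2P u : cont2 u <-> forall z : C, @Continuity.continuous C_UniformSpace R_UniformSpace u z.
Proof.
split=> H z.
- apply/filterlim_locally => eps; have [d [d0 Hd]] := H z eps (cond_pos eps).
  have s2 : 0 < sqrt 2 by apply: sqrt_lt_R0; lra.
  have d2 : 0 < d / sqrt 2 by apply: Rdiv_lt_0_compat.
  exists (mkposreal _ d2) => w Hw; apply: Hd.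
  have := C_NormedModule_mixin_compat2 _ _ _ Hw => /=.
  by have -> : sqrt 2 * (d / sqrt 2) = d by field; lra.
- move=> eps e0; have [d Hd] := proj1 (filterlim_locally u (u z)) (H z) (mkposreal eps e0).
  exists d; split; first exact: cond_pos.
  by move=> w Hw; apply: Hd; apply: C_NormedModule_mixin_compat1.
Qed.

Lemma cont2_const c : cont2 (fun=> c).
Proof. by move=> z e e0; exists 1; split; [lra | move=> w _; rewrite Rminus_diag Rabs_R0]. Qed.

Lemma cont2_mult u v : cont2 u -> cont2 v -> cont2 (fun z => u z * v z).
Proof.
move=> /cont2P Hu /cont2P Hv; apply/cont2P => z.
exact: (@Continuity.continuous_mult C_UniformSpace R_AbsRing u v z (Hu z) (Hv z)).
Qed.

Lemma cont2_minus u v : cont2 u -> cont2 v -> cont2 (fun z => u z - v z).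
Proof.
move=> /cont2P Hu /cont2P Hv; apply/cont2P => z.
exact: (@Continuity.continuous_minus C_UniformSpace R_AbsRing R_NormedModule u v z (Hu z) (Hv z)).
Qed.

Lemma cont2_comp (phi : R -> R) u : (forall z, Continuity.continuous phi (u z)) -> cont2 u -> cont2 (fun z => phi (u z)).
Proof.
move=> Hphi /cont2P Hu; apply/cont2P => z.
apply: (@Continuity.continuous_comp C_UniformSpace R_UniformSpace R_UniformSpace u phi z (Hu z)).
exact: Hphi.
Qed.

Lemma cont2_precomp u f : cont2 u -> entire f -> cont2 (fun z => u (f z)).
Proof.
move=> Hu Hf z eps /(Hu (f z)) [d [d0 Hd]].
have [d' [d'0 Hd']] := entire_ccont f z Hf d d0.
by exists d'; split=> // w /Hd' /Hd.
Qed.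

(** By continuity a point violating the bound has a whole box of violations around it, of positive
    area. *)
Lemma in_LinftyP M : cont2 M -> in_Linfty M -> exists K, forall z, Rabs (M z) <= K.
Proof.
move=> HM [K [A [mA A0 HA]]]; exists K => z0; apply: Rnot_lt_le => Hlt.
have [d [d0 Hd]] := HM z0 (Rabs (M z0) - K) ltac:(lra).
have sub : (box z0 (d / 4) `<=` A)%classic.
  move=> [x y] /boxE [H1 H2]; apply: HA => /=.
  have Hw : Cmod ((x, y) - z0) < d.
    apply: Rle_lt_trans (Cmod_le_Rabs _) _.
    change (Rabs (x - z0.1) + Rabs (y - z0.2) < d).
    change (Rabs (x - z0.1) <= d / 4) in H1; change (Rabs (y - z0.2) <= d / 4) in H2; lra.
  have := Hd _ Hw; have := Rabs_triang_inv (M z0) (M (x, y)); rewrite (Rabs_minus_sym (M z0)).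
  move=> B1 B2 B3; change (Rabs (M (x, y)) <= K) in B3; lra.
have : (planar_area (box z0 (d / 4)) <= planar_area A)%E.
  by apply: le_measure => //; rewrite inE //; exact: measurable_box.
rewrite [X in (_ <= X)%E]A0 [X in (X <= _)%E](area_box z0 (d / 4)); last lra.
by rewrite lee_fin => /RleP H; change (4 * (d / 4 * (d / 4)) <= 0) in H; nra.
Qed.

Lemma in_Linfty_of_bound M K : (forall z, Rabs (M z) <= K) -> in_Linfty M.
Proof. by move=> H; exists K; apply: aeW => z; exact: H. Qed.

Lemma vanishing_bounded M : cont2 M -> vanishes_at_infinity M -> exists K, forall z, Rabs (M z) <= K.
Proof.
move=> HM Hv; have [r Hr] := Hv 1 Rlt_0_1.
have r0 := Rabs_pos r.
have loc z : exists d B, 0 < d /\ forall w, Cmod (w - z) < d -> Rabs (M w) <= B.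
  have [d [d0 Hd]] := HM z 1 Rlt_0_1; exists d, (Rabs (M z) + 1); split=> // w Hw.
  have := Hd w Hw; have := Rabs_triang_inv (M w) (M z); lra.
have [K HK] := continuous_bounded_rect (fun z => Rabs (M z)) (- Rabs r) (- Rabs r) (2 * Rabs r) (2 * Rabs r)
  ltac:(lra) ltac:(lra) loc.
exists (Rmax K 1) => z; case: (Rlt_le_dec r (Cmod z)) => Hz.
  by apply: Rle_trans (Rlt_le _ _ (Hr z Hz)) (Rmax_r _ _).
apply: Rle_trans (Rmax_l _ _); rewrite [z]surjective_pairing; apply: HK.
- have := Rle_trans _ _ _ (Rabs_fst_Cmod z) (Rle_trans _ _ _ Hz (Rle_abs r)).
  by move=> /Rabs_le_between; lra.
- have := Rle_trans _ _ _ (Rabs_snd_Cmod z) (Rle_trans _ _ _ Hz (Rle_abs r)).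
  by move=> /Rabs_le_between; lra.
Qed.

Lemma cint0_minus f g z : entire f -> entire g ->
  cint0 (fun w => f w - g w)%C z = (cint0 f z - cint0 g z)%C.
Proof.
move=> Hf Hg.
have C1 u t : entire u -> ccontinuous (fun t => u (RtoC t * z) * z)%C t.
  by move=> Hu; apply: rc_mult; [exact: rc_ray | exact: rc_const].
rewrite /cint0 -[RHS]CI_minus; [|by move=> t; exact: C1|by move=> t; exact: C1].
by apply: CI_ext => t; ring.
Qed.

Lemma extraction_ge (phi : nat -> nat) : (forall n, (phi n < phi n.+1)%N) -> forall n, (n <= phi n)%N.
Proof.
by move=> Hphi; elim=> [|n IH]; [exact: leq0n | exact: leq_ltn_trans IH (Hphi n)].
Qed.

(** * Boundedness and compactness of the integral operators *)

(* [D] is the identity for [Vop] and the derivative for [Jop]; [om w] is the order of the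
   norm of the evaluation [f |-> gv (D f) w]. *)
Section operator.
Variables (D : (C -> C) -> C -> C) (om : C -> R) (gam psi : C -> C) (p q : R).
Hypotheses (p0 : 0 < p) (pq : p <= q).
Hypothesis entire_D : forall f, entire f -> entire (D f).
Hypothesis D_minus : forall f g, entire f -> entire g -> forall z, D (fun z => f z - g z)%C z = (D f z - D g z)%C.
Hypotheses (om_ge1 : forall w, 1 <= om w) (om_cont : cont2 om).
Hypothesis D_local : exists k, 0 < k /\ forall f w m, entire f ->
  (forall v, Cmod (v - w) <= 1 -> gv f v <= m) -> gv (D f) w <= k * m * om w.
Hypothesis D_test : exists B c, 0 < c /\ forall w, exists f,
  in_Fock p f /\ fock_norm p f <= B /\ c * om w <= gv (D f) w.
Hypotheses (entire_gam : entire gam) (entire_psi : entire psi).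
Hypotheses (gam_neq0 : exists z, gam z <> 0%C) (psi_nonconst : nonconstant psi).

Definition integrand f w : C := (D f (psi w) * gam w)%C.
Definition volterra f : C -> C := cint0 (integrand f).
Definition symbol z : R :=
  Cmod (gam z) * om (psi z) / (1 + Cmod z) * exp (/ 2 * (Cmod (psi z) ^ 2 - Cmod z ^ 2)).
(** Divided by [om] so that [D_local] bounds it from above and [D_test] from below, uniformly in
    [z]. *)
Definition gvd f z : R := gv (D f) (psi z) / om (psi z).

Let q_gt0 : 0 < q. Proof. by lra. Qed.

Lemma om_gt0 w : 0 < om w. Proof. by have := om_ge1 w; lra. Qed.

Lemma entire_integrand f : entire f -> entire (integrand f).
Proof.
by move=> Hf; apply: entire_mult => //; apply: (entire_comp (D f) psi) => //; exact: entire_D.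
Qed.

Lemma entire_volterra f : entire f -> entire (volterra f).
Proof. by move=> Hf; apply: entire_cint0; exact: entire_integrand. Qed.

Lemma symbol_ge0 z : 0 <= symbol z.
Proof.
have := Cmod_ge_0 z; have := om_gt0 (psi z); have := Cmod_ge_0 (gam z) => h1 h2 h3.
apply: Rmult_le_pos; last by apply: Rlt_le; exact: exp_pos.
by apply: Rle_mult_inv_pos; [apply: Rmult_le_pos; lra | lra].
Qed.

Lemma gvd_ge0 f z : 0 <= gvd f z.
Proof. by apply: Rle_mult_inv_pos; [exact: gv_ge0 | exact: om_gt0]. Qed.

Lemma Cmod_integrand f z :
  Cmod (integrand f z) = gvd f z * symbol z * ((1 + Cmod z) * exp (Cmod z ^ 2 / 2)).
Proof.
rewrite /integrand Cmod_mult /gvd /symbol Cmod_gv.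
have := Cmod_ge_0 z; have := om_gt0 (psi z) => h1 h2.
have -> : exp (Cmod (psi z) ^ 2 / 2) = exp (/ 2 * (Cmod (psi z) ^ 2 - Cmod z ^ 2)) * exp (Cmod z ^ 2 / 2).
  by rewrite -exp_plus; congr exp; field.
field; lra.
Qed.

Lemma symbol_le_gv f z m : entire f -> (forall v, Cmod (v - z) <= 1 -> gv (volterra f) v <= m) ->
  gvd f z * symbol z <= 2 * exp (3 / 2) * m.
Proof.
move=> Hf /(deriv_gv_bound _ _ _ (entire_volterra f Hf)).
rewrite {1}/gv (cdiff_Cderiv _ _ _ (cdiff_cint0 _ z (entire_integrand f Hf))) Cmod_integrand.
have z0 := Cmod_ge_0 z.
rewrite !Rmult_assoc -exp_plus (_ : Cmod z ^ 2 / 2 + - (Cmod z ^ 2 / 2) = 0); last by ring.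
rewrite exp_0 Rmult_1_r -!Rmult_assoc => H.
by apply: Rmult_le_reg_r H; lra.
Qed.

Lemma symbol_bounded : bounded_op p q volterra -> exists K, forall z, symbol z <= K.
Proof.
move=> [HT [K HK]]; have [B [c [c0 Ht]]] := D_test.
have [Kq [Kq0 HKq]] := gv_le_norm q q_gt0.
exists (2 * exp (3 / 2) * (Kq * (Rmax K 0 * B)) / c) => z.
have [f [Ff [fB fc]]] := Ht (psi z).
have Kn : K * fock_norm p f <= Rmax K 0 * B.
  apply: Rle_trans (Rmult_le_compat_l _ _ _ (Rmax_r K 0) fB).
  exact: Rmult_le_compat_r (fock_norm_ge0 p f) (Rmax_l K 0).
have H := symbol_le_gv f z (Kq * (Rmax K 0 * B)) (proj1 Ff) _.
have {}H : gvd f z * symbol z <= 2 * exp (3 / 2) * (Kq * (Rmax K 0 * B)).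
  apply: H => v _; apply: Rle_trans (HKq _ v (HT f Ff)) _.
  by apply: Rmult_le_compat_l; [lra | apply: Rle_trans (HK f Ff) Kn].
apply (proj1 (Rle_div_r (symbol z) _ _ c0)); apply: Rle_trans H; rewrite Rmult_comm.
apply: Rmult_le_compat_r (symbol_ge0 z) _.
by apply (proj1 (Rle_div_r c _ _ (om_gt0 (psi z)))).
Qed.

(** Since [om >= 1], dropping it from the symbol leaves the hypothesis of [weighted_affine]; a zero
    slope would make [psi] constant. *)
Lemma symbol_affine K : (forall z, symbol z <= K) ->
  exists a b : C, a <> 0%C /\ Cmod a <= 1 /\ psi = (fun z => a * z + b)%C.
Proof.
move=> HK; have [] := weighted_affine gam psi K entire_gam entire_psi _ gam_neq0.
  move=> z; have H := HK z; rewrite /symbol in H; have o1 := om_ge1 (psi z); have z0 := Cmod_ge_0 z.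
  have z1 : 0 < 1 + Cmod z by lra.
  apply (proj1 (Rle_div_l _ _ _ z1)).
  apply: Rle_trans H; rewrite /Rdiv !Rmult_assoc; apply: Rmult_le_compat_l; first exact: Cmod_ge_0.
  have i0 : 0 < / (1 + Cmod z) by apply: Rinv_0_lt_compat; lra.
  have e0 := exp_pos (/ 2 * (Cmod (psi z) ^ 2 - Cmod z ^ 2)).
  rewrite -[X in X <= _]Rmult_1_l [X in 1 * X]Rmult_comm; apply: Rmult_le_compat_r => //.
  by apply: Rlt_le; apply: Rmult_lt_0_compat.
move=> a [b [a1 Hab]]; exists a, b; split; last by split => //; apply/funext.
move=> a0; apply: psi_nonconst; exists b => z; rewrite Hab a0; ring.
Qed.

(** The radius 2 is one unit from [D_local] and one from the box in [dens_box_bound]. *)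
Lemma gvd_le_boxint : exists K, 0 < K /\ forall f z, in_Fock p f ->
  gvd f z <= K * rpow (boxint p f 2 (psi z)) (/ p).
Proof.
have [k [k0 Hk]] := D_local; have [K [K0 HK]] := dens_box_bound p p0.
exists (k * rpow K (/ p)); split; first by apply: Rmult_lt_0_compat => //; exact: rpow_gt0.
move=> f z Ff; have [Hf [I [I0 HI]]] := in_Fock_finite p f Ff.
apply/Rle_div_l; first exact: om_gt0.
rewrite (Rmult_assoc k) -rpow_mul; [|lra|exact: (boxint_ge0 p f I)].
apply: Hk => // v Hv.
rewrite -(rpow_inv (gv f v) p) //; last exact: gv_ge0.
apply: rpow_le; [by apply: Rlt_le; apply: Rinv_0_lt_compat | exact: rpow_ge0|].
rewrite -dens_gv; apply: Rle_trans (HK f v _ Hf _) _; first by rewrite (boxintE p f I Hf HI); exact: lexx.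
by apply: Rmult_le_compat_l; [lra | apply: (boxint_mono p f I Hf HI); lra].
Qed.

(** The disjunction serves two purposes. Boundedness takes for [eps] a bound of the symbol and
    [delta = 0]; in the compactness proof the symbol is small far out, while on the disc [gvd] is
    small by uniform convergence. *)
Lemma volterra_estimate K : (forall z, symbol z <= K) -> exists L, 0 < L /\ forall f I eps delta rho,
  in_Fock p f -> fock_integral p f = I%:E -> 0 <= eps -> 0 <= delta -> 0 <= rho ->
  (forall z, symbol z <= eps \/ Cmod z <= rho /\ gvd f z * symbol z <= delta) ->
  (fock_integral q (volterra f) <=
    (L * (rpow eps q * rpow I (q / p) + rpow delta q * (1 + (rho + 1) ^ 2) ^ 2))%real%:E)%E.
Proof.
move=> HK; have [a [b [a0 [a1 Hab]]]] := symbol_affine K HK.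
have [N [N0 HN]] := norm_estimate p q a b p0 pq a0 a1.
have [G [G0 HG]] := gvd_le_boxint.
exists (N * Rmax 1 (rpow G q)); split.
  by apply: Rmult_lt_0_compat => //; apply: Rlt_le_trans (Rmax_l _ _); lra.
move=> f I eps delta rho Ff HI e0 d0 r0 Hz.
have [Hf [I' [I0 HI']]] := in_Fock_finite p f Ff.
have {HI'}II : I' = I by move: HI'; rewrite HI => -[].
rewrite II {I' II} in I0.
apply: le_trans (HN f I (integrand f) (eps * G) delta rho Hf I0 HI _ _ d0 r0 _) _.
- exact: entire_integrand.
- by apply: Rmult_le_pos; lra.
- move=> z; rewrite Cmod_integrand; apply: Rmult_le_compat_r.
    by apply: Rmult_le_pos; [have := Cmod_ge_0 z; lra | apply: Rlt_le; exact: exp_pos].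
  have B0 : 0 <= eps * G * rpow (boxint p f 2 (a * z + b)%C) (/ p).
    by apply: Rmult_le_pos; [apply: Rmult_le_pos; lra | exact: rpow_ge0].
  have D0 : 0 <= (if Rle_dec (Cmod z) rho then delta else 0) by case: Rle_dec => _ /=; lra.
  case: (Hz z) => [H2 | [H1 H2]]; last by case: Rle_dec => //= _; lra.
  apply: Rle_trans (_ : eps * G * rpow (boxint p f 2 (a * z + b)%C) (/ p) <= _); last by lra.
  have H1 := HG f z Ff; rewrite [in boxint _ _ _ _]Hab in H1.
  rewrite Rmult_comm (Rmult_assoc eps).
  by apply: Rmult_le_compat => //; [exact: symbol_ge0 | exact: gvd_ge0].
rewrite lee_fin; apply/RleP.
rewrite rpow_mul; [|lra|lra].
have r1 := Rmax_l 1 (rpow G q); have r2 := Rmax_r 1 (rpow G q).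
have t1 : 0 <= rpow eps q * rpow I (q / p) by apply: Rmult_le_pos; exact: rpow_ge0.
have t2 : 0 <= rpow delta q * (1 + (rho + 1) ^ 2) ^ 2 by apply: Rmult_le_pos; [exact: rpow_ge0 | exact: pow2_ge_0].
change (N * (rpow eps q * rpow G q * rpow I (q / p) + rpow delta q * (1 + (rho + 1) ^ 2) ^ 2) <=
  N * Rmax 1 (rpow G q) * (rpow eps q * rpow I (q / p) + rpow delta q * (1 + (rho + 1) ^ 2) ^ 2)).
rewrite [X in _ <= X]Rmult_assoc; apply: Rmult_le_compat_l; first lra.
rewrite Rmult_plus_distr_l; apply: Rplus_le_compat.
  by rewrite (Rmult_comm (rpow eps q)) Rmult_assoc; apply: Rmult_le_compat_r.
by rewrite -{1}[rpow delta q * _]Rmult_1_l; apply: Rmult_le_compat_r.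
Qed.

Lemma bounded_of_symbol K : (forall z, symbol z <= K) -> bounded_op p q volterra.
Proof.
move=> HK; have [L [L0 HL]] := volterra_estimate K HK; have q0 := q_gt0.
have K0 : 0 <= K := Rle_trans _ _ _ (symbol_ge0 0%C) (HK 0%C).
have est f I : in_Fock p f -> fock_integral p f = I%:E ->
    (fock_integral q (volterra f) <= (L * (rpow K q * rpow I (q / p)))%real%:E)%E.
  move=> Ff HI; apply: le_trans (HL f I K 0 0 Ff HI K0 (Rle_refl 0) (Rle_refl 0) _) _.
    by move=> z; left.
  by rewrite rpow_0 ?Rmult_0_l ?Rplus_0_r; [exact: lexx | lra].
split=> [f Ff|].
  have [Hf [I [I0 HI]]] := in_Fock_finite p f Ff.
  exact: in_Fock_of_bound (entire_volterra f Hf) (est f I Ff HI).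
exists (rpow (q / (2 * PI) * (L * (rpow K q * rpow (2 * PI / p) (q / p)))) (1 / q)) => f Ff.
have [Hf [I [I0 HI]]] := in_Fock_finite p f Ff.
apply: Rle_trans (fock_norm_le_of_bound _ _ _ q0 (entire_volterra f Hf) (est f I Ff HI)) _.
apply: Req_le; have c0 := two_PI_ratio_gt0 q q0.
have c1 : 0 < 2 * PI / p by have := PI_RGT_0 => ?; apply: Rdiv_lt_0_compat; lra.
have n0 := fock_norm_ge0 p f.
rewrite {1}(fock_integral_of_norm p f I p0 I0 HI) (rpow_mul (2 * PI / p)); [|lra|exact: rpow_ge0].
rewrite rpow_rpow (_ : p * (q / p) = q); last by field; lra.
rewrite -{2}[fock_norm p f](rpow_inv _ q) // -[/ q]Rmult_1_l -/(1 / q) -rpow_mul.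
- by congr rpow; ring.
- apply: Rmult_le_pos; first lra.
  by apply: Rmult_le_pos; [lra | apply: Rmult_le_pos; exact: rpow_ge0].
- exact: rpow_ge0.
Qed.

Lemma cont2_symbol : cont2 symbol.
Proof.
have cm f : entire f -> cont2 (fun z => Cmod (f z)) by move=> Hf; apply: cont2_Cmod => z; exact: entire_ccont.
have sq f : entire f -> cont2 (fun z => Cmod (f z) ^ 2).
  move=> Hf; exact: cont2_mult (cm f Hf) (cont2_mult _ _ (cm f Hf) (cont2_const 1)).
have c1 : cont2 (fun z => / (1 + Cmod z)).
  apply: (cont2_comp (fun x => / (1 + x))) (cm _ entire_id) => z.
  have z0 := Cmod_ge_0 z.
  apply: (Coquelicot.Derive.ex_derive_continuous (fun x => / (1 + x))).
  by auto_derive; lra.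
have c2 : cont2 (fun z => exp (/ 2 * (Cmod (psi z) ^ 2 - Cmod z ^ 2))).
  apply: (cont2_comp (fun x => exp (/ 2 * x))).
    by move=> z; apply: (Coquelicot.Derive.ex_derive_continuous (fun x => exp (/ 2 * x))); auto_derive.
  exact: cont2_minus (sq _ entire_psi) (sq _ entire_id).
apply: cont2_mult c2; apply: cont2_mult c1; apply: cont2_mult; first exact: cm.
exact: cont2_precomp.
Qed.

Lemma in_Linfty_symbol : in_Linfty symbol <-> exists K, forall z, symbol z <= K.
Proof.
split=> [/(in_LinftyP _ cont2_symbol) [K HK] | [K HK]].
  by exists K => z; apply: Rle_trans (Rle_abs _) (HK z).
by apply: (in_Linfty_of_bound _ K) => z; rewrite Rabs_pos_eq //; exact: symbol_ge0.
Qed.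

Lemma volterra_bounded_iff : bounded_op p q volterra <-> in_Linfty symbol.
Proof.
split=> [/symbol_bounded /in_Linfty_symbol // | /in_Linfty_symbol [K]]; exact: bounded_of_symbol.
Qed.

(** Test functions taken at [psi (zn n)], for escaping points [zn n] with symbol at least [eps],
    have images whose weighted modulus is not small on the unit disc around [zn n]. The limit [h] of
    a subsequence of the images is small there by [fock_decay], so convergence in norm is
    contradicted. *)
Lemma symbol_vanishes : compact_op p q volterra -> vanishes_at_infinity symbol.
Proof.
move=> [HT Hc]; apply: NNPP => Hno; have q0 := q_gt0.
have [eps [e0 Heps]] : exists eps, 0 < eps /\ forall r, exists z, r < Cmod z /\ eps <= symbol z.
  apply: NNPP => H; apply: Hno => eps e0; apply: NNPP => H'; apply: H; exists eps; split=> // r.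
  apply: NNPP => H; apply: H'; exists r => z Hz; rewrite Rabs_pos_eq; last exact: symbol_ge0.
  by apply: Rnot_le_lt => H''; apply: H; exists z.
have [zn Hzn] := boolp.choice (fun n => Heps (INR n)).
have [B [c [c0 Ht]]] := D_test.
have [t Htn] := boolp.choice (fun n => Ht (psi (zn n))).
have [phi [h [Hphi [Hh Hlim]]]] := Hc t (fun n => proj1 (Htn n)) (ex_intro _ B (fun n => proj1 (proj2 (Htn n)))).
have [Kq [Kq0 HKq]] := gv_le_norm q q0.
have E0 := exp_pos (3 / 2).
(* Chosen so that the upper bound [2 * exp (3 / 2) * (eta + eta)] is half of the lower bound
   [c * eps]. *)
set eta := c * eps / (8 * exp (3 / 2)).
have eta0 : 0 < eta by apply: Rdiv_lt_0_compat; nra.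
have [r Hr] := fock_decay q h eta q0 Hh eta0.
have ek : 0 < eta / Kq by apply: Rdiv_lt_0_compat.
have [N HN] := proj2 (is_lim_seq_spec _ 0) Hlim (mkposreal _ ek).
have [n0 Hn0] := INR_unbounded (r + 1).
set k := maxn N n0; set z := zn (phi k); set T := volterra (t (phi k)).
have HN' : fock_norm q (fun z => T z - h z)%C < eta / Kq.
  have := HN k _; rewrite Rminus_0_r => /= H.
  by apply: Rle_lt_trans (Rle_abs _) (H _); apply/ssrnat.leP; exact: leq_maxl.
have Hz : r + 1 < Cmod z.
  apply: Rlt_trans Hn0 _; apply: Rle_lt_trans (proj1 (Hzn (phi k))).
  by apply: le_INR; apply/ssrnat.leP; apply: leq_trans (leq_maxr N n0) (extraction_ge phi Hphi k).
have HTk := HT _ (proj1 (Htn (phi k))).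
have HTh : in_Fock q (fun z => T z - h z)%C.
  have [HT1 [I1 [_ HI1]]] := in_Fock_finite q _ HTk; have [Hh1 [I2 [_ HI2]]] := in_Fock_finite q _ Hh.
  have HTe := entire_minus _ _ HT1 Hh1.
  apply: in_Fock_of_bound HTe (fock_integral_sum_le q T h _ I1 I2 q0 HT1 Hh1 HTe _ _ _).
  - by move=> w; apply: Rle_trans (Cmod_triangle _ _) _; rewrite Cmod_opp; exact: Rle_refl.
  - by rewrite HI1; exact: lexx.
  - by rewrite HI2; exact: lexx.
have H : gvd (t (phi k)) z * symbol z <= 2 * exp (3 / 2) * (eta + eta).
  apply: symbol_le_gv (proj1 (proj1 (Htn (phi k)))) _ => v Hv.
  have H1 : gv h v <= eta.
    apply: Rlt_le; apply: Hr.
    by have := Cmod_triangle v (z - v)%C; rewrite (Cmod_sub_sym z v) (_ : (v + (z - v))%C = z); [lra | ring].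
  have H2 : gv (fun z => T z - h z)%C v <= eta.
    apply: Rle_trans (HKq _ v HTh) _; rewrite Rmult_comm.
    by apply: Rlt_le; move/Rlt_div_r: HN' => HN'; exact: HN'.
  have H3 : gv T v <= gv (fun z => T z - h z)%C v + gv h v.
    rewrite /gv -Rmult_plus_distr_r; apply: Rmult_le_compat_r; first by apply: Rlt_le; exact: exp_pos.
    by apply: Rle_trans (Cmod_triangle _ _); rewrite (_ : (T v - h v + h v)%C = T v); [lra | ring].
  by change (gv T v <= eta + eta); lra.
have [_ [_ Hc2]] := Htn (phi k); have [_ Hs] := Hzn (phi k).
have H4 : c <= gvd (t (phi k)) z by apply (proj1 (Rle_div_r c _ _ (om_gt0 (psi z)))).
have H5 : c * eps <= gvd (t (phi k)) z * symbol z by apply: Rmult_le_compat => //; lra.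
have E : 2 * exp (3 / 2) * (eta + eta) = c * eps / 2 by rewrite /eta; field; lra.
nra.
Qed.

Lemma volterra_minus f g z : entire f -> entire g ->
  volterra (fun z => f z - g z)%C z = (volterra f z - volterra g z)%C.
Proof.
move=> Hf Hg; rewrite -cint0_minus; [|exact: entire_integrand|exact: entire_integrand].
by congr cint0; apply/funext => w; rewrite /integrand D_minus //; ring.
Qed.

Lemma compact_of_symbol : vanishes_at_infinity symbol -> compact_op p q volterra.
Proof.
move=> Hv; have q0 := q_gt0.
have [K HK] : exists K, forall z, symbol z <= K.
  have [K HK] := vanishing_bounded _ cont2_symbol Hv.
  by exists K => z; apply: Rle_trans (Rle_abs _) (HK z).
have K0 : 0 <= K := Rle_trans _ _ _ (symbol_ge0 0%C) (HK 0%C).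
have [HT _] := bounded_of_symbol K HK; split=> // fn Ffn [B HB].
have [L [L0 HL]] := volterra_estimate K HK.
have c1 : 0 < 2 * PI / p by have := PI_RGT_0 => ?; apply: Rdiv_lt_0_compat; lra.
set J := 2 * PI / p * rpow B p.
have HJ n : (fock_integral p (fn n) <= J%:E)%E.
  have [Hf [I [I0 HI]]] := in_Fock_finite p _ (Ffn n).
  rewrite HI lee_fin; apply/RleP; rewrite (fock_integral_of_norm p _ I p0 I0 HI).
  apply: Rmult_le_compat_l; first lra.
  by apply: rpow_le; [lra | exact: fock_norm_ge0 | exact: HB].
have [Kp [Kp0 HKp]] := gv_le_norm p p0.
have [phi [f [Hphi [Hf Hcv]]]] := montel fn (fun n => proj1 (Ffn n)) ltac:(
  move=> r; exists (Kp * B * exp (r ^ 2 / 2)) => n z Hz; rewrite Cmod_gv;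
  apply: Rmult_le_compat; [exact: gv_ge0 | by apply: Rlt_le; exact: exp_pos
    | by apply: Rle_trans (HKp _ z (Ffn n)) _; apply: Rmult_le_compat_l; [lra | exact: HB]
    | by apply: exp_le_mono; have := Cmod_ge_0 z; nra]).
have HfJ := fock_closed p (fun k => fn (phi k)) f J p0 (fun k => proj1 (Ffn (phi k))) Hf (fun k => HJ (phi k)) Hcv.
have Ff := in_Fock_of_bound _ _ _ Hf HfJ.
exists phi, (volterra f); split => //; split; first exact: HT.
pose d k z := (fn (phi k) z - f z)%C.
have Hd k : entire (d k) by exact: entire_minus (proj1 (Ffn (phi k))) Hf.
set J2 := rpow 2 p * J + rpow 2 p * (rpow 2 p * (J + 1)).
have HdJ k : (fock_integral p (d k) <= J2%:E)%E.
  apply: (fock_integral_sum_le p (fn (phi k)) f) => //; first exact: (proj1 (Ffn (phi k))).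
  by move=> w; apply: Rle_trans (Cmod_triangle _ _) _; rewrite Cmod_opp; exact: Rle_refl.
have Fd k := in_Fock_of_bound _ _ _ (Hd k) (HdJ k).
have -> : (fun k => fock_norm q (fun z => volterra (fn (phi k)) z - volterra f z)%C) =
    (fun k => fock_norm q (volterra (d k))).
  apply/funext => k; congr fock_norm; apply/funext => z; rewrite volterra_minus //.
  exact: (proj1 (Ffn (phi k))).
apply/is_lim_seq_spec => -[e0 he0] /=.
have [eta [eta0 Heta]] := rpow_small (1 / q) e0 ltac:(apply: Rdiv_lt_0_compat; lra) he0.
set A := q / (2 * PI) * L.
have A0 : 0 < A by apply: Rmult_lt_0_compat => //; exact: two_PI_ratio_gt0.
set X := rpow J2 (q / p); have X0 : 0 <= X by exact: rpow_ge0.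
(* The two terms of [volterra_estimate], times [A], each receive less than [eta / 2]: [e] is fixed
   first, then the radius [rho] beyond which the symbol is below [e], and only then [dl], which has
   to beat the factor [Y] depending on [rho]. *)
have h1 : 0 < eta / (2 * A * (X + 1)) by apply: Rdiv_lt_0_compat => //; apply: Rmult_lt_0_compat; lra.
have half x : 0 < x -> exists e, 0 < e /\ rpow e q < x.
  by move=> /(rpow_small q _ q0) [e [e1 He]]; exists (e / 2); split; [lra | apply: He; lra].
have [e [e1 He]] := half _ h1.
have [r Hr] := Hv e e1.
set rho := Rabs r; have rho0 : 0 <= rho by exact: Rabs_pos.
set Y := (1 + (rho + 1) ^ 2) ^ 2; have Y0 : 0 <= Y by exact: pow2_ge_0.
have h2 : 0 < eta / (2 * A * (Y + 1)) by apply: Rdiv_lt_0_compat => //; apply: Rmult_lt_0_compat; lra.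
have [dl [dl1 Hdl]] := half _ h2.
have [kp [kp0 Hkp]] := D_local.
have [S [S0 HS]] := entire_bounded psi rho entire_psi.
(* Closeness [m0] on the disc of radius [S + 1], which contains the unit discs of [D_local] around
   [psi z] for [|z| <= rho], gives [gvd <= dl / (K + 1)], hence [gvd * symbol <= dl]. *)
have m0 : 0 < dl / (kp * (K + 1)) by apply: Rdiv_lt_0_compat => //; apply: Rmult_lt_0_compat; lra.
have [N HN] := Hcv (S + 1) _ m0.
exists N => k /HN {}HN; rewrite Rminus_0_r Rabs_pos_eq; last exact: fock_norm_ge0.
have [_ [I [I0 HI]]] := in_Fock_finite p _ (Fd k).
have IJ : I <= J2 by have := HdJ k; rewrite HI lee_fin => /RleP.
have IX : rpow I (q / p) <= X.
  by apply: rpow_le => //; apply: Rlt_le; apply: Rdiv_lt_0_compat; lra.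
have est := HL (d k) I e dl rho (Fd k) HI (Rlt_le _ _ e1) (Rlt_le _ _ dl1) rho0 _.
apply: Rle_lt_trans (fock_norm_le_of_bound _ _ _ q0 (entire_volterra _ (Hd k)) (est _)) _.
- move=> z; case: (Rlt_le_dec rho (Cmod z)) => Hz.
    left; apply: Rle_trans (Rle_abs _) (Rlt_le _ _ (Hr z _)).
    by apply: Rle_lt_trans (Rle_abs r) Hz.
  right; split=> //.
  have H1 : gv (D (d k)) (psi z) <= kp * (dl / (kp * (K + 1))) * om (psi z).
    apply: Hkp => // v Hvz.
    have Hv' : Cmod v <= S + 1.
      have := Cmod_triangle (psi z) (v - psi z)%C; rewrite (_ : (psi z + (v - psi z))%C = v); last by ring.
      by have := HS z Hz; lra.
    have := HN v Hv'; rewrite -/(d k v) Cmod_gv => H.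
    apply: Rle_trans (Rlt_le _ _ H); rewrite -{1}[gv (d k) v]Rmult_1_r.
    apply: Rmult_le_compat_l; first exact: gv_ge0.
    by rewrite -exp_0; apply: exp_le_mono; have := pow2_ge_0 (Cmod v); lra.
  have H2 : gvd (d k) z <= dl / (K + 1).
    apply (proj2 (Rle_div_l _ _ _ (om_gt0 (psi z)))).
    by apply: Rle_trans H1 _; apply: Req_le; field; lra.
  apply: Rle_trans (Rmult_le_compat _ _ _ _ (gvd_ge0 _ z) (symbol_ge0 z) H2 (HK z)) _.
  have -> : dl / (K + 1) * K = dl * (K / (K + 1)) by field; lra.
  rewrite -{2}[dl]Rmult_1_r; apply: Rmult_le_compat_l; first lra.
  by apply/Rle_div_l; lra.
apply: Heta; split.
  apply: Rmult_le_pos; first by apply: Rlt_le; exact: two_PI_ratio_gt0.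
  apply: Rmult_le_pos; first lra.
  by apply: Rplus_le_le_0_compat; apply: Rmult_le_pos => //; exact: rpow_ge0.
rewrite -/Y -Rmult_assoc -/A.
have H1 : A * (rpow e q * rpow I (q / p)) <= eta / 2 * (X / (X + 1)).
  have -> : eta / 2 * (X / (X + 1)) = A * (eta / (2 * A * (X + 1)) * X) by field; lra.
  apply: Rmult_le_compat_l; first lra.
  by apply: Rmult_le_compat; [exact: rpow_ge0 | exact: rpow_ge0 | lra | exact: IX].
have H2 : A * (rpow dl q * Y) <= eta / 2 * (Y / (Y + 1)).
  have -> : eta / 2 * (Y / (Y + 1)) = A * (eta / (2 * A * (Y + 1)) * Y) by field; lra.
  apply: Rmult_le_compat_l; first lra.
  by apply: Rmult_le_compat_r => //; lra.
have lt1 x : 0 <= x -> x / (x + 1) < 1 by move=> x0; apply/Rlt_div_l; lra.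
have := lt1 X X0; have := lt1 Y Y0; rewrite Rmult_plus_distr_l; nra.
Qed.

Lemma volterra_compact_iff : compact_op p q volterra <-> vanishes_at_infinity symbol.
Proof. by split; [exact: symbol_vanishes | exact: compact_of_symbol]. Qed.
End operator.

(** * Test functions and specialisation to the two operators *)

Lemma Cderiv_neq0 g : entire g -> nonconstant g -> exists z, Cderiv g z <> 0%C.
Proof.
move=> Hg Hn; apply: NNPP => H; apply: Hn; exists (g 0%C) => z.
have := mean_value_ineq g 0%C z 0 Hg.
rewrite Rmult_0_l => /(_ _) H0; have {}H0 : Cmod (g z - g 0%C) <= 0.
  apply: H0 => w _; apply: Req_le.
  have -> : Cderiv g w = 0%C by apply: NNPP => Hw; apply: H; exists w.
  exact: Cmod_0.
have : (g z - g 0%C)%C = 0%C by apply: Cmod_eq_0; have := Cmod_ge_0 (g z - g 0%C)%C; lra.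
by move=> E; rewrite -[g z](_ : (g z - g 0 + g 0)%C = _); [rewrite E; ring | ring].
Qed.

Lemma fker_bounded p : 0 < p -> exists B, forall w, in_Fock p (fker w) /\ fock_norm p (fker w) <= B.
Proof.
move=> p0; have [J HJ] := fock_integral_fker p p0.
exists (rpow (p / (2 * PI) * J) (1 / p)) => w; split.
  exact: in_Fock_of_bound (entire_fker w) (HJ w).
exact: fock_norm_le_of_bound p0 (entire_fker w) (HJ w).
Qed.

Lemma gv_fker_diag w : gv (fker w) w = 1.
Proof.
rewrite gv_fker (_ : (w - w)%C = 0%C); last by ring.
by rewrite Cmod_0 (_ : - (/ 2 * 0 ^ 2) = 0) ?exp_0 //; ring.
Qed.

Lemma eval_test p : 0 < p -> exists B c, 0 < c /\ forall w, exists f,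
  in_Fock p f /\ fock_norm p f <= B /\ c * 1 <= gv f w.
Proof.
move=> /fker_bounded [B HB]; exists B, 1; split; first lra.
by move=> w; exists (fker w); have [H1 H2] := HB w; rewrite gv_fker_diag; do !split=> //; lra.
Qed.

(** The derivative of [fker w] at [w] is [Cconj w] times its value, which degenerates as [w] tends
    to 0; near the origin the identity function takes its place. *)
Lemma deriv_test p : 0 < p -> exists B c, 0 < c /\ forall w, exists f,
  in_Fock p f /\ fock_norm p f <= B /\ c * (1 + Cmod w) <= gv (Cderiv f) w.
Proof.
move=> p0; have [B HB] := fker_bounded p p0; have [J HJ] := fock_integral_id p p0.
have E0 := exp_pos (- / 2).
(* If [|w| < 1], then [1 + |w| <= 2] and the weight is at least [exp (- / 2)]; otherwise
   [|w| >= (1 + |w|) / 2]. One constant covers both cases. *)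
exists (Rmax B (rpow (p / (2 * PI) * J) (1 / p))), (exp (- / 2) / 2); split; first lra.
move=> w; have w0 := Cmod_ge_0 w; case: (Rlt_le_dec (Cmod w) 1) => Hw.
  exists (fun z => z); split; first exact: in_Fock_of_bound entire_id HJ.
  split; first exact: Rle_trans (fock_norm_le_of_bound _ _ _ p0 entire_id HJ) (Rmax_r _ _).
  rewrite /gv (cdiff_Cderiv _ _ _ (cdiff_id w)) Cmod_1 Rmult_1_l.
  have : exp (- / 2) <= exp (- (Cmod w ^ 2 / 2)) by apply: exp_le_mono; nra.
  nra.
exists (fker w); have [H1 H2] := HB w; split=> //; split; first exact: Rle_trans H2 (Rmax_l _ _).
have -> : gv (Cderiv (fker w)) w = Cmod w.
  rewrite -[RHS]Rmult_1_r -(gv_fker_diag w) /gv (cdiff_Cderiv _ _ _ (cdiff_fker w w)) Cmod_mult Cmod_conj.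
  by rewrite Rmult_assoc.
have : exp (- / 2) <= 1 by rewrite -exp_0; apply: exp_le_mono; lra.
nra.
Qed.

Lemma cont2_1_Cmod : cont2 (fun w => 1 + Cmod w).
Proof.
move=> z e e0; have [d [d0 Hd]] := cont2_Cmod (fun w => w) (fun z => entire_ccont _ z entire_id) z e e0.
exists d; split=> // w /Hd; by rewrite (_ : 1 + Cmod w - (1 + Cmod z) = Cmod w - Cmod z); last ring.
Qed.

Lemma Cderiv_minus f g : entire f -> entire g ->
  forall z, Cderiv (fun z => f z - g z)%C z = (Cderiv f z - Cderiv g z)%C.
Proof.
move=> /entire_cdiff Hf /entire_cdiff Hg z.
by apply: cdiff_Cderiv; exact: cdiff_minus (Hf z) (Hg z).
Qed.

Lemma symbol_Mgp g psi : symbol (fun=> 1) (Cderiv g) psi = Mgp g psi.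
Proof. by apply/funext => z; rewrite /symbol /Mgp Rmult_1_r. Qed.

Lemma eval_local : exists k, 0 < k /\ forall f w m, entire f ->
  (forall v, Cmod (v - w) <= 1 -> gv f v <= m) -> gv f w <= k * m * 1.
Proof.
exists 1; split; first lra.
move=> f w m _ H; rewrite Rmult_1_l Rmult_1_r; apply: H.
rewrite (_ : (w - w)%C = 0%C); last by ring.
by rewrite Cmod_0; lra.
Qed.

Lemma deriv_local : exists k, 0 < k /\ forall f w m, entire f ->
  (forall v, Cmod (v - w) <= 1 -> gv f v <= m) -> gv (Cderiv f) w <= k * m * (1 + Cmod w).
Proof.
exists (2 * exp (3 / 2)); split; last exact: deriv_gv_bound.
by have := exp_pos (3 / 2); lra.
Qed.

Delimit Scope R_scope with R.

Theorem theorem1 (p q : R) (g psi : C -> C) :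
  (0 < p)%R -> (p <= q)%R ->
  entire g -> entire psi -> nonconstant g -> nonconstant psi ->
  (bounded_op p q (Vop g psi) <-> in_Linfty (Mgp g psi)) /\
  (compact_op p q (Vop g psi) <-> vanishes_at_infinity (Mgp g psi)) /\
  (bounded_op p q (Jop g psi) <-> in_Linfty (Mtgp g psi)) /\
  (compact_op p q (Jop g psi) <-> vanishes_at_infinity (Mtgp g psi)).
Proof.
move=> p0 pq Hg Hpsi ng npsi.
have g'0 := Cderiv_neq0 g Hg ng.
have g0 : exists z, g z <> 0%C.
  by apply: NNPP => H; apply: ng; exists 0%C => z; apply: NNPP => Hz; apply: H; exists z.
have id1 (w : C) : (1 <= 1)%R := Rle_refl 1.
have om1 (w : C) : (1 <= 1 + Cmod w)%R by have := Cmod_ge_0 w; lra.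
have Hg' := entire_Cderiv g Hg.
(* [Mgp] differs from [symbol] by a factor 1, hence the rewriting; [Mtgp], [Vop] and [Jop] are
   instances of [symbol] and [volterra] by conversion. *)
rewrite -symbol_Mgp; split.
  exact: (volterra_bounded_iff (fun f => f) _ _ _ p q p0 pq (fun f Hf => Hf) id1 (cont2_const 1) eval_local
    (eval_test p p0)).
split.
  exact: (volterra_compact_iff (fun f => f) _ _ _ p q p0 pq (fun f Hf => Hf) (fun f g _ _ z => erefl) id1 (cont2_const 1)
    eval_local (eval_test p p0)).
split.
  exact: (volterra_bounded_iff Cderiv _ _ _ p q p0 pq entire_Cderiv om1 cont2_1_Cmod deriv_local (deriv_test p p0)).
exact: (volterra_compact_iff Cderiv _ _ _ p q p0 pq entire_Cderiv Cderiv_minus om1 cont2_1_Cmod deriv_local (deriv_test p p0)).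
Qed.
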